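(* Let $\mathcal{A}$ be a unital separable approximately divisible C$^*$-algebra. If $\mathcal{A}$ has the approximation property (in the sense defined in the context), then $$\delta_{top}(x_1,\ldots,x_n)=1,$$ where $x_1,\ldots,x_n$ is any finite family of self-adjoint generators of $\mathcal{A}$.
   Context: Approximate divisibility. For a finite-dimensional C$^*$-algebra $\mathcal{B}\cong M_{k_1}(\mathbb{C})\oplus\cdots\oplus M_{k_r}(\mathbb{C})$, define $\mathrm{SubRank}(\mathcal{B})=\min\{k_1,\ldots,k_r\}$. A separable unital C$^*$-algebra $\mathcal{A}$ with unit $I_{\mathcal{A}}$ is approximately divisible if, for every $x_1,\ldots,x_n\in\mathcal{A}$ and $\varepsilon>0$, there is a finite-dimensional C$^*$-subalgebra $\mathcal{B}$ of $\mathcal{A}$ such that (1) $I_{\mathcal{A}}\in\mathcal{B}$; (2) $\mathrm{SubRank}(\mathcal{B})\ge 2$; (3) $\|x_iy-yx_i\|<\varepsilon$ for $i=1,\ldots,n$ and all $y\in\mathcal{B}$ with $\|y\|\le 1$. Topological free entropy dimension. Let $M_k^{s.a}(\mathbb{C})$ be the set of self-adjoint $k\times k$ complex matrices. On $M_k(\mathbb{C})^n$ use the norm $\|(A_1,\ldots,A_n)\|=\max_i\|A_i\|$ (operator norms). For $\mathcal{F}\subseteq M_k(\mathbb{C})^n$ and $\omega>0$, the covering number $\nu_\infty(\mathcal{F},\omega)$ is the minimal number of open $\omega$-balls in this norm whose union covers $\mathcal{F}$. Let $\{p_m\}_{m=1}^\infty$ be an enumeration of all noncommutative polynomials in $\mathbb{C}\langle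 X_1,\ldots,X_n\rangle$ whose coefficients have rational real and imaginary parts. For self-adjoint elements $x_1,\ldots,x_n$ of a unital C$^*$-algebra, $\varepsilon>0$ and positive integers $k,m$, let $$\Gamma_{top}(x_1,\ldots,x_n;k,\varepsilon,m)=\{(A_1,\ldots,A_n)\in (M_k^{s.a}(\mathbb{C}))^n:\ |\,\|p_j(A_1,\ldots,A_n)\|-\|p_j(x_1,\ldots,x_n)\|\,|<\varepsilon,\ 1\le j\le m\}.$$ Define $$\delta_{top}(x_1,\ldots,x_n;\omega)=\inf_{\varepsilon>0,\,m\in\mathbb{N}}\ \limsup_{k\to\infty}\frac{\log \nu_\infty(\Gamma_{top}(x_1,\ldots,x_n;k,\varepsilon,m),\omega)}{-k^2\log\omega},\qquad \delta_{top}(x_1,\ldots,x_n)=\limsup_{\omega\to0^+}\delta_{top}(x_1,\ldots,x_n;\omega),$$ with $\log 0=-\infty$. Approximation property. Suppose $\mathcal{A}$ is a unital C$^*$-algebra and $x_1,\ldots,x_n$ is a finite family of self-adjoint elements generating $\mathcal{A}$ as a C$^*$-algebra. If for any $m\in\mathbb{N}$ and $\varepsilon>0$ there is a sequence of positive integers $k_1<k_2<\cdots$ such that $\Gamma_{top}(x_1,\ldots,x_n;k_s,\varepsilon,m)\neq\emptyset$ for all $s\ge1$, then $\mathcal{A}$ is said to have the approximation property. *)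

(* Defs.v *)
Set Warnings "-notation-overridden,-notation-incompatible-prefix,-ambiguous-paths".
From HB Require Import structures.
From mathcomp Require Import all_boot all_order all_algebra.
From mathcomp Require Import complex finmap.
From mathcomp Require Import -(notations) monalg.
From mathcomp Require Import all_classical all_reals all_analysis.
Import numFieldNormedType.Exports.

Set Implicit Arguments.
Unset Strict Implicit.
Unset Printing Implicit Defensive.
Import Order.TTheory GRing.Theory Num.Theory.
Local Open Scope classical_set_scope.
Local Open Scope complex_scope.
Local Open Scope sesquilinear_scope.
Local Open Scope ring_scope.

(* Unital C*-algebras over R[i].  The norm is a real-valued field of the mixin
   rather than the one of completeNormedModType R[i], because Hierarchy Builder
   cannot join rings and normed modules below numDomainType.  The underlying
   algType enforces 1 != 0; the zero algebra is never approximately divisible,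
   its only subalgebra having no matrix summand. *)
HB.mixin Record isCStarAlgebra (R : realType) (A : Type)
    of GRing.Algebra R[i] A := {
  cnorm : A -> R ;
  star : A -> A ;
  cnorm0_eq0 : forall x : A, cnorm x = 0 -> x = 0 ;
  cnorm_leD : forall x y : A, cnorm (x + y) <= cnorm x + cnorm y ;
  cnormZ : forall (c : R[i]) (x : A), cnorm (c *: x) = Normc.normc c * cnorm x ;
  cnorm_leM : forall x y : A, cnorm (x * y) <= cnorm x * cnorm y ;
  cnorm_complete : forall u : nat -> A,
    (forall e : R, 0 < e -> exists N : nat, forall i j : nat,
      (N <= i)%N -> (N <= j)%N -> cnorm (u i - u j) < e) ->
    exists l : A, cnorm (u i - l) @[i --> \oo] --> (0 : R) ;
  starK : forall x : A, star (star x) = x ;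
  starD : forall x y : A, star (x + y) = star x + star y ;
  starZ : forall (c : R[i]) (x : A), star (c *: x) = (c^*)%C *: star x ;
  starM : forall x y : A, star (x * y) = star y * star x ;
  cnorm_starM : forall x : A, cnorm (star x * x) = cnorm x ^+ 2
}.

#[short(type="cstarAlgType")]
HB.structure Definition CStarAlgebra (R : realType) :=
  {A of isCStarAlgebra R A & GRing.Algebra R[i] A}.

Section CStarAlgebras.
Variables (R : realType) (A : cstarAlgType R).
Implicit Types (B D : set A).

Definition separable_cstar : Prop :=
  exists D, countable D /\
    forall (x : A) (e : R), 0 < e -> exists2 d, D d & cnorm (x - d) < e.

Definition self_adjoint (x : A) : Prop := star x = x.

(* Not required to contain the unit of A. *)
Definition cstar_subalgebra B : Prop :=
  [/\ B 0 /\ (forall x y, B x -> B y -> B (x + y)),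
      forall (c : R[i]) x, B x -> B (c *: x),
      forall x y, B x -> B y -> B (x * y),
      forall x, B x -> B (star x)
    & forall (u : nat -> A) (l : A), (forall i, B (u i)) ->
        cnorm (u i - l) @[i --> \oo] --> (0 : R) -> B l].

Definition finite_dimensional B : Prop :=
  exists (d : nat) (b : 'I_d -> A),
    forall x, B x -> exists c : 'I_d -> R[i], x = \sum_i c i *: b i.

(* f is a *-isomorphism from the direct sum of the M_(k i)(C) onto B. *)
Definition direct_sum_iso (r : nat) (k : 'I_r -> nat) B
    (f : (forall i, 'M[R[i]]_(k i)) -> A) : Prop :=
  [/\ forall (c : R[i]) M N,
        f (fun i => c *: M i + N i) = c *: f M + f N,
      forall M N, f (fun i => M i *m N i) = f M * f N,
      forall M, f (fun i => (M i)^t*) = star (f M),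
      injective f
    & range f = B].

Definition is_SubRank B (d : nat) : Prop :=
  exists (r : nat) (k : 'I_r.+1 -> nat) (f : (forall i, 'M[R[i]]_(k i)) -> A),
    [/\ forall i, (0 < k i)%N, direct_sum_iso B f
      & d = \big[minn/k ord0]_(i < r.+1) k i].

(* 0 when B is not isomorphic to a nonempty direct sum of matrix algebras. *)
Definition SubRank B : nat := xget 0%N [set d | is_SubRank B d].

Definition approximately_divisible : Prop :=
  forall (n : nat) (x : 'I_n -> A) (e : R), 0 < e ->
    exists B, [/\ cstar_subalgebra B /\ finite_dimensional B,
      B 1,
      (2 <= SubRank B)%N
    & forall (i : 'I_n) (y : A), B y -> cnorm y <= 1 ->
        cnorm (x i * y - y * x i) < e].

(* Generation as a unital C*-algebra.  This is weaker than requiring the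
   smallest C*-subalgebra containing the x i, unit or not, to be A. *)
Definition generates (n : nat) (x : 'I_n -> A) : Prop :=
  forall B, cstar_subalgebra B -> B 1 -> (forall i, B (x i)) -> B = setT.

End CStarAlgebras.

Section NoncommutativePolynomials.
Variables (R : realType) (n : nat).

(* C<X_1, .., X_n> as the monoid algebra of the free monoid on 'I_n. *)
Definition ncpoly : Type := monalg.malg (monalg.fmonom 'I_n) R[i].

(* Evaluation at x in a ring T into which the scalars are mapped by f. *)
Definition nceval (T : pzRingType) (f : R[i] -> T) (x : 'I_n -> T)
    (P : ncpoly) : T :=
  \sum_(w <- monalg.msupp P)
    f (monalg.mcoeff w P) * \prod_(i <- monalg.fmonom_val w) x i.

Definition rational_ncpoly (P : ncpoly) : Prop :=
  forall w, exists a b : rat, monalg.mcoeff w P = ratr a +i* ratr b.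

(* The enumeration is p 1, p 2, ...; the value p 0 is never used. *)
Definition is_enumeration (p : nat -> ncpoly) : Prop :=
  [set p j | j in [set j | (0 < j)%N]] = [set P | rational_ncpoly P].

End NoncommutativePolynomials.

Section MatrixTuples.
Variables (R : realType) (k : nat).

Definition l2norm (v : 'cV[R[i]]_k) : R :=
  Num.sqrt (\sum_i Normc.normc (v i 0) ^+ 2).

Definition opnorm (M : 'M[R[i]]_k) : R :=
  sup [set l2norm (M *m v) | v in [set v | l2norm v <= 1]].

Definition tuple_norm (n : nat) (M : 'I_n -> 'M[R[i]]_k) : R :=
  \big[Num.max/0]_(i < n) opnorm (M i).

(* +oo when F is not covered by finitely many balls. *)
Definition covering_number (n : nat) (F : set ('I_n -> 'M[R[i]]_k)) (w : R) :
    \bar R :=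
  ereal_inf [set (N%:R)%:E | N in [set N : nat |
    exists c : 'I_N -> 'I_n -> 'M[R[i]]_k,
      forall M, F M -> exists s, tuple_norm (fun i => M i - c s i) < w]].

End MatrixTuples.

Section TopologicalFreeEntropy.
Variables (R : realType) (A : cstarAlgType R).

Definition Gamma_top (n : nat) (p : nat -> ncpoly R n) (x : 'I_n -> A)
    (k : nat) (e : R) (m : nat) : set ('I_n -> 'M[R[i]]_k) :=
  [set M | (forall i, (M i)^t* = M i) /\
    forall j, (1 <= j <= m)%N ->
      `|opnorm (nceval (@scalar_mx _ k) M (p j))
        - cnorm (nceval (fun c => c%:A) x (p j))| < e].

Definition delta_top_at (n : nat) (p : nat -> ncpoly R n) (x : 'I_n -> A)
    (w : R) : \bar R :=
  ereal_inf [set y | exists (e : R) (m : nat), [/\ 0 < e, (0 < m)%N &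
    y = limn_esup (fun k : nat =>
      lne (covering_number (Gamma_top p x (k := k) e m) w)
        * ((- k%:R ^+ 2 * ln w)^-1)%:E)%E]].

Definition delta_top (n : nat) (p : nat -> ncpoly R n) (x : 'I_n -> A) :
    \bar R :=
  limf_esup (delta_top_at p x) 0^'+.

End TopologicalFreeEntropy.

Definition approximation_property (R : realType)
    (p : forall n, nat -> ncpoly R n) (A : cstarAlgType R) : Prop :=
  exists (n : nat) (x : 'I_n -> A),
    [/\ forall i, self_adjoint (x i), generates x &
      forall (m : nat) (e : R), (0 < m)%N -> 0 < e ->
        exists ks : nat -> nat,
          [/\ forall s, (0 < ks s)%N, forall s, (ks s < ks s.+1)%N &
            forall s, Gamma_top (p n) x (k := ks s) e m !=set0]].

(* Main.v *)
Set Warnings "-notation-overridden,-notation-incompatible-prefix,-ambiguous-paths".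
Require Import Defs.
From mathcomp Require Import all_boot all_order all_algebra.
From mathcomp Require Import complex finmap.
From mathcomp Require Import -(notations) monalg.
From mathcomp Require Import all_classical all_reals all_analysis.
From mathcomp Require Import ring lra zify.
(** Put d = 2 ^ s and eta = (2 / 3) ^ s.  Approximate divisibility enters through
    one consequence: there is a noncommutative polynomial q, hermitian on hermitian
    arguments, such that q(x) almost commutes with the generators while, for every
    fine enough microstate M, the matrix q(M) is close to a hermitian matrix
    H = sum_(j < d) j P_j whose P_j are orthogonal projections with sum 1 and rank at
    most eta k ([almost_central_family], [almost_central_diag]).  It is built by
    repeated halving.  A finite-dimensional algebra whose blocks all have size at
    least 2 contains a projection f and elements v, v', w, w' of norm at most 1 with
    1 - f = v f v' + w f w' and f = v' (1 - f) v ([approximate_halving]).  These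
    relations, and almost commutation with what has been built before, hold up to
    small errors in fine microstates.  A matrix at distance less than 1 from an
    idempotent has at least the rank of that idempotent ([rank_perturb]), so each
    halving cuts every P_j into two pieces of rank at most two thirds of the rank of
    P_j ([refine_family_step]).  In the C*-algebra itself only norms of polynomials
    are compared; the spectral theorem is applied to matrices.

    Upper bound ([delta_top_at_le]).  Cover the hermitian matrices of norm at most d,
    a real space of dimension k^2, by small cells.  For all microstates whose H lies
    in a given cell, the coordinates almost commute with one and the same H, hence
    are close to matrices that are block diagonal in an eigenbasis of H.  These form
    a real space of dimension at most eta k^2.  So the covering number at scale w is
    at most (c / w) ^ (k^2 + n eta k^2) with c independent of k and w.

    Lower bound ([delta_top_at_ge]).  The unitary orbit of a microstate consists of
    microstates.  Rotating by Cayley transforms of small hermitian matrices K that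
    are off-diagonal with respect to H, a space of dimension at least (1 - eta) k^2,
    moves q(M) by at least a constant times the change of K ([orbit_separated]), and
    q is Lipschitz with a constant independent of k.  So the covering number is at
    least (c / w) ^ ((1 - eta) k^2).  That there are microstates for infinitely many
    k is transported from the generators of the approximation property to x by
    polynomial approximation ([microstates_exist]).

    Both counts need the entropy of a ball of a D-dimensional real normed space with
    the exact exponent D and a base independent of the norm.  Instead of comparing
    volumes, [packing_bound] and [cells_lower_bound] iterate a packing or a covering
    j times across geometric scales, compare with a crude coordinatewise count, and
    let j tend to infinity, which removes the crude constants.

    Letting w tend to 0 and then s to infinity squeezes the dimension to 1. *)

Import numFieldNormedType.Exports.
Import Order.TTheory GRing.Theory Num.Theory.
Set Implicit Arguments.
Unset Strict Implicit.
Unset Printing Implicit Defensive.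
Local Open Scope classical_set_scope.
Local Open Scope complex_scope.
Local Open Scope sesquilinear_scope.
Local Open Scope ring_scope.

(** * Euclidean norms of complex vectors *)

Section EuclideanNorm.
Variable R : realType.
Notation C := R[i].
Notation nc := (@Normc.normc R).

Lemma nc_ge0 (z : C) : 0 <= nc z.
Proof. by case: z => a b; rewrite sqrtr_ge0. Qed.
Lemma nc0 : nc 0 = 0.
Proof. exact: Normc.normc0. Qed.
Lemma nc1 : nc 1 = 1.
Proof. exact: Normc.normc1. Qed.
Lemma ncM (x y : C) : nc (x * y) = nc x * nc y.
Proof. exact: Normc.normcM. Qed.
Lemma ncD (x y : C) : nc (x + y) <= nc x + nc y.
Proof. exact: le_normcD. Qed.
Lemma nc_conj (z : C) : nc (conjc z) = nc z.
Proof. by case: z => a b /=; rewrite sqrrN. Qed.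
Lemma nc_real (a : R) : nc a%:C = `|a|.
Proof. by rewrite /= expr0n /= addr0 sqrtr_sqr. Qed.
Lemma nc_eq0 (z : C) : nc z = 0 -> z = 0.
Proof. exact: Normc.eq0_normc. Qed.
Lemma nc_sum (I : Type) (r : seq I) (P : pred I) (F : I -> C) :
  nc (\sum_(i <- r | P i) F i) <= \sum_(i <- r | P i) nc (F i).
Proof.
elim/big_ind2 : _ => [|x a y b xa yb|//]; first by rewrite nc0.
exact: le_trans (ncD _ _) (lerD xa yb).
Qed.
Lemma nc_Re (z : C) : `|complex.Re z| <= nc z.
Proof. by case: z => a b /=; rewrite -sqrtr_sqr ler_wsqrtr// lerDl sqr_ge0. Qed.
Lemma nc_Im (z : C) : `|complex.Im z| <= nc z.
Proof. by case: z => a b /=; rewrite -sqrtr_sqr ler_wsqrtr// lerDr sqr_ge0. Qed.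
Lemma nc_le_ReIm (z : C) : nc z <= `|complex.Re z| + `|complex.Im z|.
Proof.
have -> : z = (complex.Re z)%:C + (0 +i* complex.Im z).
  by case: z => p q; apply/eqP; rewrite eq_complex /= addr0 add0r !eqxx.
apply: le_trans (ncD _ _) _; rewrite nc_real /= addr0 add0r lerD2l.
by rewrite expr0n /= add0r sqrtr_sqr.
Qed.
Lemma nc_sqr (z : C) : ((nc z) ^+ 2)%:C = conjc z * z.
Proof.
have := sqr_normc z; rewrite mulrC => <-.
by rewrite rmorphXn.
Qed.

Lemma real_cauchy_schwarz (I : finType) (a b : I -> R) :
  \sum_i a i * b i <= Num.sqrt (\sum_i a i ^+ 2) * Num.sqrt (\sum_i b i ^+ 2).
Proof.
set A := Num.sqrt _; set B := Num.sqrt _.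
have zero (c d : I -> R) : Num.sqrt (\sum_i c i ^+ 2) = 0 ->
    \sum_i c i * d i <= 0.
  move=> /eqP; rewrite sqrtr_eq0 => c0.
  rewrite big1 // => i _.
  have : c i ^+ 2 <= 0.
    by apply: le_trans c0; rewrite (bigD1 i) //= lerDl sumr_ge0 // => j _; rewrite sqr_ge0.
  move=> ci; have /eqP : c i ^+ 2 == 0 by rewrite eq_le ci sqr_ge0.
  by move=> /eqP; rewrite sqrf_eq0 => /eqP->; rewrite mul0r.
have [A0|A0] := eqVneq A 0; first by rewrite A0 mul0r; exact: zero.
have [B0|B0] := eqVneq B 0.
  rewrite B0 mulr0; under eq_bigr do rewrite mulrC; exact: zero.
have Ap : 0 < A by rewrite lt_def A0 sqrtr_ge0.
have Bp : 0 < B by rewrite lt_def B0 sqrtr_ge0.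
have sq (c : I -> R) : \sum_i c i ^+ 2 = Num.sqrt (\sum_i c i ^+ 2) ^+ 2.
  by rewrite sqr_sqrtr // sumr_ge0 // => j _; rewrite sqr_ge0.
have -> : A * B = \sum_i (a i ^+ 2 * (B / A) + b i ^+ 2 * (A / B)) / 2.
  rewrite -mulr_suml big_split /= -!mulr_suml (sq a) (sq b) -/A -/B; field.
  by rewrite A0 B0.
apply: ler_sum => i _; rewrite ler_pdivlMr //.
have : 0 <= (a i * B - b i * A) ^+ 2 / (A * B) by rewrite divr_ge0 ?sqr_ge0 ?mulr_ge0 ?ltW.
suff -> : (a i * B - b i * A) ^+ 2 / (A * B) =
   (a i ^+ 2 * (B / A) + b i ^+ 2 * (A / B)) - a i * b i * 2 by rewrite subr_ge0.
by field; rewrite A0 B0.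
Qed.

Section Vectors.
Variable k : nat.
Implicit Types u v : 'cV[C]_k.

Lemma l2norm_ge0 v : 0 <= l2norm v.
Proof. exact: sqrtr_ge0. Qed.

Lemma l2norm_sqr v : l2norm v ^+ 2 = \sum_i nc (v i 0) ^+ 2.
Proof. by rewrite sqr_sqrtr // sumr_ge0 // => i _; rewrite sqr_ge0. Qed.

Lemma l2norm0 : l2norm (0 : 'cV[C]_k) = 0.
Proof.
rewrite /l2norm big1 ?sqrtr0 // => i _; rewrite mxE.
by rewrite [Normc.normc _]nc0 expr0n.
Qed.

Lemma l2norm_eq0 v : l2norm v = 0 -> v = 0.
Proof.
move=> /eqP; rewrite sqrtr_eq0 => v0; apply/colP => i; rewrite mxE.
apply: nc_eq0; apply/eqP; rewrite -sqrf_eq0 eq_le sqr_ge0 andbT.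
apply: le_trans v0; rewrite (bigD1 i) //= lerDl sumr_ge0 // => j _.
by rewrite sqr_ge0.
Qed.

Lemma l2normZ (c : C) v : l2norm (c *: v) = nc c * l2norm v.
Proof.
rewrite /l2norm -(ger0_norm (nc_ge0 c)) -sqrtr_sqr -sqrtrM ?sqr_ge0 //.
by congr Num.sqrt; rewrite mulr_sumr; apply: eq_bigr => i _; rewrite mxE [Normc.normc _]ncM exprMn.
Qed.

Lemma l2normD u v : l2norm (u + v) <= l2norm u + l2norm v.
Proof.
rewrite -(@ler_pXn2r _ 2) ?nnegrE ?addr_ge0 ?l2norm_ge0 //.
rewrite sqrrD !l2norm_sqr.
have := real_cauchy_schwarz (fun i => nc (u i 0)) (fun i => nc (v i 0)).
rewrite -/(l2norm u) -/(l2norm v) => cs.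
apply: (@le_trans _ _ (\sum_i (nc (u i 0) + nc (v i 0)) ^+ 2)).
  apply: ler_sum => i _; rewrite mxE ler_pXn2r ?nnegrE ?addr_ge0 ?nc_ge0 //.
  exact: ncD.
under eq_bigr do rewrite sqrrD; rewrite !big_split /=.
by rewrite lerD2r lerD2l mulr2n lerD.
Qed.

Definition dot u v : C := (u^t* *m v) 0 0.

Lemma dotE u v : dot u v = \sum_i conjc (u i 0) * v i 0.
Proof. by rewrite /dot mxE; apply: eq_bigr => i _; rewrite !mxE. Qed.

Lemma dot_sqr v : dot v v = (l2norm v ^+ 2)%:C.
Proof.
rewrite dotE l2norm_sqr rmorph_sum; apply: eq_bigr => i _.
by rewrite -nc_sqr.
Qed.

Lemma dot_le u v : nc (dot u v) <= l2norm u * l2norm v.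
Proof.
rewrite dotE; apply: le_trans (nc_sum _ _ _) _.
apply: le_trans (real_cauchy_schwarz (fun i => nc (u i 0)) (fun i => nc (v i 0))).
by apply: ler_sum => i _; rewrite ncM nc_conj.
Qed.

Lemma l2norm_entry v i : nc (v i 0) <= l2norm v.
Proof.
rewrite -[leLHS](ger0_norm (nc_ge0 _)) -sqrtr_sqr ler_wsqrtr //.
by rewrite (bigD1 i) //= lerDl sumr_ge0 // => j _; rewrite sqr_ge0.
Qed.

Lemma l2norm_le_sum v : l2norm v <= \sum_i nc (v i 0).
Proof.
have -> : v = \sum_i (v i 0) *: delta_mx i 0.
  by rewrite {1}[v]matrix_sum_delta; apply: eq_bigr => i _; rewrite big_ord1.
have h (r : seq 'I_k) :
   l2norm (\sum_(i <- r) v i 0 *: delta_mx i 0) <= \sum_(i <- r) nc (v i 0).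
  elim/big_ind2 : _ => [|x a y b xa yb|i _]; first by rewrite l2norm0.
    exact: le_trans (l2normD _ _) (lerD xa yb).
  rewrite l2normZ ler_piMr ?nc_ge0 // /l2norm (bigD1 i) //= big1 => [|j /negbTE ji].
    by rewrite mxE !eqxx addr0 [Normc.normc _]nc1 expr1n sqrtr1.
  by rewrite mxE ji [Normc.normc _]nc0 expr0n.
apply: le_trans (h _) _; apply: ler_sum => i _; rewrite summxE (bigD1 i) //= big1.
  by rewrite !mxE !eqxx mulr1 addr0.
by move=> j /negbTE ji; rewrite !mxE eq_sym ji mulr0.
Qed.

End Vectors.
End EuclideanNorm.

(** * The operator norm *)

Section OpNorm.
Variable R : realType.
Notation C := R[i].
Notation nc := (@Normc.normc R).
Variable k : nat.
Implicit Types (M N : 'M[C]_k) (u v : 'cV[C]_k).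

Lemma opnorm_has_sup M :
  has_sup [set l2norm (M *m v) | v in [set v | l2norm v <= 1]].
Proof.
split; first by exists (l2norm (M *m 0)), 0 => //=; rewrite l2norm0 ler01.
exists (\sum_i \sum_j nc (M i j)) => _ [v v1 <-].
apply: le_trans (l2norm_le_sum _) _; apply: ler_sum => i _; rewrite mxE.
apply: le_trans (nc_sum _ _ _) _; apply: ler_sum => j _.
rewrite ncM ler_piMr ?nc_ge0 //; exact: le_trans (l2norm_entry _ _) v1.
Qed.

Lemma opnorm_ge0 M : 0 <= opnorm M.
Proof.
apply: (@le_trans _ _ (l2norm (M *m 0))); first exact: l2norm_ge0.
by apply: (sup_upper_bound (opnorm_has_sup M)); exists 0 => //=; rewrite l2norm0 ler01.
Qed.

Lemma opnormP M v : l2norm (M *m v) <= opnorm M * l2norm v.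
Proof.
have [v0|v0] := eqVneq (l2norm v) 0.
  by rewrite (l2norm_eq0 v0) mulmx0 !l2norm0 mulr0.
have vp : 0 < l2norm v by rewrite lt_def v0 l2norm_ge0.
rewrite -ler_pdivrMr //.
apply: (sup_upper_bound (opnorm_has_sup M)).
exists (((l2norm v)^-1)%:C *: v) => /=.
  by rewrite l2normZ nc_real ger0_norm ?invr_ge0 ?l2norm_ge0 // mulVf.
by rewrite -scalemxAr l2normZ nc_real ger0_norm ?invr_ge0 ?l2norm_ge0 // mulrC.
Qed.

Lemma opnorm_le M (c : R) : 0 <= c ->
  (forall v, l2norm (M *m v) <= c * l2norm v) -> opnorm M <= c.
Proof.
move=> c0 h; apply: ge_sup; first by case: (opnorm_has_sup M).
move=> _ [v /= v1 <-]; apply: le_trans (h v) _.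
by rewrite ler_piMr.
Qed.

Lemma opnorm0 : opnorm (0 : 'M[C]_k) = 0.
Proof.
apply/eqP; rewrite eq_le opnorm_ge0 andbT; apply: opnorm_le => // v.
by rewrite mul0mx l2norm0 mul0r.
Qed.

Lemma opnormD M N : opnorm (M + N) <= opnorm M + opnorm N.
Proof.
apply: opnorm_le; first by rewrite addr_ge0 ?opnorm_ge0.
move=> v; rewrite mulmxDl mulrDl; apply: le_trans (l2normD _ _) _.
by rewrite lerD ?opnormP.
Qed.

Lemma opnormM M N : opnorm (M *m N) <= opnorm M * opnorm N.
Proof.
apply: opnorm_le; first by rewrite mulr_ge0 ?opnorm_ge0.
move=> v; rewrite -mulmxA -mulrA; apply: le_trans (opnormP _ _) _.
by rewrite ler_wpM2l ?opnorm_ge0 ?opnormP.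
Qed.

Lemma opnormM_le M N (a b : R) : opnorm M <= a -> opnorm N <= b ->
  opnorm (M *m N) <= a * b.
Proof.
move=> Ma Nb; apply: le_trans (opnormM _ _) _.
by apply: ler_pM => //; exact: opnorm_ge0.
Qed.

Lemma opnormZ_le (c : C) M : opnorm (c *: M) <= nc c * opnorm M.
Proof.
apply: opnorm_le; first by rewrite mulr_ge0 ?opnorm_ge0 ?nc_ge0.
move=> v; rewrite -scalemxAl l2normZ -mulrA.
by rewrite ler_wpM2l ?nc_ge0 ?opnormP.
Qed.

Lemma opnormZ (c : C) M : opnorm (c *: M) = nc c * opnorm M.
Proof.
apply/eqP; rewrite eq_le opnormZ_le /=.
have [->|c0] := eqVneq c 0; first by rewrite nc0 mul0r opnorm_ge0.
have cp : 0 < nc c.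
  by rewrite lt_def nc_ge0 andbT; apply: contra_neq c0 => /nc_eq0.
rewrite -ler_pdivlMl // -{1}[M](scalerK c0).
by apply: le_trans (opnormZ_le _ _) _; rewrite Normc.normcV.
Qed.

Lemma opnormN M : opnorm (- M) = opnorm M.
Proof. by rewrite -scaleN1r opnormZ normcN nc1 mul1r. Qed.

Lemma opnormBC M N : opnorm (M - N) = opnorm (N - M).
Proof. by rewrite -opnormN opprB. Qed.

Lemma opnorm_scalar (c : C) : opnorm (c%:M : 'M[C]_k) <= nc c.
Proof.
apply: opnorm_le; first exact: nc_ge0.
by move=> v; rewrite mul_scalar_mx l2normZ.
Qed.

Lemma opnorm_entry M i j : nc (M i j) <= opnorm M.
Proof.
have := opnormP M (delta_mx j 0); rewrite -colE.
have -> : l2norm (delta_mx j 0 : 'cV[C]_k) = 1.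
  rewrite /l2norm (bigD1 j) //= big1 => [|i0 /negbTE ji].
    by rewrite mxE !eqxx addr0 [Normc.normc _]nc1 expr1n sqrtr1.
  by rewrite mxE ji [Normc.normc _]nc0 expr0n.
rewrite mulr1; apply: le_trans.
by apply: le_trans (l2norm_entry _ i); rewrite mxE.
Qed.

Lemma opnorm_le_entries M (c : R) : (forall i j, nc (M i j) <= c) -> 0 <= c ->
  opnorm M <= k%:R ^+ 2 * c.
Proof.
move=> h c0; apply: opnorm_le; first by rewrite mulr_ge0 ?exprn_ge0.
move=> v; apply: le_trans (l2norm_le_sum _) _.
have -> : k%:R ^+ 2 * c * l2norm v = \sum_(i < k) \sum_(j < k) c * l2norm v.
  by rewrite !sumr_const card_ord -mulrnA -[RHS]mulr_natl natrM -expr2 !mulrA.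
apply: ler_sum => i _; rewrite mxE.
apply: le_trans (nc_sum _ _ _) _; apply: ler_sum => j _.
by rewrite ncM ler_pM ?nc_ge0 ?l2norm_entry.
Qed.

Lemma dot_ct M u v : dot (M *m u) v = dot u (M^t* *m v).
Proof. by rewrite /dot trmx_mul map_mxM /= mulmxA. Qed.

Lemma ctK M : M^t*^t* = M.
Proof. exact: trmxCK. Qed.
Lemma ctM M N : (M *m N)^t* = N^t* *m M^t*.
Proof. by rewrite trmx_mul map_mxM. Qed.
Lemma ctD M N : (M + N)^t* = M^t* + N^t*.
Proof. by rewrite linearD /= map_mxD. Qed.
Lemma ctN M : (- M)^t* = - M^t*.
Proof. by rewrite linearN /= map_mxN. Qed.
Lemma ctB M N : (M - N)^t* = M^t* - N^t*.
Proof. by rewrite ctD ctN. Qed.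
Lemma ctZ (c : C) M : (c *: M)^t* = conjc c *: M^t*.
Proof. by rewrite linearZ /= map_mxZ. Qed.
Lemma ct_scalar (c : C) : (c%:M : 'M[C]_k)^t* = (conjc c)%:M.
Proof. by rewrite tr_scalar_mx map_scalar_mx. Qed.
Lemma ct1 : (1%:M : 'M[C]_k)^t* = 1%:M.
Proof. by rewrite ct_scalar conjc1. Qed.
Lemma ct_sum (I : Type) (r : seq I) (P : pred I) (F : I -> 'M[C]_k) :
  (\sum_(i <- r | P i) F i)^t* = \sum_(i <- r | P i) (F i)^t*.
Proof.
elim/big_rec2 : _ => [|i x y _ <-]; last by rewrite ctD.
by rewrite trmx0 map_mx0.
Qed.

(** With w = M^* v, |w|^2 = <M w, v> <= |M| |w| |v|. *)
Lemma opnorm_ct_le M : opnorm (M^t*) <= opnorm M.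
Proof.
apply: opnorm_le; first exact: opnorm_ge0.
move=> v; set w := M^t* *m v.
have [w0|w0] := eqVneq (l2norm w) 0.
  by rewrite w0 mulr_ge0 ?opnorm_ge0 ?l2norm_ge0.
have wp : 0 < l2norm w by rewrite lt_def w0 l2norm_ge0.
rewrite -(ler_pM2l wp) -expr2.
have -> : l2norm w ^+ 2 = nc (dot w w).
  by rewrite dot_sqr nc_real ger0_norm // sqr_ge0.
rewrite {2}/w -dot_ct; apply: le_trans (dot_le _ _) _.
rewrite mulrA (mulrC (l2norm w)) ler_wpM2r ?l2norm_ge0 //; exact: opnormP.
Qed.

Lemma opnorm_ct M : opnorm (M^t*) = opnorm M.
Proof.
apply: le_anti; apply/andP; split; first exact: opnorm_ct_le.
by have := opnorm_ct_le (M^t*); rewrite ctK.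
Qed.

Definition unitary M := M^t* *m M = 1%:M.

Lemma unitaryC M : unitary M -> M *m M^t* = 1%:M.
Proof. exact: mulmx1C. Qed.

Lemma unitary_ct M : unitary M -> unitary (M^t*).
Proof. by move=> h; rewrite /unitary ctK unitaryC. Qed.

Lemma l2norm_unitary M v : unitary M -> l2norm (M *m v) = l2norm v.
Proof.
move=> h; apply/eqP; rewrite -(@eqrXn2 _ 2) ?l2norm_ge0 //; apply/eqP.
apply: complexI; rewrite -!dot_sqr dot_ct mulmxA.
by rewrite -/(unitary M) in h *; rewrite h mul1mx.
Qed.

Lemma opnorm_unitary M : unitary M -> opnorm M <= 1.
Proof. by move=> h; apply: opnorm_le => // v; rewrite l2norm_unitary // mul1r. Qed.

Lemma opnorm_conj U M : unitary U -> opnorm (U *m M *m U^t*) = opnorm M.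
Proof.
move=> h.
have le N V : unitary V -> opnorm (V *m N *m V^t*) <= opnorm N.
  move=> hV; apply: opnorm_le; first exact: opnorm_ge0.
  move=> v; rewrite -!mulmxA l2norm_unitary //.
  apply: le_trans (opnormP _ _) _; rewrite l2norm_unitary //.
  exact: unitary_ct.
apply: le_anti; apply/andP; split; first exact: le.
have := le (U *m M *m U^t*) _ (unitary_ct h).
by rewrite ctK !mulmxA h mul1mx -mulmxA h mulmx1.
Qed.

Lemma opnorm_diag (d : 'rV[C]_k) (c : R) : 0 <= c ->
  (forall i, nc (d 0 i) <= c) -> opnorm (diag_mx d) <= c.
Proof.
move=> c0 h; apply: opnorm_le => // v.
rewrite -(@ler_pXn2r _ 2) ?nnegrE ?mulr_ge0 ?l2norm_ge0 //.
rewrite exprMn !l2norm_sqr mulr_sumr; apply: ler_sum => i _.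
rewrite mul_diag_mx mxE ncM exprMn ler_wpM2r ?sqr_ge0 //.
by rewrite ler_pXn2r ?nnegrE ?nc_ge0.
Qed.

Lemma opnorm_proj M : M^t* = M -> M *m M = M -> opnorm M <= 1.
Proof.
move=> Ms Mp; apply: opnorm_le => // v; rewrite mul1r.
have [w0|w0] := eqVneq (l2norm (M *m v)) 0; first by rewrite w0 l2norm_ge0.
have wp : 0 < l2norm (M *m v) by rewrite lt_def w0 l2norm_ge0.
rewrite -(ler_pM2l wp) -expr2.
have -> : l2norm (M *m v) ^+ 2 = nc (dot (M *m v) (M *m v)).
  by rewrite dot_sqr nc_real ger0_norm // sqr_ge0.
have -> : dot (M *m v) (M *m v) = dot v (M *m v).
  by rewrite dot_ct Ms mulmxA Mp.
by rewrite mulrC dot_le.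
Qed.

Lemma unitmx_ker M : (forall v, M *m v = 0 -> v = 0) -> M \in unitmx.
Proof.
move=> h; rewrite -unitmx_tr -row_free_unit -kermx_eq0.
apply/eqP/row_matrixP => i; rewrite row0.
apply: trmx_inj; rewrite trmx0; apply: h.
by rewrite -{1}[M]trmxK -trmx_mul -row_mul mulmx_ker row0 trmx0.
Qed.

(** A kernel vector v would satisfy |v| <= |1 - M| |v|. *)
Lemma unitmx_near1 M : opnorm (1%:M - M) < 1 -> M \in unitmx.
Proof.
move=> h; apply: unitmx_ker => v Mv0; apply: l2norm_eq0.
have := opnormP (1%:M - M) v; rewrite mulmxBl Mv0 subr0 mul1mx => le1.
apply/eqP; rewrite eq_le l2norm_ge0 andbT leNgt; apply/negP => v0.
by have := le_lt_trans le1 (_ : _ < 1 * l2norm v); rewrite ltr_pM2r // mul1r ltxx => /(_ h).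
Qed.

(** As Q (1 - (Q - X)) = Q X for idempotent Q, and 1 - (Q - X) is invertible,
    Q factors through X.  This turns approximate algebraic relations into exact
    inequalities between ranks. *)
Lemma rank_perturb (Q X : 'M[C]_k) : Q *m Q = Q -> opnorm (Q - X) < 1 ->
  (\rank Q <= \rank X)%N.
Proof.
move=> QQ h; set Z := 1%:M - (Q - X).
have Zu : Z \in unitmx by apply: unitmx_near1; rewrite /Z opprB addrC subrK.
have QZ : Q *m Z = Q *m X by rewrite /Z mulmxBr mulmx1 mulmxBr QQ opprB addrC subrK.
have -> : Q = Q *m X *m invmx Z by rewrite -QZ mulmxK.
rewrite -mulmxA; apply: leq_trans (mxrankM_maxr _ _) _.
exact: mxrankM_maxl.
Qed.

End OpNorm.

(** * Spectral calculus of hermitian matrices and orthogonal families of projections *)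

Section Spectral.
Variable R : realType.
Notation C := R[i].
Notation nc := (@Normc.normc R).
Variable k : nat.
Implicit Types (M N X F : 'M[C]_k) (l : 'I_k -> R).

Definition real_diag l : 'M[C]_k := diag_mx (\row_i (l i)%:C).

Lemma real_diagE l i j : real_diag l i j = if i == j then (l i)%:C else 0.
Proof. by rewrite !mxE; case: eqP => _; rewrite ?mulr1n ?mulr0n. Qed.

Lemma real_diag_ct l : (real_diag l)^t* = real_diag l.
Proof.
apply/matrixP => i j; rewrite !mxE eq_sym; case: eqP => [->|_].
  by rewrite !mulr1n; exact: conjc_real.
by rewrite !mulr0n conjC0.
Qed.

Lemma real_diagB l l' : real_diag l - real_diag l' = real_diag (fun i => l i - l' i).
Proof.
apply/matrixP => i j; rewrite mxE [in X in _ + X]mxE !real_diagE.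
by case: eqP => [_|_]; rewrite ?subr0 // rmorphB.
Qed.

Lemma real_diagM l l' : real_diag l *m real_diag l' = real_diag (fun i => l i * l' i).
Proof.
rewrite mulmx_diag; congr diag_mx; apply/rowP => i.
by rewrite !mxE rmorphM.
Qed.

Lemma opnorm_real_diag l c : 0 <= c -> (forall i, `|l i| <= c) ->
  opnorm (real_diag l) <= c.
Proof. by move=> c0 h; apply: opnorm_diag => // i; rewrite mxE [Normc.normc _]nc_real. Qed.

Lemma opnorm_real_diag_ge l i : `|l i| <= opnorm (real_diag l).
Proof.
by apply: le_trans (opnorm_entry _ i i); rewrite real_diagE eqxx [Normc.normc _]nc_real.
Qed.

Lemma comm_real_diag l X : X *m real_diag l = real_diag l *m X ->
  forall i j, l i != l j -> X i j = 0.
Proof.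
move=> /matrixP h i j lij; have := h i j.
rewrite mul_mx_diag mul_diag_mx !mxE mulrC => /eqP.
rewrite -subr_eq0 -mulrBl mulf_eq0 -rmorphB => /orP[/eqP e|/eqP//].
have := complexI e; rewrite -[X in _ = X]/0 => /eqP; rewrite subr_eq0 => /eqP e1.
by rewrite e1 eqxx in lij.
Qed.

Lemma real_diag_comm l X : (forall i j, l i != l j -> X i j = 0) ->
  X *m real_diag l = real_diag l *m X.
Proof.
move=> h; apply/matrixP => i j; rewrite mul_mx_diag mul_diag_mx !mxE mulrC.
by have [->//|/h->] := eqVneq (l i) (l j); rewrite !mulr0.
Qed.

Lemma sandwichK (U V D : 'M[C]_k) : V *m U = 1%:M -> V *m (U *m D *m V) *m U = D.
Proof. by move=> VU; rewrite !mulmxA VU mul1mx -mulmxA VU mulmx1. Qed.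

Lemma sandwichM (U V D E : 'M[C]_k) : V *m U = 1%:M ->
  U *m D *m V *m (U *m E *m V) = U *m (D *m E) *m V.
Proof. by move=> VU; rewrite !mulmxA -(mulmxA _ V) VU mulmx1. Qed.

Lemma sandwichB (U V D E : 'M[C]_k) :
  U *m D *m V - U *m E *m V = U *m (D - E) *m V.
Proof. by rewrite mulmxBr mulmxBl. Qed.

(** In an eigenbasis, X commutes with the first matrix iff its entries between
    different eigenvalues vanish; so X commutes with every function of that matrix. *)
Lemma comm_sandwich (U V X : 'M[C]_k) l g : V *m U = 1%:M -> U *m V = 1%:M ->
  (forall i j, l i = l j -> g i = g j) ->
  X *m (U *m real_diag l *m V) = (U *m real_diag l *m V) *m X ->
  X *m (U *m real_diag g *m V) = (U *m real_diag g *m V) *m X.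
Proof.
move=> VU UV lg; have [Y ->] : exists Y, X = U *m Y *m V.
  by exists (V *m X *m U); rewrite (sandwichK X UV).
rewrite (sandwichM Y _ VU) (sandwichM _ Y VU).
move=> /(congr1 (fun Z => V *m Z *m U)).
rewrite (sandwichK _ VU) (sandwichK _ VU) => Yl.
rewrite (sandwichM Y _ VU) (sandwichM _ Y VU).
rewrite real_diag_comm // => i j gij.
by apply: (comm_real_diag Yl); apply: contra_neq gij; exact: lg.
Qed.

Lemma herm_spectral M : M^t* = M ->
  exists U l, unitary U /\ M = U *m real_diag l *m U^t*.
Proof.
move=> Ms; have Mh : M \is hermsymmx.
  by apply/is_hermitianmxP; rewrite expr0 scale1r Ms.
have Mn := hermitian_normalmx Mh.
have /mxOverP Dr := hermitian_spectral_diag_real Mh.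
have Pu := spectral_unitarymx M.
exists ((spectralmx M)^t*), (fun i => complex.Re (spectral_diag M 0 i)); split.
  by rewrite /unitary ctK; apply/unitarymxP.
rewrite ctK -invmx_unitary //.
have -> : real_diag (fun i => complex.Re (spectral_diag M 0 i)) =
    diag_mx (spectral_diag M).
  by rewrite /real_diag; congr diag_mx; apply/rowP => i; rewrite mxE RRe_real.
exact: (orthomx_spectralP Mn).
Qed.

(** Round each eigenvalue to the nearest point of {0, 1}.  For an eigenvalue t the
    other point of {0, 1} is at distance at least 1/2, so t is at distance at most
    2 |t^2 - t| from the nearest one.  As a function of F, the result commutes with
    the commutant of F. *)
Lemma round_proj F : F^t* = F -> exists G : 'M[C]_k,
  [/\ G^t* = G, G *m G = G, opnorm (F - G) <= 2 * opnorm (F *m F - F)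
   & forall X, X *m F = F *m X -> X *m G = G *m X].
Proof.
move=> Fs; have [U [l [Uu ->]]] := herm_spectral Fs.
have UU := unitaryC Uu.
pose g i : R := if 1 / 2 < l i then 1 else 0.
exists (U *m real_diag g *m U^t*).
split.
- by rewrite !ctM ctK real_diag_ct mulmxA.
- rewrite (sandwichM _ _ Uu) real_diagM; congr (_ *m real_diag _ *m _); apply/funext => i.
  by rewrite /g; case: ifP; rewrite ?mulr1 ?mulr0.
- rewrite (sandwichM _ _ Uu) !sandwichB !opnorm_conj // real_diagM !real_diagB.
  apply: opnorm_real_diag; first by rewrite mulr_ge0 ?opnorm_ge0.
  move=> i; have := opnorm_real_diag_ge (fun i => l i * l i - l i) i.
  rewrite -(@ler_pM2l _ 2) // => h; apply: le_trans h.
  rewrite /g; have [h|h] := ltrP (1/2) (l i).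
    have -> : l i * l i - l i = (l i - 1) * l i by ring.
    rewrite normrM (ger0_norm (_ : 0 <= l i)); last by lra.
    have : 0 <= `|l i - 1| by []. nra.
  have -> : l i * l i - l i = - ((l i - 0) * (1 - l i)) by ring.
  rewrite normrN normrM (ger0_norm (_ : 0 <= 1 - l i)); last by lra.
  have : 0 <= `|l i - 0| by []. nra.
move=> X h.
apply: comm_sandwich h => // i j lij; by rewrite /g lij.
Qed.

(** The principal submatrix on S is an identity matrix. *)
Lemma rank_diag01 (S : {set 'I_k}) :
  (#|S| <= \rank (real_diag (fun i => (i \in S)%:R)))%N.
Proof.
set E := real_diag _; pose f (x : 'I_#|S|) := enum_val x.
have <- : \rank (1%:M : 'M[C]_#|S|) = #|S| by rewrite mxrank1.
have -> : 1%:M = mxsub f f E.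
  apply/matrixP => x y; rewrite [LHS]mxE [RHS]mxE real_diagE (inj_eq enum_val_inj).
  by rewrite (enum_valP x : f x \in S); case: eqP.
rewrite -{1}[E]mulmx1 mxsub_mul.
apply: leq_trans (mxrankM_maxl _ _) _.
by rewrite rowsubE mxrankM_maxr.
Qed.

End Spectral.

Section ProjectionFamilies.
Variable R : realType.
Notation C := R[i].
Notation nc := (@Normc.normc R).
Variable k : nat.

(** The index type is nat, with only the indices below d meaningful: halving every
    projection of a family then amounts to arithmetic on indices. *)
Definition proj_family (d : nat) (P : nat -> 'M[C]_k) :=
  [/\ forall j, (j < d)%N -> (P j)^t* = P j,
   forall i j, (i < d)%N -> (j < d)%N -> P i *m P j = if i == j then P i else 0
   & \sum_(j < d) P j = 1%:M].

(** One hermitian matrix that encodes the whole family, with spectrum in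
    {0, .., d - 1}; distinct eigenvalues differ by at least 1. *)
Definition weighted_sum (d : nat) (P : nat -> 'M[C]_k) := \sum_(j < d) j%:R *: P j.

(** The conditional expectation onto the commutant of the family. *)
Definition pinch (d : nat) (P : nat -> 'M[C]_k) (X : 'M[C]_k) := \sum_(j < d) P j *m X *m P j.

Variables (d : nat) (P : nat -> 'M[C]_k).
Implicit Types X : 'M[C]_k.
Hypothesis PP : proj_family d P.

Lemma weighted_sum_ct : (weighted_sum d P)^t* = weighted_sum d P.
Proof.
case: PP => Ps _ _; rewrite /weighted_sum ct_sum; apply: eq_bigr => j _.
by rewrite ctZ Ps // conjc_nat.
Qed.

Lemma proj_family_sumr j : (j < d)%N -> P j *m weighted_sum d P = j%:R *: P j.
Proof.
case: PP => _ Po _ jd; rewrite /weighted_sum mulmx_sumr (bigD1 (Ordinal jd)) //=.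
rewrite -scalemxAr Po // eqxx big1 ?addr0 // => i ij.
rewrite -scalemxAr Po // ifN ?scaler0 //.
by apply: contra ij => /eqP ij; apply/eqP/val_inj.
Qed.

Lemma proj_family_suml j : (j < d)%N -> weighted_sum d P *m P j = j%:R *: P j.
Proof.
case: PP => _ Po _ jd; rewrite /weighted_sum mulmx_suml (bigD1 (Ordinal jd)) //=.
rewrite -scalemxAl Po // eqxx big1 ?addr0 // => i ij.
rewrite -scalemxAl Po // ifN ?scaler0 //.
Qed.

Lemma proj_family_norm j : (j < d)%N -> opnorm (P j) <= 1.
Proof.
by case: PP => Ps Po _ jd; apply: opnorm_proj; rewrite ?Ps // Po // eqxx.
Qed.

Lemma proj_family_decomp X : X = \sum_(i < d) \sum_(j < d) P i *m X *m P j.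
Proof.
case: PP => _ _ P1; rewrite -{1}[X]mul1mx -{1}[_ *m X]mulmx1 -P1.
rewrite mulmx_suml mulmx_suml; apply: eq_bigr => i _.
by rewrite mulmx_sumr.
Qed.

Lemma opnorm_sum (I : Type) (r : seq I) (Q : pred I) (F : I -> 'M[C]_k) :
  opnorm (\sum_(i <- r | Q i) F i) <= \sum_(i <- r | Q i) opnorm (F i).
Proof.
elim/big_ind2 : _ => [|x a y b xa yb|//]; first by rewrite opnorm0.
exact: le_trans (opnormD _ _) (lerD xa yb).
Qed.

Lemma off_corner X i j : (i < d)%N -> (j < d)%N -> i != j ->
  opnorm (P i *m X *m P j) <= opnorm (X *m weighted_sum d P - weighted_sum d P *m X).
Proof.
move=> id jd ij; set H := weighted_sum d P.
have e : P i *m (X *m H - H *m X) *m P j = (j%:R - i%:R) *: (P i *m X *m P j).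
  rewrite mulmxBr mulmxBl !mulmxA proj_family_sumr // -(mulmxA _ H) proj_family_suml //.
  by rewrite -!scalemxAl -!scalemxAr scalerBl.
have c1 : 1 <= nc (j%:R - i%:R).
  rewrite -[j%:R](rmorph_nat (real_complex R)) -[i%:R](rmorph_nat (real_complex R)) -rmorphB nc_real.
  have [lt|lt|e0] := ltngtP i j; last by rewrite e0 eqxx in ij.
    rewrite ger0_norm ?subr_ge0 ?ler_nat 1?ltnW //.
    by rewrite lerBrDr addrC natr1 ler_nat.
  rewrite distrC ger0_norm ?subr_ge0 ?ler_nat 1?ltnW //.
  by rewrite lerBrDr addrC natr1 ler_nat.
apply: (@le_trans _ _ (opnorm (P i *m (X *m H - H *m X) *m P j))).
  by rewrite e opnormZ ler_peMl ?opnorm_ge0.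
rewrite -[leRHS]mulr1 -[X in X * _]mul1r.
apply: opnormM_le; last exact: proj_family_norm.
by apply: opnormM_le; first exact: proj_family_norm.
Qed.

(** The corner (i, j) of the commutator with the weighted sum is j - i times the
    corner (i, j) of X, hence at least as large when i and j differ.  Summing over
    the corners: X almost commutes with the weighted sum iff it is almost block
    diagonal. *)
Lemma off_pinch X :
  opnorm (X - pinch d P X) <= d%:R ^+ 2 * opnorm (X *m weighted_sum d P - weighted_sum d P *m X).
Proof.
have off := @off_corner X; have c0 := opnorm_ge0 (X *m weighted_sum d P - weighted_sum d P *m X).
move: (opnorm (X *m weighted_sum d P - weighted_sum d P *m X)) off c0 => c off c0.
have -> : X - pinch d P X = \sum_(i < d) \sum_(j < d | j != i) P i *m X *m P j.
  rewrite {1}[X]proj_family_decomp /pinch -sumrB; apply: eq_bigr => i _.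
  by rewrite (bigD1 i) //= addrC addrK.
apply: le_trans (opnorm_sum _ _ _) _.
have -> : d%:R ^+ 2 * c = \sum_(i < d) \sum_(j < d) c.
  by rewrite !sumr_const card_ord -mulrnA -[RHS]mulr_natl natrM.
apply: ler_sum => i _; apply: le_trans (opnorm_sum _ _ _) _.
rewrite [leRHS](bigID (fun j => j != i)) /= -[leLHS]addr0 lerD //.
  by apply: ler_sum => j ji; apply: off => //; rewrite eq_sym.
by apply: sumr_ge0 => j _.
Qed.

Lemma pinch_comm X j : (j < d)%N -> P j *m pinch d P X = pinch d P X *m P j.
Proof.
case: PP => _ Po _ jd; rewrite /pinch mulmx_sumr mulmx_suml.
apply: eq_bigr => i _; rewrite !mulmxA -[in RHS]mulmxA !Po //.
by rewrite (eq_sym j); case: eqP => [->|_]; rewrite // !mul0mx mulmx0.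
Qed.

Lemma pinch_ct X : (pinch d P X)^t* = pinch d P (X^t*).
Proof.
case: PP => Ps _ _; rewrite /pinch ct_sum; apply: eq_bigr => i _.
by rewrite !ctM Ps // mulmxA.
Qed.

(** Since P j H = j P j for the weighted sum H, an eigenvector of H for an eigenvalue
    outside {0, .., d - 1} would be killed by all P j, whose sum is 1; and the
    eigenvectors for j lie in the range of P j. *)
Lemma proj_family_diag : exists (U : 'M[C]_k) (l : 'I_k -> nat),
  [/\ unitary U, forall a, (l a < d)%N,
      weighted_sum d P = U *m real_diag (fun a => (l a)%:R) *m U^t*
    & forall j, (j < d)%N -> (#|[pred a | l a == j]| <= \rank (P j))%N].
Proof.
have [U [m [Uu He]]] := herm_spectral weighted_sum_ct.
have key j a b : (j < d)%N -> m a != j%:R -> (P j *m U) b a = 0.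
  move=> jd maj.
  have : P j *m U *m real_diag m = j%:R *: (P j *m U).
    rewrite scalemxAl -(proj_family_sumr jd) He !mulmxA -[_ *m U^t* *m U]mulmxA Uu.
    by rewrite mulmx1.
  move=> /matrixP/(_ b a); rewrite mul_mx_diag !mxE => /eqP.
  rewrite mulrC -[j%:R](rmorph_nat (real_complex R)) -subr_eq0 -mulrBl -rmorphB.
  rewrite mulf_eq0 => /orP[/eqP e|/eqP//].
  have /eqP := complexI e; rewrite subr_eq0 => /eqP e1.
  by rewrite e1 eqxx in maj.
have PU b a : U b a = \sum_(j < d) (P j *m U) b a.
  by case: PP => _ _ P1; rewrite -{1}[U]mul1mx -P1 mulmx_suml summxE.
have ex a : exists j : 'I_d, m a == j%:R.
  apply/not_existsP => h.
  have U0 b : U b a = 0.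
    rewrite PU big1 // => j _; apply: key => //; apply/negP; exact: h.
  have /matrixP/(_ a a) := Uu; rewrite !mxE eqxx big1 => [/esym/eqP|b _].
    by rewrite oner_eq0.
  by rewrite U0 mulr0.
pose l a := xchoose (ex a).
have lP a : m a = (l a)%:R by apply/eqP/(xchooseP (ex a)).
exists U, (fun a => nat_of_ord (l a)); split => //.
  by rewrite He; congr (_ *m real_diag _ *m _); apply/funext.
move=> j jd; pose S := [set a | nat_of_ord (l a) == j]%SET.
rewrite -cardsE; apply: leq_trans (rank_diag01 R S) _.
set E := real_diag _.
have UE : U *m E = P j *m U *m E.
  apply/matrixP => b a; rewrite !mul_mx_diag !mxE inE.
  have [lj|_] := eqVneq (nat_of_ord (l a)) j; last by rewrite !mulr0.
  congr (_ * _); rewrite PU (bigD1 (Ordinal jd)) //= big1 ?addr0; first by rewrite mxE.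
  move=> i ij; apply: key => //; rewrite lP eqr_nat lj.
  by apply: contra ij => /eqP ij; apply/eqP/val_inj.
have -> : E = U^t* *m (P j *m U *m E) by rewrite -UE mulmxA Uu mul1mx.
apply: leq_trans (mxrankM_maxr _ _) _.
by rewrite -mulmxA mxrankM_maxl.
Qed.

End ProjectionFamilies.

(** * Metric entropy of finite-dimensional normed spaces *)

Section Entropy.
Variable R : realType.

(** Used to remove constants: an inequality between powers that holds up to a factor
    independent of the exponent holds without that factor. *)
Lemma pow_bounded_le1 (x K : R) : 0 <= x -> (forall j : nat, x ^+ j <= K) -> x <= 1.
Proof.
move=> x0 h; rewrite leNgt; apply/negP => x1.
have bern (j : nat) : 1 + j%:R * (x - 1) <= x ^+ j.
  elim: j => [|j ih]; first by rewrite mul0r addr0 expr0.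
  rewrite exprS; apply: (@le_trans _ _ (x * (1 + j%:R * (x - 1)))); last first.
    by rewrite ler_pM2l // (lt_trans ltr01).
  rewrite -natr1; have j0 : 0 <= j%:R :> R by [].
  have : 0 <= j%:R * ((x - 1) * (x - 1)) by rewrite mulr_ge0 // mulr_ge0 // subr_ge0 ltW.
  nra.
have xp : 0 < x - 1 by rewrite subr_gt0.
have K0 : 0 <= K by apply: le_trans (h 0%N); rewrite expr0.
pose j := (Num.truncn (K / (x - 1))).+1.
have : K < j%:R * (x - 1).
  by rewrite -ltr_pdivrMr // truncnS_gt.
have := le_trans (bern j) (h j); lra.
Qed.

(** W is a real subspace of V on which the coordinates co are comparable with the norm
    nu, up to constants that the entropy estimates do not see. *)
Variables (V : lmodType R[i]) (nu : V -> R) (W : V -> Prop).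
Variables (I : finType) (co : V -> I -> R) (C1 C2 : R).
Hypothesis nuD : forall u v, nu (u + v) <= nu u + nu v.
Hypothesis nuZ : forall (a : R) v, nu (a%:C *: v) = `|a| * nu v.
Hypothesis W0 : W 0.
Hypothesis WD : forall u v, W u -> W v -> W (u + v).
Hypothesis WZ : forall (a : R) v, W v -> W (a%:C *: v).
Hypothesis C1p : 0 < C1.
Hypothesis C2p : 0 < C2.
Hypothesis co_le : forall u v i, W u -> W v -> `|co u i - co v i| <= C1 * nu (u - v).
Hypothesis nu_le : forall u v (s : R), W u -> W v ->
  (forall i, `|co u i - co v i| <= s) -> 0 <= s -> nu (u - v) <= C2 * s.
Hypothesis co0 : forall i, co 0 i = 0.
Hypothesis co_surj : forall t : I -> R, exists v, W v /\ forall i, co v i = t i.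

Let nuN v : nu (- v) = nu v.
Proof.
have -> : - v = (-1 : R)%:C *: v by rewrite rmorphN1 scaleN1r.
by rewrite nuZ normrN normr1 mul1r.
Qed.

Let nuBC u v : nu (u - v) = nu (v - u).
Proof. by rewrite -nuN opprB. Qed.

Let nu0 : nu 0 = 0.
Proof.
have -> : 0 = (0 : R)%:C *: (0 : V) by rewrite scaler0.
by rewrite nuZ normr0 mul0r.
Qed.

Let nu_ge0 v : 0 <= nu v.
Proof.
have := nuD v (- v); rewrite subrr nu0 nuN -mulr2n -mulr_natl; lra.
Qed.

Let nuB u v : nu (u - v) <= nu u + nu v.
Proof. by rewrite -(nuN v) nuD. Qed.

Definition separated (T : Type) (y : T -> V) (r s : R) :=
  (forall t, W (y t) /\ nu (y t) <= r) /\
  (forall t t', t <> t' -> s <= nu (y t - y t')).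

(** Pigeonhole on a grid of coordinates.  The factors C1 and C2, which may depend on
    the dimension, make this bound crude. *)
Lemma separated_card (T : finType) (y : T -> V) (r s : R) : 0 <= r -> 0 < s ->
  separated y r s -> #|T|%:R <= (4 * C1 * C2 * r / s + 1) ^+ #|I|.
Proof.
move=> r0 s0 [yW ys].
(* b is the step of the grid: coordinates at distance at most b keep two points
   closer than s. *)
have [b [bp b1 b2]] : exists b : R, [/\ 0 < b, C2 * b = s / 2 &
    4 * C1 * C2 * r / s = 2 * C1 * r / b].
  exists (s / (2 * C2)); split; first by rewrite divr_gt0 // mulr_gt0.
    by field; rewrite gt_eqF.
  by field; rewrite !gt_eqF.
have cob t i : `|co (y t) i| <= C1 * r.
  have [h1 h2] := yW t.
  have := co_le i h1 W0; rewrite co0 !subr0 => /le_trans; apply.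
  by rewrite ler_pM2l.
pose m := Num.truncn (2 * C1 * r / b).
pose g t i : nat := Num.truncn ((co (y t) i + C1 * r) / b).
have cop t i : 0 <= (co (y t) i + C1 * r) / b.
  rewrite divr_ge0 ?(ltW bp) //.
  have := cob t i; rewrite ler_norml => /andP[]; lra.
have gm t i : (g t i < m.+1)%N.
  rewrite ltnS /g /m le_truncn // ler_pM2r ?invr_gt0 //.
  have := cob t i; rewrite ler_norml => /andP[]; lra.
pose h t : {ffun I -> 'I_m.+1} := [ffun i => Ordinal (gm t i)].
have hi : injective h.
  move=> t t' e; apply: contrapT => /ys; apply/negP; rewrite -ltNge.
  have [Wt _] := yW t; have [Wt' _] := yW t'.
  apply: (@le_lt_trans _ _ (C2 * b)).
    apply: nu_le => //; last exact: ltW.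
    move=> i; have /(congr1 (@nat_of_ord _)) : h t i = h t' i by rewrite e.
    rewrite !ffunE /= => ge.
    have /andP[a1 a2] := truncn_itv (cop t i).
    have /andP[a3 a4] := truncn_itv (cop t' i).
    move: a1 a2; rewrite -/(g t i) ge => a1 a2; move: a3 a4; rewrite -/(g t' i) => a3 a4.
    move: a1 a2 a3 a4; rewrite -natr1 !ler_pdivlMr // !ltr_pdivrMr //.
    by rewrite ler_norml; move=> *; apply/andP; split; nra.
  rewrite b1; lra.
have := leq_card h hi; rewrite card_ffun card_ord -(ler_nat R) natrX => /le_trans; apply.
apply: lerXn2r; rewrite ?nnegrE //.
  by rewrite addr_ge0 // divr_ge0 ?(ltW s0) // !mulr_ge0 ?(ltW C1p) ?(ltW C2p).
rewrite -natr1 lerD2r /m.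
rewrite b2.
by rewrite truncn_le divr_ge0 ?(ltW bp) // !mulr_ge0 ?(ltW C1p).
Qed.

(** The points are the sums y_(a_0) + q y_(a_1) + .. + q^(j-1) y_(a_(j-1)), where
    the ratio q = s / (8 r) is so small that the terms after the first index at
    which two such sums differ cannot undo half of the separation there. *)
Lemma separated_iter (M : nat) (y : 'I_M -> V) (r s : R) j : 0 < s -> s <= r ->
  separated y r s ->
  exists (T : finType) (z : T -> V), #|T| = (M ^ j)%N /\
    separated z (2 * r) ((s / (8 * r)) ^+ j * (s / 2)).
Proof.
move=> s0 sr [yW ys]; have r0 : 0 < r by exact: lt_le_trans sr.
set d := s / (8 * r).
have dp : 0 < d by rewrite divr_gt0 // mulr_gt0.
have dr : d * (8 * r) = s by rewrite /d divfK // gt_eqF // mulr_gt0.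
have d1 : d <= 1 / 8 by rewrite /d ler_pdivrMr ?mulr_gt0 //; lra.
elim: j => [|j [T [z [cT [zW zs]]]]].
  (* A single point: separation is void. *)
  exists unit, (fun=> 0); rewrite card_unit expn0; split => //; split.
    by move=> _; rewrite nu0 mulr_ge0 // ltW.
  by case; case.
exists ('I_M * T)%type, (fun p => y p.1 + d%:C *: z p.2); split.
  by rewrite card_prod card_ord cT expnS.
split.
  move=> [a t] /=; have [? ya] := yW a; have [? zt] := zW t; split.
    by apply: WD => //; exact: WZ.
  apply: le_trans (nuD _ _) _; rewrite nuZ ger0_norm ?(ltW dp) //.
  have := nu_ge0 (z t); nra.
move=> [a t] [a' t'] /= ne.
have [e|/eqP na] := eqVneq a a'.
  subst a'; have nt : t <> t' by move=> tt; apply: ne; rewrite tt.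
  rewrite opprD addrACA subrr add0r -scalerBr nuZ ger0_norm ?(ltW dp) // exprS -mulrA.
  by rewrite ler_pM2l // zs.
have h1 := ys _ _ na.
have h2 : nu (d%:C *: (z t - z t')) <= d * (4 * r).
  rewrite nuZ ger0_norm ?(ltW dp) // ler_pM2l //; apply: le_trans (nuB _ _) _.
  have [_ ?] := zW t; have [_ ?] := zW t'; lra.
have h3 : nu (y a - y a') <=
    nu (y a + d%:C *: z t - (y a' + d%:C *: z t')) + nu (d%:C *: (z t - z t')).
  have -> : y a - y a' = y a + d%:C *: z t - (y a' + d%:C *: z t') - d%:C *: (z t - z t').
    by rewrite scalerBr opprD addrACA addrK.
  exact: nuB.
have h4 : d ^+ j.+1 * (s / 2) <= s / 2.
  rewrite ler_piMl ?exprn_ile1 ?(ltW dp) //; lra.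
lra.
Qed.

(** The crude bound for the M ^ j points of [separated_iter], which are separated by
    (s / (8 r)) ^ j * (s / 2), compares M ^ j with (8 r / s) ^ (j #|I|) up to a factor
    independent of j. *)
Lemma packing_bound (M : nat) (y : 'I_M -> V) (r s : R) : 0 < s -> s <= r ->
  separated y r s -> M%:R <= (8 * r / s) ^+ #|I|.
Proof.
move=> s0 sr ysep; have r0 : 0 < r by exact: lt_le_trans sr.
set d := s / (8 * r).
have dp : 0 < d by rewrite divr_gt0 // mulr_gt0.
have d1 : d <= 1 by rewrite /d ler_pdivrMr ?mulr_gt0 //; lra.
have -> : 8 * r / s = d^-1 by rewrite /d invf_div.
rewrite exprVn -[leRHS]mul1r ler_pdivlMr ?exprn_gt0 //.
pose K := 16 * C1 * C2 * r / s + 1.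
have K1 : 1 <= K.
  by rewrite /K lerDr divr_ge0 ?(ltW s0) // !mulr_ge0 ?(ltW C1p) ?(ltW C2p) ?(ltW r0).
apply: (@pow_bounded_le1 _ (K ^+ #|I|)).
  by rewrite mulr_ge0 ?exprn_ge0 // ltW.
move=> j; have [T [z [cT zsep]]] := separated_iter j s0 sr ysep.
rewrite -/d in zsep.
have djp : 0 < d ^+ j by rewrite exprn_gt0.
have := separated_card _ _ zsep; rewrite cT natrX => /(_ _ _)/wrap[||h].
- by rewrite mulr_ge0 // ltW.
- by rewrite mulr_gt0 // divr_gt0.
rewrite exprMn exprAC -ler_pdivlMr ?exprn_gt0 // -exprVn -exprMn.
apply: le_trans h _; apply: lerXn2r; rewrite ?nnegrE.
- by apply: addr_ge0 => //; apply: divr_ge0; apply: ltW; rewrite !mulr_gt0 ?divr_gt0.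
- by rewrite mulr_ge0 // ?invr_ge0 ltW // (lt_le_trans ltr01).
rewrite /K [leRHS]mulrDl mul1r lerD //.
  rewrite le_eqVlt; apply/orP; left; apply/eqP.
  by field; rewrite !gt_eqF.
by rewrite invf_ge1 // exprn_ile1 // ltW.
Qed.

(** A separated set with the largest possible number of points is a net. *)
Lemma ball_cover (r s : R) : 0 < s -> s <= r -> exists (M : nat) (c : nat -> V),
  [/\ M%:R <= (8 * r / s) ^+ #|I|, forall t, W (c t) &
   forall v, W v -> nu v <= r -> exists2 t, (t < M)%N & nu (v - c t) < s].
Proof.
move=> s0 sr; have r0 : 0 < r by exact: lt_le_trans sr.
pose pk M := `[< exists y : nat -> V, separated (fun t : 'I_M => y t) r s >].
have p0 : exists M, pk M.
  by exists 0%N; apply/asboolP; exists (fun=> 0); split => [] [].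
have pb M : pk M -> (M <= Num.truncn ((8 * r / s) ^+ #|I|))%N.
  move=> /asboolP[y h]; have := packing_bound s0 sr h.
  by move=> /le_truncn; rewrite natrK.
case: (ex_maxnP p0 pb) => M /asboolP[y ysep] Mmax.
exists M, (fun t => if (t < M)%N then y t else 0); split.
- exact: packing_bound ysep.
- by move=> t; case: ifP => // tM; case: ysep => /(_ (Ordinal tM))[].
move=> v Wv vr; apply: contrapT => nex.
suff /Mmax : pk M.+1 by rewrite ltnn.
apply/asboolP; exists (fun t => if (t < M)%N then y t else v).
have far t (tM : (t < M)%N) : s <= nu (v - y t).
  by rewrite leNgt; apply/negP => h; apply: nex; exists t => //; rewrite tM.
case: ysep => yW ys; split.
  by move=> t; case: ifP => // tM; have := yW (Ordinal tM).
move=> t t' tt'; case: ifP => tM; case: ifP => tM'.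
- by apply: (ys (Ordinal tM) (Ordinal tM')) => -[] /val_inj.
- by rewrite nuBC far.
- exact: far.
case: tt'; apply/val_inj.
have e (u : 'I_M.+1) : (u < M)%N = false -> nat_of_ord u = M.
  by move=> uM; apply/eqP; rewrite eqn_leq -ltnS ltn_ord leqNgt uM.
exact: etrans (e _ tM) (esym (e _ tM')).
Qed.

(** The cells give N centres whose balls of radius r th cover the ball of radius r;
    rescaling, N ^ j balls of radius r th ^ j cover it.  Each of these contains at
    most one point of a coordinate grid of step comparable to r th ^ j, and the ball
    of radius r contains (c / th ^ j) ^ #|I| such points with c independent of j. *)
Lemma cells_lower_bound (N : nat) (s : V -> nat) (r th : R) : 0 < r -> 0 < th ->
  (forall v, W v -> nu v <= r -> (s v < N)%N) ->
  (forall u v, W u -> W v -> nu u <= r -> nu v <= r -> s u = s v ->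
     nu (u - v) <= r * th) ->
  th ^- #|I| <= N%:R.
Proof.
move=> r0 th0 sN ssep.
have /choice[c cP] (t : nat) : exists c, W c /\
    forall v, W v -> nu v <= r -> s v = t -> nu (v - c) <= r * th.
  have [[u [Wu ur ut]]|no] := pselect (exists u, [/\ W u, nu u <= r & s u = t]).
    by exists u; split => // v Wv vr vt; apply: ssep => //; rewrite ut vt.
  exists 0; split => // v Wv vr vt; case: no; by exists v.
have it j : exists (T : finType) (z : T -> V), [/\ #|T| = (N ^ j)%N,
    forall t, W (z t) & forall v, W v -> nu v <= r ->
      exists t, nu (v - z t) <= r * th ^+ j].
  elim: j => [|j [T [z [cT zW zc]]]].
    exists unit, (fun=> 0); rewrite card_unit; split => // v Wv vr.
    by exists tt; rewrite subr0 expr0 mulr1.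
  exists ('I_N * T)%type, (fun p : 'I_N * T => c p.1 + th%:C *: z p.2); split.
  - by rewrite card_prod card_ord cT expnS.
  - by move=> [a t] /=; apply: WD; [case: (cP a)|exact: WZ].
  move=> v Wv vr; have sv := sN v Wv vr.
  have [Wc /(_ v Wv vr erefl) h1] := cP (s v).
  pose w := (th^-1)%:C *: (v - c (s v)).
  have Ww : W w.
    apply/WZ/WD => //; have -> : - c (s v) = (-1 : R)%:C *: c (s v) by rewrite rmorphN1 scaleN1r.
    exact: WZ.
  have wr : nu w <= r.
    by rewrite nuZ ger0_norm ?invr_ge0 ?(ltW th0) // mulrC ler_pdivrMr.
  have [t ht] := zc w Ww wr.
  exists (Ordinal sv, t) => /=.
  have -> : v - (c (s v) + th%:C *: z t) = th%:C *: (w - z t).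
    by rewrite scalerBr /w scalerA -rmorphM mulfV ?gt_eqF // scale1r opprD addrA.
  by rewrite nuZ ger0_norm ?(ltW th0) // exprS mulrCA ler_pM2l.
have grid j : (4 * C1 * C2)^-1 ^+ #|I| * th ^- (j * #|I|) <= N%:R ^+ j.
  have [T [z [cT zW zc]]] := it j.
  have thj : 0 < th ^+ j by rewrite exprn_gt0.
  have [b [bp bE]] : exists b : R, 0 < b /\ b = 4 * C1 * (r * th ^+ j).
    by exists (4 * C1 * (r * th ^+ j)); rewrite !mulr_gt0.
  (* Multiples of b up to m as coordinates keep the point in the ball of radius r. *)
pose m := Num.truncn (r / (C2 * b)).
  have m0 : 0 <= r / (C2 * b) by rewrite divr_ge0 ?ltW // mulr_gt0.
  have /choice[v vP] (g : {ffun I -> 'I_m.+1}) : exists v, W v /\ forall i, co v i = (g i)%:R * b.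
    exact: co_surj.
  have vr g : nu (v g) <= r.
    have [Wv gv] := vP g; rewrite -[v g]subr0.
    apply: (@le_trans _ _ (C2 * (m%:R * b))).
      apply: nu_le => //; last by rewrite mulr_ge0 // ltW.
      move=> i; rewrite co0 subr0 gv ger0_norm ?mulr_ge0 ?(ltW bp) //.
      by rewrite ler_pM2r // ler_nat -ltnS.
    rewrite mulrCA -ler_pdivlMr ?mulr_gt0 //.
    by rewrite truncn_le.
  have /choice[f fP] g : exists t, nu (v g - z t) <= r * th ^+ j.
    by apply: zc => //; case: (vP g).
  have fi : injective f.
    move=> g g' e; apply/ffunP => i; apply: contrapT => ne.
    have [Wv gv] := vP g; have [Wv' gv'] := vP g'.
    have h1 : nu (v g - v g') <= 2 * (r * th ^+ j).
      have -> : v g - v g' = (v g - z (f g)) - (v g' - z (f g')).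
        by rewrite e opprB addrA subrK.
      apply: le_trans (nuB _ _) _; have := fP g; have := fP g'; lra.
    have := co_le i Wv Wv'; rewrite gv gv' -mulrBl normrM (ger0_norm (ltW bp)).
    have : 1 <= `|(g i)%:R - (g' i)%:R : R|.
      have [lt|lt|/val_inj//] := ltngtP (g i) (g' i).
        rewrite distrC ger0_norm ?subr_ge0 ?ler_nat 1?ltnW //.
        by rewrite lerBrDr addrC natr1 ler_nat.
      rewrite ger0_norm ?subr_ge0 ?ler_nat 1?ltnW //.
      by rewrite lerBrDr addrC natr1 ler_nat.
    have : 0 < r * th ^+ j by rewrite mulr_gt0.
    move: h1; rewrite bE; move: (nu _) (`|_|) (r * _) => x a q h1 q0 a1 h.
    have : C1 * x <= C1 * (2 * q) by rewrite ler_pM2l.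
    have : 4 * C1 * q <= a * (4 * C1 * q) by rewrite ler_peMl // !mulr_ge0 // ltW.
    have : 0 < C1 * q by rewrite mulr_gt0.
    lra.
  have := leq_card f fi; rewrite card_ffun card_ord cT -(ler_nat R) !natrX.
  apply: le_trans; rewrite exprM -exprVn -exprMn.
  apply: lerXn2r; rewrite ?nnegrE //.
    by rewrite mulr_ge0 // invr_ge0 ?(ltW thj) // !mulr_ge0 // ltW.
  have -> : (4 * C1 * C2)^-1 / th ^+ j = r / (C2 * b).
    by rewrite bE; field; rewrite !gt_eqF.
  by rewrite ltW // truncnS_gt.
set K := (4 * C1 * C2)^-1 ^+ #|I| in grid.
have Kp : 0 < K by rewrite exprn_gt0 // invr_gt0 !mulr_gt0.
clearbody K; have thI : 0 < th ^+ #|I| by rewrite exprn_gt0.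
have N0 : 0 < N%:R :> R.
  rewrite ltr0n; apply: leq_ltn_trans (sN 0 W0 _) => //.
  by rewrite nu0 ltW.
rewrite -[leLHS]mul1r ler_pdivrMr //.
rewrite -[leLHS]invr1 -[leRHS]invrK lef_pV2 ?posrE ?ltr01 ?invr_gt0 ?mulr_gt0 //.
apply: (@pow_bounded_le1 _ (K^-1)).
  by rewrite invr_ge0 mulr_ge0 // ltW.
move=> j; rewrite exprVn lef_pV2 ?posrE ?exprn_gt0 ?mulr_gt0 //.
by rewrite exprMn -exprM mulnC -ler_pdivrMr ?exprn_gt0.
Qed.

End Entropy.

(** * Metric entropy of hermitian matrices with prescribed support *)

Section HermitianEntropy.
Variable R : realType.
Notation C := R[i].
Notation nc := (@Normc.normc R).
Variable k : nat.
Variable S : rel 'I_k.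
Hypothesis Ssym : symmetric S.

Definition herm_supp (M : 'M[C]_k) :=
  M^t* = M /\ forall a b, ~~ S a b -> M a b = 0.

Definition support_card : nat := #|[pred x : 'I_k * 'I_k | S x.1 x.2]|.

Let I : finType := {x : 'I_k * 'I_k | S x.1 x.2}.

Let cardI : #|I| = support_card.
Proof. by rewrite /support_card card_sig. Qed.

(** Half the sum of the real and the imaginary part of an entry.  The entries (a, b)
    and (b, a) of a hermitian matrix are conjugate, so their two values of cf recover
    both, and a hermitian matrix supported on S has exactly one real coordinate for
    each pair in S. *)
Let cf (M : 'M[C]_k) (x : 'I_k * 'I_k) : R :=
  (complex.Re (M x.1 x.2) + complex.Im (M x.1 x.2)) / 2.

Let co (M : 'M[C]_k) (x : I) : R := cf M (val x).

Lemma herm_suppD M N : herm_supp M -> herm_supp N -> herm_supp (M + N).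
Proof.
move=> [Ms M0] [Ns N0]; split; first by rewrite ctD Ms Ns.
by move=> a b ab; rewrite mxE M0 // N0 // addr0.
Qed.

Lemma herm_suppZ (x : R) M : herm_supp M -> herm_supp (x%:C *: M).
Proof.
move=> [Ms M0]; split; first by rewrite ctZ Ms conjc_real.
by move=> a b ab; rewrite mxE M0 // mulr0.
Qed.

Lemma herm_supp0 : herm_supp 0.
Proof. by split; [rewrite trmx0 map_mx0|move=> a b _; rewrite mxE]. Qed.

Let cfB M N x : cf M x - cf N x = cf (M - N) x.
Proof.
rewrite /cf !mxE; move: (M _ _) (N _ _) => [a b] [c d] /=; by field.
Qed.

Let co_le (M N : 'M[C]_k) x : herm_supp M -> herm_supp N ->
  `|co M x - co N x| <= 1 * opnorm (M - N).
Proof.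
move=> _ _; rewrite mul1r /co cfB /cf.
apply: le_trans (opnorm_entry (M - N) (val x).1 (val x).2).
move: ((M - N) _ _) => z; rewrite normrM (@ger0_norm _ 2^-1) ?invr_ge0 // ler_pdivrMr //.
apply: le_trans (ler_normD _ _) _.
have := nc_Re z; have := nc_Im z; lra.
Qed.

Let herm_swap (M : 'M[C]_k) a b : M^t* = M -> M b a = conjc (M a b).
Proof. by move=> /matrixP/(_ b a); rewrite !mxE. Qed.

Let nu_le (M N : 'M[C]_k) (s : R) : herm_supp M -> herm_supp N ->
  (forall x, `|co M x - co N x| <= s) -> 0 <= s ->
  opnorm (M - N) <= (4 * k%:R ^+ 2 + 1) * s.
Proof.
move=> hM hN h s0.
have [Xs X0] : herm_supp (M - N).
  apply: herm_suppD => //; rewrite -scaleN1r -(rmorphN1 (real_complex R)).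
  exact: herm_suppZ.
set X := M - N in Xs X0 *.
have hX a b : S a b -> `|cf X (a, b)| <= s.
  by move=> Sab; have := h (Sub (a, b) Sab); rewrite /co /= cfB.
apply: (@le_trans _ _ (k%:R ^+ 2 * (4 * s))).
  apply: opnorm_le_entries; last by rewrite mulr_ge0.
  move=> a b; have [Sab|/X0->] := boolP (S a b); last by rewrite [Normc.normc _]nc0 mulr_ge0.
  have Sba : S b a by rewrite Ssym.
  have := hX _ _ Sab; have := hX _ _ Sba.
  rewrite /cf (herm_swap a b Xs) => h1 h2.
  apply: le_trans (nc_le_ReIm _) _; move: h1 h2; case: (X a b) => p q /= h1 h2.
  move: h1 h2; rewrite !ler_norml => /andP[? ?] /andP[? ?].
  have : `|p| <= 2 * s by rewrite ler_norml; apply/andP; split; lra.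
  have : `|q| <= 2 * s by rewrite ler_norml; apply/andP; split; lra.
  lra.
have : 0 <= k%:R ^+ 2 :> R by rewrite exprn_ge0.
nra.
Qed.

Let co0 x : co 0 x = 0.
Proof. by rewrite /co /cf !mxE /= addr0 mul0r. Qed.

Let co_surj (t : I -> R) : exists M, herm_supp M /\ forall x, co M x = t x.
Proof.
pose g a b : R := oapp t 0 (insub (a, b)).
have g0 a b : ~~ S a b -> g a b = 0.
  by move=> Sab; rewrite /g insubF //; apply: negbTE.
exists (\matrix_(a, b) ((g a b + g b a) +i* (g a b - g b a))); split; first split.
- apply/matrixP => a b; rewrite !mxE; apply/eqP.
  by rewrite [_ == _]eq_complex /= opprB addrC !eqxx.
- by move=> a b Sab; rewrite mxE !g0 ?subr0 ?addr0 // Ssym.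
move=> [[a b] Sab]; rewrite /co /cf !mxE /=.
have -> : g a b + g b a + (g a b - g b a) = 2 * g a b by ring.
rewrite mulrAC mulfV // mul1r /g.
by rewrite insubT.
Qed.

Let C2p : 0 < 4 * k%:R ^+ 2 + 1 :> R.
Proof. by rewrite ltr_wpDl // mulr_ge0 // exprn_ge0. Qed.

Let nuZ (a : R) (M : 'M[C]_k) : opnorm (a%:C *: M) = `|a| * opnorm M.
Proof. by rewrite opnormZ nc_real. Qed.

Lemma herm_cover (r s : R) : 0 < s -> s <= r ->
  exists (N : nat) (c : nat -> 'M[C]_k), N%:R <= (8 * r / s) ^+ support_card /\
   forall M, herm_supp M -> opnorm M <= r ->
     exists2 t, (t < N)%N & opnorm (M - c t) < s.
Proof.
move=> s0 sr.
have [N [c [h1 _ h2]]] := ball_cover (@opnormD _ _) nuZ herm_supp0 herm_suppD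
  herm_suppZ ltr01 C2p co_le nu_le co0 s0 sr.
by exists N, c; rewrite -cardI.
Qed.

Lemma herm_cells (N : nat) (s : 'M[C]_k -> nat) (r th : R) : 0 < r -> 0 < th ->
  (forall M, herm_supp M -> opnorm M <= r -> (s M < N)%N) ->
  (forall M M', herm_supp M -> herm_supp M' -> opnorm M <= r -> opnorm M' <= r ->
     s M = s M' -> opnorm (M - M') <= r * th) ->
  th ^- support_card <= N%:R.
Proof.
rewrite -cardI.
exact: (cells_lower_bound (@opnormD _ _) nuZ herm_supp0 herm_suppD
  herm_suppZ ltr01 C2p co_le nu_le co0 co_surj).
Qed.

End HermitianEntropy.

(** * Noncommutative rational polynomials as terms *)

Section NormedAlgebra.
Variable R : realType.
Notation C := R[i].
Notation nc := (@Normc.normc R).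

(** Common to the C*-algebra and to matrices of every size, including size 0, where
    the unit has norm 0.  Estimates for terms proved from these laws have constants
    that do not depend on the size. *)
Record normed_alg (T : pzRingType) (f : C -> T) (nu : T -> R) : Prop := NormedAlg {
  na_f0 : f 0 = 0;
  na_f1 : f 1 = 1;
  na_fD : forall a b, f (a + b) = f a + f b;
  na_fM : forall a b, f (a * b) = f a * f b;
  na_fC : forall a y, f a * y = y * f a;
  na_ge0 : forall x, 0 <= nu x;
  na_D : forall x y, nu (x + y) <= nu x + nu y;
  na_M : forall x y, nu (x * y) <= nu x * nu y;
  na_N : forall x, nu (- x) = nu x;
  na_f : forall a, nu (f a) <= nc a }.

Lemma matrix_normed k : normed_alg (@scalar_mx C k) (@opnorm R k).
Proof.
split.
- exact: raddf0.
- by [].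
- exact: raddfD.
- exact: scalar_mxM.
- by move=> a y; apply/esym; exact: scalar_mxC.
- exact: opnorm_ge0.
- exact: opnormD.
- exact: opnormM.
- exact: opnormN.
- exact: opnorm_scalar.
Qed.

Section CStar.
Variable A : cstarAlgType R.
Implicit Types x y : A.

Lemma cnormN x : cnorm (- x) = cnorm x.
Proof. by rewrite -scaleN1r cnormZ normcN nc1 mul1r. Qed.

Lemma cnorm0 : cnorm (0 : A) = 0.
Proof. by rewrite -(scale0r (0 : A)) cnormZ nc0 mul0r. Qed.

Lemma cnorm_ge0 x : 0 <= cnorm x.
Proof.
have := cnorm_leD x (- x); rewrite subrr cnorm0 cnormN -mulr2n -mulr_natl; lra.
Qed.

Lemma star1 : star (1 : A) = 1.
Proof.
by rewrite -[LHS]mulr1 -[X in _ * X]starK -starM mulr1 starK.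
Qed.

(** The norm c of the unit satisfies c = c^2. *)
Lemma cnorm1 : cnorm (1 : A) <= 1.
Proof.
have := cnorm_starM (1 : A); rewrite star1 mulr1 expr2.
have := cnorm_ge0 1; nra.
Qed.

Lemma cnorm_star x : cnorm (star x) = cnorm x.
Proof.
have le y : cnorm y <= cnorm (star y).
  have := cnorm_starM y; have := cnorm_leM (star y) y.
  have := cnorm_ge0 y; have := cnorm_ge0 (star y).
  move=> h1 h2 h3 h4; rewrite leNgt; apply/negP => h5; nra.
by apply: le_anti; apply/andP; split; [rewrite -[leRHS](congr1 _ (starK x)) le|exact: le].
Qed.

Lemma cstar_normed : normed_alg (fun c => c%:A : A) (@cnorm R A).
Proof.
split.
- exact: scale0r.
- exact: scale1r.
- by move=> a b; rewrite scalerDl.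
- by move=> a b; rewrite -scalerAl mul1r scalerA.
- by move=> a y; rewrite mulr_algl mulr_algr.
- exact: cnorm_ge0.
- exact: cnorm_leD.
- exact: cnorm_leM.
- exact: cnormN.
- move=> a; rewrite cnormZ ler_piMr ?nc_ge0 //; exact: cnorm1.
Qed.

End CStar.
End NormedAlgebra.

Section Terms.
Variable R : realType.
Notation C := R[i].
Notation nc := (@Normc.normc R).

(** Rational polynomials as syntax, which makes adjoints, substitution and estimates
    by induction available.  They define the same functions as the polynomials with
    rational coefficients, by [term_of_ncpoly] and [ncpoly_of_term]. *)
Inductive term (n : nat) : Type :=
  | TVar of 'I_n
  | TConst of rat & rat
  | TAdd of term n & term n
  | TMul of term n & term n.

Definition rat_complex (a b : rat) : C := ratr a +i* ratr b.

Fixpoint teval (n : nat) (T : pzRingType) (f : C -> T) (x : 'I_n -> T) (t : term n) : T :=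
  match t with
  | TVar i => x i
  | TConst a b => f (rat_complex a b)
  | TAdd s t => teval f x s + teval f x t
  | TMul s t => teval f x s * teval f x t
  end.

Fixpoint tstar (n : nat) (t : term n) : term n :=
  match t with
  | TVar i => TVar i
  | TConst a b => TConst n a (- b)
  | TAdd s t => TAdd (tstar s) (tstar t)
  | TMul s t => TMul (tstar t) (tstar s)
  end.

Fixpoint tsubst (m n : nat) (s : 'I_m -> term n) (t : term m) : term n :=
  match t with
  | TVar i => s i
  | TConst a b => TConst n a b
  | TAdd u v => TAdd (tsubst s u) (tsubst s v)
  | TMul u v => TMul (tsubst s u) (tsubst s v)
  end.

Lemma teval_subst m n (s : 'I_m -> term n) (T : pzRingType) (f : C -> T) x t :
  teval f x (tsubst s t) = teval f (fun i => teval f x (s i)) t.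
Proof. by elim: t => //= u -> v ->. Qed.

Lemma term_of_ncpoly n (P : ncpoly R n) : rational_ncpoly P ->
  exists t : term n, forall (T : pzRingType) (f : C -> T) (nu : T -> R) x,
    normed_alg f nu -> nceval f x P = teval f x t.
Proof.
move=> Pr; rewrite /nceval.
elim: (enum_fset (monalg.msupp P)) => [|w s [t ht]].
  exists (TConst n 0 0) => T f nu x na.
  by rewrite big_nil /= /rat_complex !raddf0 (na_f0 na).
have [a [b wab]] := Pr w.
have [u hu] : exists u : term n, forall (T : pzRingType) (f : C -> T) (nu : T -> R) x,
    normed_alg f nu -> \prod_(i <- monalg.fmonom_val w) x i = teval f x u.
  elim: (monalg.fmonom_val w) => [|i v [u hu]].
    exists (TConst n 1 0) => T f nu x na.
    by rewrite big_nil /= /rat_complex rmorph1 raddf0 (na_f1 na).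
  by exists (TMul (TVar i) u) => T f nu x na; rewrite big_cons /= (hu _ _ _ _ na).
exists (TAdd (TMul (TConst n a b) u) t) => T f nu x na.
by rewrite big_cons /= (ht _ _ _ _ na) (hu _ _ _ _ na) wab.
Qed.

Definition poly_list n := seq (C * seq 'I_n).

Definition leval n (T : pzRingType) (f : C -> T) (x : 'I_n -> T) (l : poly_list n) : T :=
  \sum_(p <- l) f p.1 * \prod_(i <- p.2) x i.

(** The expansion of a term into monomials, through which it becomes an element of
    the free algebra. *)
Fixpoint tlist n (t : term n) : poly_list n :=
  match t with
  | TVar i => [:: (1, [:: i])]
  | TConst a b => [:: (rat_complex a b, [::])]
  | TAdd s t => tlist s ++ tlist t
  | TMul s t => [seq (p.1 * q.1, p.2 ++ q.2) | p <- tlist s, q <- tlist t]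
  end.

Lemma leval_tlist n (T : pzRingType) (f : C -> T) (nu : T -> R) (x : 'I_n -> T) t :
  normed_alg f nu -> leval f x (tlist t) = teval f x t.
Proof.
move=> na; rewrite /leval; elim: t => [i|a b|s IHs t IHt|s IHs t IHt] /=.
- by rewrite big_seq1 (na_f1 na) mul1r big_seq1.
- by rewrite big_seq1 big_nil mulr1.
- by rewrite big_cat IHs IHt.
rewrite big_allpairs_dep /= -IHs -IHt mulr_suml; apply: eq_bigr => p _.
rewrite mulr_sumr; apply: eq_bigr => q _.
rewrite (na_fM na) big_cat /= -!mulrA; congr (_ * _).
by rewrite !mulrA (na_fC na).
Qed.

Section Lpoly.
Variable n : nat.
Local Notation malg := (monalg.malg (monalg.fmonom 'I_n) R[i]).

Definition lpoly (l : poly_list n) : malg :=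
  \sum_(p <- l) monalg.mkmalgU (monalg.FMonom p.2) p.1.

Variables (T : pzRingType) (f : C -> T) (nu : T -> R) (x : 'I_n -> T).
Hypothesis na : normed_alg f nu.

Lemma nceval_wide (d : {fset monalg.fmonom 'I_n}) (P : malg) :
  (monalg.msupp P `<=` d)%fset ->
  nceval f x P = \sum_(w <- d) f (monalg.mcoeff w P) * \prod_(i <- monalg.fmonom_val w) x i.
Proof.
move=> le; rewrite /nceval; apply: big_fset_incl => // w wd.
by move/monalg.mcoeff_outdom => ->; rewrite (na_f0 na) mul0r.
Qed.

Lemma ncevalD (P Q : malg) : nceval f x (P + Q : malg) = nceval f x P + nceval f x Q.
Proof.
pose d := (monalg.msupp P `|` monalg.msupp Q)%fset.
rewrite (@nceval_wide d (P + Q)) ?monalg.msuppD_le //.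
rewrite (@nceval_wide d P) ?fsubsetUl // (@nceval_wide d Q) ?fsubsetUr //.
rewrite -big_split /=; apply: eq_bigr => w _.
by rewrite monalg.mcoeffD (na_fD na) mulrDl.
Qed.

Lemma ncevalU (c : C) (w : seq 'I_n) :
  nceval f x (monalg.mkmalgU (monalg.FMonom w) c) = f c * \prod_(i <- w) x i.
Proof.
rewrite (nceval_wide (monalg.msuppU_le)) big_seq_fset1.
by rewrite monalg.mcoeffU eqxx mulr1n.
Qed.

Lemma nceval_lpoly l : nceval f x (lpoly l) = leval f x l.
Proof.
rewrite /lpoly /leval; elim: l => [|p l ih].
  rewrite !big_nil (nceval_wide (d := fset0)) ?monalg.msupp0 //.
  by rewrite big_seq_fset0.
by rewrite !big_cons ncevalD ncevalU ih.
Qed.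

End Lpoly.

Lemma rat_complex_add a b c d : rat_complex a b + rat_complex c d = rat_complex (a + c) (b + d).
Proof. by rewrite /rat_complex !rmorphD. Qed.

Lemma rat_complex_mul a b c d :
  rat_complex a b * rat_complex c d = rat_complex (a * c - b * d) (a * d + b * c).
Proof. by rewrite /rat_complex rmorphB rmorphD !rmorphM. Qed.

Lemma rational_lpoly n (t : term n) : rational_ncpoly (lpoly (tlist t)).
Proof.
have hl (l : poly_list n) : (forall p, p \in l -> exists a b, p.1 = rat_complex a b) ->
    rational_ncpoly (lpoly l).
  rewrite /lpoly; elim: l => [|p l ih] h w.
    by exists 0, 0; rewrite big_nil monalg.mcoeff0 !raddf0.
  have [a [b pab]] := h p (mem_head _ _).
  have [|a' [b' e]] := ih _ w; first by move=> q ql; apply: h; rewrite inE ql orbT.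
  rewrite big_cons monalg.mcoeffD monalg.mcoeffU e pab.
  case: eqP => _; last by exists a', b'; rewrite mulr0n add0r.
  by exists (a + a'), (b + b'); rewrite mulr1n; exact: rat_complex_add.
apply: hl; elim: t => [i|a b|s IHs t IHt|s IHs t IHt] /= p.
- by rewrite inE => /eqP->; exists 1, 0; rewrite /rat_complex rmorph1 raddf0.
- by rewrite inE => /eqP->; exists a, b.
- by rewrite mem_cat => /orP[]; [exact: IHs|exact: IHt].
move=> /allpairsP[[u v] /= [us vt ->]] /=.
have [a [b ->]] := IHs _ us; have [c [d ->]] := IHt _ vt.
by rewrite rat_complex_mul; do 2 eexists.
Qed.

Lemma ncpoly_of_term n (t : term n) : exists2 P : ncpoly R n, rational_ncpoly P &
  forall (T : pzRingType) (f : C -> T) (nu : T -> R) x,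
    normed_alg f nu -> nceval f x P = teval f x t.
Proof.
exists (lpoly (tlist t)); first exact: rational_lpoly.
by move=> T f nu x na; rewrite (nceval_lpoly _ na) (leval_tlist _ _ na).
Qed.

Lemma term_of_enumeration n (p : nat -> ncpoly R n) j : is_enumeration p -> (0 < j)%N ->
  exists t : term n, forall (T : pzRingType) (f : C -> T) (nu : T -> R) z,
    normed_alg f nu -> nceval f z (p j) = teval f z t.
Proof.
move=> hp j0; apply: term_of_ncpoly.
have : [set P | rational_ncpoly P] (p j); last by [].
by rewrite -hp; exists j.
Qed.

Lemma teval_star n (T : pzRingType) (f : C -> T) (s : T -> T) (x : 'I_n -> T) t :
  (forall a, s (f a) = f (conjc a)) -> (forall a b, s (a + b) = s a + s b) ->
  (forall a b, s (a * b) = s b * s a) -> (forall i, s (x i) = x i) ->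
  s (teval f x t) = teval f x (tstar t).
Proof.
move=> sf sD sM sx; elim: t => //= [a b|u hu v hv|u hu v hv].
- by rewrite sf /rat_complex rmorphN.
- by rewrite sD hu hv.
- by rewrite sM hu hv.
Qed.

(** The hermitian part of a term. *)
Definition tsym n (t : term n) : term n :=
  TMul (TConst n (1 / 2) 0) (TAdd t (tstar t)).

Lemma tstarK n : involutive (@tstar n).
Proof. by elim=> //= [a b|u hu v hv|u hu v hv]; rewrite ?opprK ?hu ?hv. Qed.

Lemma teval_tsym n (T : pzRingType) (f : C -> T) nu (s : T -> T) (x : 'I_n -> T) t :
  normed_alg f nu ->
  (forall a, s (f a) = f (conjc a)) -> (forall a b, s (a + b) = s a + s b) ->
  (forall a b, s (a * b) = s b * s a) -> (forall i, s (x i) = x i) ->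
  s (teval f x (tsym t)) = teval f x (tsym t).
Proof.
move=> na sf sD sM sx; rewrite (teval_star _ sf sD sM sx) /= tstarK oppr0.
by rewrite -(na_fC na) addrC.
Qed.

Lemma teval_bound n (r : R) (t : term n) : exists2 B : R, 0 <= B &
  forall (T : pzRingType) (f : C -> T) nu (x : 'I_n -> T),
  normed_alg f nu -> (forall i, nu (x i) <= r) -> nu (teval f x t) <= B.
Proof.
elim: t => [i|a b|u [B B0 hB] v [D D0 hD]|u [B B0 hB] v [D D0 hD]].
- exists (Num.max 0 r); first by rewrite le_max lexx.
  by move=> T f nu x na h /=; rewrite le_max h orbT.
- exists (nc (rat_complex a b)); first exact: nc_ge0.
  by move=> T f nu x na h /=; exact: (na_f na).
- exists (B + D); first exact: addr_ge0.
  move=> T f nu x na h /=; apply: le_trans (na_D na _ _) _.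
  by apply: lerD; [exact: hB na _|exact: hD na _].
- exists (B * D); first exact: mulr_ge0.
  move=> T f nu x na h /=; apply: le_trans (na_M na _ _) _.
  by apply: ler_pM; rewrite ?(na_ge0 na) //; [exact: hB na _|exact: hD na _].
Qed.

(** The constant depends on the term and on the radius of the ball only. *)
Lemma teval_lip n (r : R) (t : term n) : exists2 L : R, 0 <= L &
  forall (T : pzRingType) (f : C -> T) nu (x y : 'I_n -> T) (e : R),
  normed_alg f nu -> (forall i, nu (x i) <= r) -> (forall i, nu (y i) <= r) ->
  0 <= e -> (forall i, nu (x i - y i) <= e) ->
  nu (teval f x t - teval f y t) <= L * e.
Proof.
elim: t => [i|a b|u [L L0 hL] v [K K0 hK]|u [L L0 hL] v [K K0 hK]].
- by exists 1 => // T f nu x y e na hx hy e0 h; rewrite mul1r; exact: h.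
- exists 0 => // T f nu x y e na hx hy e0 h; rewrite mul0r /= subrr.
  by rewrite -(na_f0 na); apply: le_trans (na_f na _) _; rewrite nc0.
- exists (L + K); first exact: addr_ge0.
  move=> T f nu x y e na hx hy e0 h /=; rewrite opprD addrACA mulrDl.
  apply: le_trans (na_D na _ _) _.
  by apply: lerD; [exact: (hL _ _ _ _ _ _ na hx hy e0 h)|exact: (hK _ _ _ _ _ _ na hx hy e0 h)].
have [B B0 hB] := teval_bound r u; have [D D0 hD] := teval_bound r v.
exists (L * D + B * K); first by rewrite addr_ge0 ?mulr_ge0.
move=> T f nu x y e na hx hy e0 h /=.
set a := teval f x u; set b := teval f x v.
set a' := teval f y u; set b' := teval f y v.
have -> : a * b - a' * b' = (a - a') * b + a' * (b - b').
  by rewrite mulrBl mulrBr addrA subrK.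
have -> : (L * D + B * K) * e = L * e * D + B * (K * e) by ring.
apply: le_trans (na_D na _ _) _; apply: lerD.
  apply: le_trans (na_M na _ _) _.
  by apply: ler_pM; rewrite ?(na_ge0 na) //; [exact: (hL _ _ _ _ _ _ na hx hy e0 h)|exact: hD na _].
apply: le_trans (na_M na _ _) _.
by apply: ler_pM; rewrite ?(na_ge0 na) //; [exact: hB na _|exact: (hK _ _ _ _ _ _ na hx hy e0 h)].
Qed.

End Terms.

(** * Density of terms and properties of fine microstates *)

Section Density.
Variable R : realType.
Notation C := R[i].
Notation nc := (@Normc.normc R).

Lemma rational_dense (c : C) (e : R) : 0 < e -> exists a b, nc (c - rat_complex R a b) < e.
Proof.
case: c => p q e0.
have [a] := @rat_in_itvoo R (p - e / 2) (p + e / 2) ltac:(lra).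
have [b] := @rat_in_itvoo R (q - e / 2) (q + e / 2) ltac:(lra).
rewrite !in_itv /= => /andP[b1 b2] /andP[a1 a2].
exists a, b; have h := nc_le_ReIm (Complex p q - rat_complex R a b).
apply: (le_lt_trans h) => /=; clear h.
have : `|p - ratr a| < e / 2 by rewrite ltr_norml; apply/andP; split; lra.
have : `|q - ratr b| < e / 2 by rewrite ltr_norml; apply/andP; split; lra.
lra.
Qed.

Variables (A : cstarAlgType R) (n : nat) (x : 'I_n -> A).
Hypothesis xsa : forall i, self_adjoint (x i).

Notation ev t := (teval (fun c => c%:A : A) x t).

Definition term_closure (a : A) :=
  forall e : R, 0 < e -> exists t, cnorm (a - ev t) < e.

Lemma star_ev t : star (ev t) = ev (tstar t).
Proof.
apply: teval_star => //.
- by move=> a; rewrite starZ star1.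
- exact: starD.
- exact: starM.
Qed.

Lemma starN (a : A) : star (- a) = - star a.
Proof. by rewrite -scaleN1r starZ rmorphN1 scaleN1r. Qed.

Lemma cnormBC (a b : A) : cnorm (a - b) = cnorm (b - a).
Proof. by rewrite -cnormN opprB. Qed.

Lemma cnorm_triangle (a b c : A) : cnorm (a - c) <= cnorm (a - b) + cnorm (b - c).
Proof. by apply: le_trans (cnorm_leD _ _); rewrite addrA subrK. Qed.

Lemma term_closure_var i : term_closure (x i).
Proof. by move=> e e0; exists (TVar i); rewrite subrr cnorm0. Qed.

Lemma term_closureD a b : term_closure a -> term_closure b -> term_closure (a + b).
Proof.
move=> ha hb e e0; have [|s hs] := ha (e / 2); first by rewrite divr_gt0.
have [|t ht] := hb (e / 2); first by rewrite divr_gt0.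
exists (TAdd s t) => /=; rewrite opprD addrACA.
apply: le_lt_trans (cnorm_leD _ _) _; lra.
Qed.

Lemma term_closure_const (c : C) : term_closure (c%:A).
Proof.
move=> e e0; have [a [b h]] := rational_dense c e0.
exists (TConst n a b) => /=; rewrite -scalerBl; apply: le_lt_trans h.
exact: (na_f (cstar_normed A)).
Qed.

Lemma term_closureM a b : term_closure a -> term_closure b -> term_closure (a * b).
Proof.
move=> ha hb e e0.
have na := cnorm_ge0 a; have nb := cnorm_ge0 b.
pose K := 1 + cnorm a + cnorm b.
have Kp : 0 < K by rewrite /K; lra.
pose d := Num.min 1 (e / (2 * K)).
have dp : 0 < d by rewrite lt_min ltr01 divr_gt0 // mulr_gt0.
have d1 : d <= 1 by rewrite ge_min lexx.
have dK : d * (2 * K) <= e by rewrite -ler_pdivlMr ?mulr_gt0 // ge_min lexx orbT.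
have [s hs] := ha d dp; have [t ht] := hb d dp.
exists (TMul s t) => /=.
have -> : a * b - ev s * ev t = (a - ev s) * b + ev s * (b - ev t).
  by rewrite mulrBl mulrBr addrA subrK.
have ns : cnorm (ev s) <= cnorm a + d.
  have -> : ev s = a - (a - ev s) by rewrite opprB addrC subrK.
  apply: le_trans (cnorm_leD _ _) _; rewrite cnormN; lra.
apply: le_lt_trans (cnorm_leD _ _) _.
have h1 := cnorm_leM (a - ev s) b; have h2 := cnorm_leM (ev s) (b - ev t).
have p1 := cnorm_ge0 (a - ev s); have p2 := cnorm_ge0 (b - ev t).
have p3 := cnorm_ge0 (ev s).
have h3 : cnorm (a - ev s) * cnorm b <= d * cnorm b by rewrite ler_wpM2r // ltW.
have h4 : cnorm (ev s) * cnorm (b - ev t) <= (cnorm a + 1) * d.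
  apply: ler_pM => //; [lra|exact: ltW].
have : d * cnorm b + (cnorm a + 1) * d < e.
  have -> : d * cnorm b + (cnorm a + 1) * d = d * K by rewrite /K; ring.
  have : 0 < d * K by rewrite mulr_gt0.
  move: dK; have -> : d * (2 * K) = d * K + d * K by ring.
  lra.
lra.
Qed.

Lemma term_closure_star a : term_closure a -> term_closure (star a).
Proof.
move=> h e e0; have [t ht] := h e e0; exists (tstar t).
by rewrite -star_ev -starN -starD cnorm_star.
Qed.

Lemma term_closure_lim (u : nat -> A) (l : A) : (forall i, term_closure (u i)) ->
  cnorm (u i - l) @[i --> \oo] --> (0 : R) -> term_closure l.
Proof.
move=> hu /cvgrPdist_lt ul e e0.
have [|N _ /(_ N (leqnn N))] := ul (e / 2); first by rewrite divr_gt0.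
rewrite /= sub0r normrN ger0_norm ?cnorm_ge0 // => h1.
have [|t h2] := hu N (e / 2); first by rewrite divr_gt0.
exists t; apply: le_lt_trans (cnorm_triangle _ (u N) _) _.
rewrite cnormBC; lra.
Qed.

Hypothesis xgen : generates x.

(** The closure of the values of terms is a C*-subalgebra containing 1 and all x i,
    hence everything. *)
Lemma terms_dense a : term_closure a.
Proof.
suff -> : term_closure = setT by [].
apply: xgen; last exact: term_closure_var.
  split.
  - split; last exact: term_closureD.
    by rewrite -(scale0r 1); exact: term_closure_const.
  - move=> c y hy; rewrite -mulr_algl; apply: term_closureM => //.
    exact: term_closure_const.
  - exact: term_closureM.
  - exact: term_closure_star.
  - exact: term_closure_lim.
by rewrite -(scale1r 1); exact: term_closure_const.
Qed.

(** Replacing a term by its hermitian part does not increase the distance to a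
    self-adjoint element. *)
Lemma sym_terms_dense a e : self_adjoint a -> 0 < e ->
  exists t, cnorm (a - ev (tsym t)) < e.
Proof.
move=> sa e0; have [t h] := terms_dense a e0; exists t.
have -> : a - ev (tsym t) = (2^-1 : R)%:C *: ((a - ev t) + (a - ev (tstar t))).
  rewrite /= mulr_algl.
  have -> : rat_complex R (1 / 2) 0 = (2^-1 : R)%:C.
    by rewrite /rat_complex raddf0 div1r fmorphV /= rmorph_nat.
  rewrite addrACA -opprD scalerBr; congr (_ - _).
  rewrite -mulr2n -[a *+ 2]scaler_nat scalerA -(rmorph_nat (real_complex R)) -rmorphM mulVf //.
  by rewrite rmorph1 scale1r.
rewrite cnormZ nc_real ger0_norm ?invr_ge0 //.
have h2 : cnorm (a - ev (tstar t)) = cnorm (a - ev t).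
  by rewrite -star_ev -[in LHS]sa -starN -starD cnorm_star.
have := cnorm_leD (a - ev t) (a - ev (tstar t)); rewrite h2 mulrC.
move=> h3; rewrite ltr_pdivrMr //; lra.
Qed.

End Density.

Section Eventually.
Variable R : realType.
Notation C := R[i].
Variables (A : cstarAlgType R) (n : nat) (p : nat -> ncpoly R n) (x : 'I_n -> A).
Hypothesis hp : is_enumeration p.

(** Properties of all fine enough microstates, used like a filter: it is stable under
    finite intersections ([micro_near_and], [micro_near_all]), so finitely many
    norm conditions on terms can be imposed at once. *)
Definition micro_near (Q : forall k, ('I_n -> 'M[C]_k) -> Prop) :=
  exists (e : R) (m : nat), [/\ 0 < e, (0 < m)%N &
    forall k M, Gamma_top p x (k := k) e m M -> Q k M].

Lemma Gamma_top_mono k (e e' : R) (m m' : nat) M : e <= e' -> (m' <= m)%N ->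
  Gamma_top p x (k := k) e m M -> Gamma_top p x (k := k) e' m' M.
Proof.
move=> ee mm [Ms h]; split => // j /andP[j1 jm].
apply: lt_le_trans ee; apply: h; rewrite j1 /=; exact: leq_trans mm.
Qed.

Lemma micro_near_and Q Q' : micro_near Q -> micro_near Q' ->
  micro_near (fun k M => Q k M /\ Q' k M).
Proof.
move=> [e [m [e0 m0 h]]] [e' [m' [e0' m0' h']]].
exists (Num.min e e'), (maxn m m'); split.
- by rewrite lt_min e0.
- by rewrite leq_max m0.
move=> k M hM; split.
  by apply: h; apply: Gamma_top_mono hM; [rewrite ge_min lexx|rewrite leq_maxl].
by apply: h'; apply: Gamma_top_mono hM; [rewrite ge_min lexx orbT|rewrite leq_maxr].
Qed.

Lemma micro_near_mono Q (Q' : forall k, ('I_n -> 'M[C]_k) -> Prop) :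
  (forall k M, Q k M -> Q' k M) -> micro_near Q -> micro_near Q'.
Proof. by move=> h [e [m [e0 m0 hq]]]; exists e, m; split => // k M /hq/h. Qed.

Lemma micro_near_herm : micro_near (fun k M => forall i, (M i)^t* = M i).
Proof. by exists 1, 1%N; split => // k M []. Qed.

Lemma micro_near_all (I : finType) (Q : I -> forall k, ('I_n -> 'M[C]_k) -> Prop) :
  (forall i, micro_near (Q i)) -> micro_near (fun k M => forall i, Q i k M).
Proof.
move=> h; suff : micro_near (fun k M => forall i, i \in enum I -> Q i k M).
  by apply: micro_near_mono => k M hM i; apply: hM; rewrite mem_enum.
elim: (enum I) => [|i s ih].
  by apply: micro_near_mono micro_near_herm => k M _ i; rewrite in_nil.
apply: micro_near_mono (micro_near_and (h i) ih) => k M [h1 h2] j.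
by rewrite inE => /orP[/eqP->//|/h2].
Qed.

(** The polynomial of the term occurs in the enumeration p. *)
Lemma micro_near_term (t : term n) (e : R) : 0 < e -> micro_near (fun k M =>
  `|opnorm (teval (@scalar_mx C k) M t) - cnorm (teval (fun c => c%:A : A) x t)| < e).
Proof.
move=> e0; have [P Pr Pt] := ncpoly_of_term R t.
have [j j0 Pj] : exists2 j, (0 < j)%N & p j = P.
  have : [set P | rational_ncpoly P] P by [].
  by rewrite -hp => -[j /= j0 <-]; exists j.
exists e, j; split => // k M [_ /(_ j)].
rewrite j0 leqnn Pj => /(_ isT).
by rewrite (Pt _ _ _ _ (matrix_normed R k)) (Pt _ _ _ _ (cstar_normed A)).
Qed.

Lemma micro_near_small (t : term n) (e : R) :
  cnorm (teval (fun c => c%:A : A) x t) < e -> micro_near (fun k M =>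
  opnorm (teval (@scalar_mx C k) M t) < e).
Proof.
move=> h; pose d := e - cnorm (teval (fun c => c%:A : A) x t).
have d0 : 0 < d by rewrite subr_gt0.
apply: micro_near_mono (micro_near_term t d0) => k M; rewrite ltr_norml => /andP[_].
by rewrite /d; lra.
Qed.

Lemma teval_ct (t : term n) k (M : 'I_n -> 'M[C]_k) : (forall i, (M i)^t* = M i) ->
  (teval (@scalar_mx C k) M (tsym t))^t* = teval (@scalar_mx C k) M (tsym t).
Proof.
move=> h; apply: (teval_tsym (s := fun X : 'M[C]_k => X^t*) t (matrix_normed R k)) => //.
- exact: ct_scalar.
- exact: ctD.
- exact: ctM.
Qed.

End Eventually.

(** * Halving a matrix algebra *)

Section Halving.
Variable R : realType.
Notation C := R[i].
Variable k : nat.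
Local Notation h := (k./2)%N.

Definition halfF : 'M[C]_k := \matrix_(i, j) ((i == j) && (i < h)%N)%:R.
Definition halfV : 'M[C]_k := \matrix_(i, j) ((i == (j + h)%N :> nat) && (j < h)%N)%:R.
(** For odd k, the first half and its translate by halfV leave over the last
    coordinate; this moves the coordinate 0 there. *)
Definition halfW : 'M[C]_k :=
  \matrix_(i, j) [&& odd k, i == k.-1 :> nat & j == 0 :> nat]%:R.

Lemma halfF_ct : halfF^t* = halfF.
Proof.
apply/matrixP => i j; rewrite !mxE conjC_nat eq_sym.
by have [->|] := eqVneq i j.
Qed.

Lemma mul_halfF (M : 'M[C]_k) : M *m halfF = \matrix_(i, j) (M i j * (j < h)%N%:R).
Proof.
apply/matrixP => i j; rewrite !mxE (bigD1 j) //= big1 ?addr0 ?mxE ?eqxx //.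
by move=> a /negbTE aj; rewrite mxE aj mulr0.
Qed.

Lemma halfF_idem : halfF *m halfF = halfF.
Proof.
apply/matrixP => i j; rewrite mul_halfF !mxE.
by have [->|] := eqVneq i j; rewrite /= ?mul0r // -natrM mulnb andbb.
Qed.

Lemma halfVF : halfV *m halfF = halfV.
Proof.
by apply/matrixP => i j; rewrite mul_halfF !mxE -natrM mulnb -andbA andbb.
Qed.

Hypothesis k2 : (2 <= k)%N.

Let h_gt0 : (0 < h)%N. Proof. by rewrite half_gt0. Qed.
Let h2 : (h + h <= k)%N.
Proof. by rewrite addnn -[X in (_ <= X)%N](odd_double_half k) leq_addl. Qed.

Lemma halfWF : halfW *m halfF = halfW.
Proof.
apply/matrixP => i j; rewrite mul_halfF !mxE -natrM mulnb.
by case: (odd k) => //=; case: (_ == k.-1) => //=; case: eqP => //= ->; rewrite h_gt0.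
Qed.

Lemma halfVtV : halfV^t* *m halfV = halfF.
Proof.
apply/matrixP => i j; rewrite !mxE.
under eq_bigr do rewrite !mxE conjC_nat -natrM mulnb.
have [ih|ih] := boolP (i < h)%N; last first.
  by rewrite andbF big1 // => a _; rewrite andbF.
have ik : (i + h < k)%N by apply: leq_trans h2; rewrite ltn_add2r.
rewrite (bigD1 (Ordinal ik)) //= big1 ?addr0 => [|a].
  rewrite eqxx /= andbT eqn_add2r -val_eqE /=.
  by case: eqP => [<-|//]; rewrite ih.
rewrite -val_eqE /= => /negbTE ->; by [].
Qed.

Lemma halfVtFV : halfV^t* *m halfF *m halfV = 0.
Proof.
rewrite mul_halfF; apply/matrixP => i j; rewrite !mxE big1 // => a _.
rewrite !mxE conjC_nat -!natrM !mulnb.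
by case: eqP => //= ->; rewrite [(_ + _ < _)%N]ltnNge leq_addl /= !andbF.
Qed.

Lemma halfVVt i j : (halfV *m halfV^t*) i j = ((i == j) && (h <= i < h + h)%N)%:R.
Proof.
rewrite !mxE; under eq_bigr do rewrite !mxE conjC_nat -natrM mulnb.
have [ih|ih] := boolP (h <= i < h + h)%N; last first.
  rewrite andbF big1 // => a _; case: eqP => //= ia.
  by move: ih; rewrite ia leq_addl ltn_add2r /= => /negbTE->.
case/andP: ih => h1 h3.
have ik : (i - h < k)%N by apply: leq_ltn_trans (ltn_ord i); rewrite leq_subr.
rewrite (bigD1 (Ordinal ik)) //= big1 ?addr0 => [|a].
  by rewrite subnK // eqxx /= ltn_subLR // h3 andbT eq_sym andbT.
rewrite -val_eqE /= => /negbTE na.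
case: eqP => //= ia; by move: na; rewrite ia addnK eqxx.
Qed.

Lemma halfWWt i j :
  (halfW *m halfW^t*) i j = [&& i == j, odd k & i == k.-1 :> nat]%:R.
Proof.
rewrite !mxE; under eq_bigr do rewrite !mxE conjC_nat -natrM mulnb.
have k0 : (0 < k)%N by apply: leq_trans k2.
rewrite (bigD1 (Ordinal k0)) //= big1 ?addr0 => [|a].
  rewrite eqxx !andbT -val_eqE /=; case: (odd k); rewrite ?andbF //=.
  by case: (eqVneq (i : nat) k.-1) => [->|]; rewrite ?andbF //= andbT eq_sym.
by rewrite -val_eqE /= => /negbTE->; rewrite !andbF.
Qed.

(** The complement of the first half consists of a copy of that half and, for odd k,
    of the last coordinate.  This uses that the half is not empty. *)
Lemma half_complement : halfF + (halfV *m halfF *m halfV^t* +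
  halfW *m halfF *m halfW^t*) = 1%:M.
Proof.
rewrite halfVF halfWF; apply/matrixP => i j.
rewrite mxE [X in _ + X]mxE halfVVt halfWWt !mxE.
case: (i == j) => //=; last by rewrite !addr0.
rewrite -!natrD; congr (_%:R).
have ik := ltn_ord i; have := odd_double_half k; rewrite -addnn.
case: (odd k) => /= e; lia.
Qed.

Lemma halfWtW_ct : (halfW^t* *m halfW)^t* = halfW^t* *m halfW.
Proof. by rewrite ctM ctK. Qed.

Lemma halfWtW_idem :
  halfW^t* *m halfW *m (halfW^t* *m halfW) = halfW^t* *m halfW.
Proof.
have e i j : (halfW^t* *m halfW) i j = [&& i == j, odd k & i == 0 :> nat]%:R.
  rewrite !mxE; under eq_bigr do rewrite !mxE conjC_nat -natrM mulnb.
  have k1 : (k.-1 < k)%N by rewrite prednK // (leq_trans _ k2).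
  rewrite (bigD1 (Ordinal k1)) //= big1 ?addr0 => [|a].
    rewrite eqxx /= -val_eqE /=; case: (odd k); rewrite ?andbF //=.
    by case: (eqVneq (i : nat) 0%N) => [->|]; rewrite ?andbF //= andbT eq_sym.
  by rewrite -val_eqE /= => /negbTE->; rewrite !andbF.
apply/matrixP => i j; rewrite [LHS]mxE (bigD1 i) //= big1 ?addr0 => [|a ai].
  rewrite !e eqxx -natrM mulnb; congr (_%:R).
  by case: (i == j); case: (odd k); case: (_ == 0%N).
by rewrite e eq_sym (negbTE ai) mul0r.
Qed.

End Halving.

Section Divisible.
Variable R : realType.
Notation C := R[i].
Variable A : cstarAlgType R.

Lemma cnorm_proj (q : A) : star q = q -> q * q = q -> cnorm q <= 1.
Proof.
move=> qs qq; have := cnorm_starM q; rewrite qs qq expr2.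
have := cnorm_ge0 q; nra.
Qed.

Lemma cnorm_partial_isometry (v q : A) : star q = q -> q * q = q ->
  star v * v = q -> cnorm v <= 1.
Proof.
move=> qs qq vq; have := cnorm_starM v; rewrite vq expr2.
have := cnorm_proj qs qq; have := cnorm_ge0 v; nra.
Qed.

Lemma bigmin_le (I : eqType) (s : seq I) (F : I -> nat) (x0 : nat) i :
  i \in s -> (\big[minn/x0]_(j <- s) F j <= F i)%N.
Proof.
elim: s => // j s ih; rewrite inE big_cons => /orP[/eqP->|/ih h].
  exact: geq_minl.
exact: leq_trans (geq_minr _ _) h.
Qed.

Hypothesis Adiv : approximately_divisible A.

(** Take in each block the matrices halving it.  Their images in A are partial
    isometries, and a projection q has norm at most 1 since |q| = |q|^2. *)
Lemma approximate_halving (m : nat) (y : 'I_m -> A) (e : R) : 0 < e ->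
  exists f v v' w w' : A,
  [/\ star f = f, f * f = f,
     [/\ cnorm f <= 1, cnorm v <= 1, cnorm v' <= 1, cnorm w <= 1 & cnorm w' <= 1],
     1 = f + (v * f * v' + w * f * w') /\ f = v' * (1 - f) * v
   & forall z, z \in [:: f; v; v'; w; w'] -> forall i, cnorm (y i * z - z * y i) < e].
Proof.
move=> e0; have [B [_ B1 Bsub Bcomm]] := Adiv y e0.
have [d [r [k [g [kp giso dk]]]] d2] : exists2 d, is_SubRank B d & (2 <= d)%N.
  move: Bsub; rewrite /SubRank; case: xgetP => // d _ hd d2; by exists d.
have k2 i : (2 <= k i)%N.
  apply: leq_trans d2 _; rewrite dk; apply: bigmin_le; exact: mem_index_enum.
case: giso => glin gM gS _ gB.
have gD M N : g M + g N = g (fun i => M i + N i).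
  rewrite -[g M]scale1r -glin; congr g.
  by apply: functional_extensionality_dep => i; rewrite scale1r.
have g0 : g (fun=> 0) = 0.
  have := gD (fun=> 0) (fun=> 0).
  have -> : (fun i : 'I_r.+1 => (0 : 'M[C]_(k i)) + 0) = (fun i => 0 : 'M[C]_(k i)).
    by apply: functional_extensionality_dep => i; rewrite addr0.
  by move/eqP; rewrite -subr_eq0 addrK => /eqP.
have g1 : g (fun=> 1%:M) = 1.
  have : range g 1 by rewrite gB.
  move=> [E _ gE]; rewrite -[LHS]mulr1 -gE -gM; congr g.
  by apply: functional_extensionality_dep => i; rewrite mul1mx.
pose f := g (fun i => halfF R (k i)).
pose v := g (fun i => halfV R (k i)).
pose w := g (fun i => halfW R (k i)).
have v'E : star v = g (fun i => (halfV R (k i))^t*) by rewrite /v -gS.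
have w'E : star w = g (fun i => (halfW R (k i))^t*) by rewrite /w -gS.
have geq M N : (forall i, M i = N i) -> g M = g N.
  by move=> MN; congr g; apply: functional_extensionality_dep.
have fs : star f = f by rewrite /f -gS; apply: geq => i; rewrite halfF_ct.
have ff : f * f = f by rewrite /f -gM; apply: geq => i; rewrite halfF_idem.
have vv : star v * v = f by rewrite v'E /v /f -gM; apply: geq => i; rewrite halfVtV.
have vfv : star v * f * v = 0.
  by rewrite v'E /v /f -!gM -g0; apply: geq => i; rewrite halfVtFV.
pose q := g (fun i => (halfW R (k i))^t* *m halfW R (k i)).
have qs : star q = q by rewrite /q -gS; apply: geq => i; exact: halfWtW_ct.
have qq : q * q = q by rewrite /q -gM; apply: geq => i; exact: halfWtW_idem.
have wq : star w * w = q by rewrite w'E /w /q -gM.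
have nf : cnorm f <= 1 by exact: cnorm_proj.
have nv : cnorm v <= 1 by exact: cnorm_partial_isometry vv.
have nw : cnorm w <= 1 by exact: cnorm_partial_isometry wq.
have gmem M : B (g M) by rewrite -gB; exists M.
exists f, v, (star v), w, (star w); split => //.
- by rewrite !cnorm_star.
- split; last by rewrite mulrBr mulr1 mulrBl vfv subr0 vv.
  rewrite -g1 v'E w'E /f /v /w -!gM !gD; apply: geq => i.
  by rewrite half_complement.
move=> z; rewrite !inE => /or4P[/eqP->|/eqP->|/eqP->|/orP[]/eqP->] i; apply: Bcomm => //.
- exact: gmem.
- exact: gmem.
- by rewrite v'E; exact: gmem.
- by rewrite cnorm_star.
- exact: gmem.
- by rewrite w'E; exact: gmem.
- by rewrite cnorm_star.
Qed.

End Divisible.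

(** * Refining a family of projections *)

Section MatrixCloseness.
Variable R : realType.
Notation C := R[i].
Variable k : nat.
Implicit Types (a b c : 'M[C]_k) (e : R).

(** Lets approximate identities be chained like equations, with explicit errors. *)
Definition mxclose e a b := opnorm (a - b) <= e.

Lemma mxclose_sym e a b : mxclose e a b -> mxclose e b a.
Proof. by rewrite /mxclose opnormBC. Qed.

Lemma mxclose_trans e e' a b c : mxclose e a b -> mxclose e' b c -> mxclose (e + e') a c.
Proof.
move=> h h'; rewrite /mxclose; have -> : a - c = (a - b) + (b - c) by rewrite addrA subrK.
exact: le_trans (opnormD _ _) (lerD h h').
Qed.

Lemma mxclose_le e e' a b : e <= e' -> mxclose e a b -> mxclose e' a b.
Proof. by move=> ee h; apply: le_trans ee. Qed.

Lemma mxclose_lt e e' a b : mxclose e a b -> e < e' -> opnorm (a - b) < e'.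
Proof. by rewrite /mxclose; exact: le_lt_trans. Qed.

Lemma mxcloseW e a b : opnorm (a - b) < e -> mxclose e a b.
Proof. exact: ltW. Qed.

Lemma mxclose_mull e (K : R) a b c : opnorm c <= K -> mxclose e a b ->
  mxclose (K * e) (c *m a) (c *m b).
Proof. by move=> h h'; rewrite /mxclose -mulmxBr opnormM_le. Qed.

Lemma mxclose_mulr e (K : R) a b c : opnorm c <= K -> mxclose e a b ->
  mxclose (e * K) (a *m c) (b *m c).
Proof. by move=> h h'; rewrite /mxclose -mulmxBl opnormM_le. Qed.

Lemma mxcloseD e e' a b c d : mxclose e a b -> mxclose e' c d ->
  mxclose (e + e') (a + c) (b + d).
Proof.
move=> h h'; rewrite /mxclose opprD addrACA.
exact: le_trans (opnormD _ _) (lerD h h').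
Qed.

Lemma mxcloseN e a b : mxclose e a b -> mxclose e (- a) (- b).
Proof. by rewrite /mxclose -opprD opnormN. Qed.

Lemma mxclosexx a : mxclose 0 a a.
Proof. by rewrite /mxclose subrr opnorm0. Qed.

Lemma mxclose_norm e (K : R) a b : mxclose e a b -> opnorm a <= K -> opnorm b <= K + e.
Proof.
move=> /mxclose_sym h ha; have -> : b = a + (b - a) by rewrite addrC subrK.
exact: le_trans (opnormD _ _) (lerD ha h).
Qed.

(** The row spaces of a and b meet trivially and lie in the row space of p. *)
Lemma rank_orth_idem a b p : a *m a = a -> b *m b = b -> a *m b = 0 -> b *m a = 0 ->
  a *m p = a -> b *m p = b -> (\rank a + \rank b <= \rank p)%N.
Proof.
move=> aa bb ab ba ap bp.
have cap0 : (a :&: b)%MS = 0.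
  apply/eqP/rowV0P => v; rewrite sub_capmx => /andP[/submxP[x xa] /submxP[y yb]].
  have : v *m a = v by rewrite xa -mulmxA aa.
  by rewrite yb -mulmxA ba mulmx0.
rewrite -mxrank_disjoint_sum //; apply: mxrankS.
rewrite addsmx_sub; apply/andP; split.
  by rewrite -ap; exact: submxMl.
by rewrite -bp; exact: submxMl.
Qed.

Lemma mulmx_comm_idem a b c : a *m a = a -> a *m b = b *m a ->
  a *m b *m (a *m c) = a *m (b *m c).
Proof. by move=> aa ab; rewrite ab -mulmxA (mulmxA a) aa !mulmxA ab. Qed.

Lemma rank_sandwich a b c : (\rank (b *m a *m c) <= \rank a)%N.
Proof.
by apply: leq_trans (mxrankM_maxl _ _) _; exact: mxrankM_maxr.
Qed.

End MatrixCloseness.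

Section Refine.
Variable R : realType.
Notation C := R[i].

Variables (k d : nat) (P : nat -> 'M[C]_k).
Hypothesis PP : proj_family d P.

(** P j commutes with the pinching of X, which is close to X by [off_pinch]. *)
Lemma comm_proj_family_mxclose (X : 'M[C]_k) (e : R) j : (j < d)%N ->
  mxclose e (X *m weighted_sum d P) (weighted_sum d P *m X) ->
  mxclose (2 * (d%:R ^+ 2 * e)) (P j *m X) (X *m P j).
Proof.
move=> jd h; have Pn := proj_family_norm PP jd.
have cl : mxclose (d%:R ^+ 2 * e) X (pinch d P X).
  apply: le_trans (off_pinch PP X) _; rewrite ler_wpM2l ?exprn_ge0 //.
have h1 := mxclose_mull Pn cl; have h2 := mxclose_mulr Pn (mxclose_sym cl).
rewrite (pinch_comm PP) // in h1.
by apply: mxclose_le (mxclose_trans h1 h2); lra.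
Qed.

(** The indices 2 j and 2 j + 1 carry the two pieces of P j, so that the weighted sum
    of the new family is twice the old one plus G. *)
Definition refine (G : 'M[C]_k) (j : nat) : 'M[C]_k :=
  if odd j then P j./2 *m G else P j./2 *m (1%:M - G).

Variable G : 'M[C]_k.
Hypothesis Gs : G^t* = G.
Hypothesis GG : G *m G = G.
Hypothesis PG : forall j, (j < d)%N -> P j *m G = G *m P j.

Lemma half_lt j : (j < d.*2)%N -> (j./2 < d)%N.
Proof. by lia. Qed.

Lemma sum_double (V : zmodType) (F : nat -> V) (m : nat) :
  \sum_(j < m.*2) F j = \sum_(j < m) (F j.*2 + F j.*2.+1).
Proof.
elim: m => [|m ih]; first by rewrite !big_ord0.
by rewrite doubleS !big_ord_recr /= ih addrA.
Qed.

Lemma refine_even j : refine G j.*2 = P j *m (1%:M - G).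
Proof. by rewrite /refine odd_double doubleK. Qed.

Lemma refine_odd j : refine G j.*2.+1 = P j *m G.
Proof. by rewrite /refine /= odd_double /= uphalf_double. Qed.

Lemma refine_proj_family : proj_family d.*2 (refine G).
Proof.
case: (PP) => Ps Po P1.
have G1 : (1%:M - G) *m (1%:M - G) = 1%:M - G.
  by rewrite mulmxBl mul1mx mulmxBr mulmx1 GG subrr subr0.
have G0 : G *m (1%:M - G) = 0 by rewrite mulmxBr mulmx1 GG subrr.
have G0' : (1%:M - G) *m G = 0 by rewrite mulmxBl mul1mx GG subrr.
have PG' j : (j < d)%N -> P j *m (1%:M - G) = (1%:M - G) *m P j.
  by move=> jd; rewrite mulmxBr mulmxBl mulmx1 mul1mx PG.
split.
- move=> j /half_lt jd; rewrite /refine; case: ifP => _; rewrite ctM Ps //.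
    by rewrite Gs PG.
  by rewrite ctB ct1 Gs PG'.
- move=> i j /half_lt id /half_lt jd.
  have e (X Y : 'M[C]_k) : P j./2 *m X = X *m P j./2 ->
      P i./2 *m X *m (P j./2 *m Y) = P i./2 *m P j./2 *m (X *m Y).
    by move=> XP; rewrite !mulmxA -(mulmxA _ X) -XP !mulmxA.
  have ij : (i == j) = (odd i == odd j) && (i./2 == j./2)%N.
    by apply/eqP/andP => [->//|[/eqP a /eqP b]]; rewrite -(odd_double_half i) a b odd_double_half.
  rewrite ij /refine; have := Po _ _ id jd.
  case: (odd i); case: (odd j) => /=; rewrite ?andbF => h; rewrite e ?PG ?PG' // h.
  + by rewrite GG; case: eqP => _; rewrite ?mul0mx // PG.
  + by rewrite G0 mulmx0.
  + by rewrite G0' mulmx0.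
  + by rewrite G1; case: eqP => _; rewrite ?mul0mx // PG'.
rewrite sum_double; under eq_bigr do rewrite refine_even refine_odd -mulmxDr subrK mulmx1.
exact: P1.
Qed.

Lemma weighted_sum_refine : weighted_sum d.*2 (refine G) = 2%:R *: weighted_sum d P + G.
Proof.
case: (PP) => _ _ P1.
rewrite /weighted_sum (sum_double (fun j => j%:R *: refine G j)) /=.
rewrite -[in RHS](mul1mx G) -P1 mulmx_suml scaler_sumr -big_split /=.
apply: eq_bigr => j _; rewrite refine_even refine_odd -natr1 scalerDl scale1r addrA.
rewrite -scalerDr -mulmxDr subrK mulmx1; congr (_ + _).
by rewrite scalerA -natrM mul2n.
Qed.

End Refine.

Section RefinementStep.
Variable R : realType.
Notation C := R[i].

(** The errors of [refine_family_step]: e bounds the errors of the hypotheses,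
    q = d^2 e the distances to pinchings, and m / 10 the distance from F to the exact
    projection G. *)
Lemma refine_family_tolerances (d : nat) (dl : R) : 0 < dl -> exists e q m : R,
  [/\ [/\ 0 < e, 0 <= q & q = d%:R ^+ 2 * e],
   [/\ 2 + q <= 3, 3 * q + q * 2 + e + q <= 7 * q + e, q + 2 * (7 * q + e) <= m / 10,
    0 + m / 10 <= dl & 0 <= q] &
   1 * (m / 10 + e + (2 * (m / 10) * 2 + 2 * (m / 10) * 2)) +
     (2 * q * (1 * 2) + 2 * q * (1 * 2)) < 1 /\
   1 * (m / 10 + e + 2 * (m / 10) * 2) + 2 * q * (1 * 2) < 1].
Proof.
move=> dl0; have D0 : 0 <= d%:R ^+ 2 :> R by rewrite exprn_ge0.
move: (d%:R ^+ 2) D0 => D D0.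
pose m := Num.min dl 1; have m0 : 0 < m by rewrite lt_min dl0 ltr01.
have m1 : m <= 1 by rewrite ge_min lexx orbT.
have mdl : m <= dl by rewrite ge_min lexx.
clearbody m.
have [e [e0 eDm em]] : exists e : R, [/\ 0 < e, 200 * (D * e) <= m & 200 * e <= m].
  exists (m / (200 * (D + 1))).
  have p : 0 < 200 * (D + 1) by lra.
  have h : m / (200 * (D + 1)) * (200 * (D + 1)) = m by rewrite divfK // gt_eqF.
  have q : 0 < m / (200 * (D + 1)) by rewrite divr_gt0.
  by move: q h; move: (m / _) => x x0 h; split => //; nra.
have q0 : 0 <= D * e by rewrite mulr_ge0 // ltW.
exists e, (D * e), m; split; first by [].
  by move: (D * e) q0 eDm => q q0 eDm; split; lra.
by move: (D * e) q0 eDm => q q0 eDm; split; lra.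
Qed.

(** Pinch F to make it commute with the family and round it to a projection G.  Then
    P j (1 - G) is close to V (P j G) V' + W (P j G) W', and P j G is close to
    V' (P j (1 - G)) V, so that rank (P j (1 - G)) <= 2 rank (P j G) and
    rank (P j G) <= rank (P j (1 - G)); as the two ranks add up to at most rank (P j),
    each is at most two thirds of it. *)
Lemma refine_family_step (d : nat) (dl : R) : 0 < dl -> exists2 e : R, 0 < e &
  forall k (P : nat -> 'M[C]_k) (F V V' W W' : 'M[C]_k), proj_family d P -> F^t* = F ->
    mxclose e (F *m F) F ->
    mxclose e 1%:M (F + (V *m F *m V' + W *m F *m W')) ->
    mxclose e F (V' *m (1%:M - F) *m V) ->
    (forall z, z \in [:: F; V; V'; W; W'] -> opnorm z <= 2) ->
    (forall z, z \in [:: F; V; V'; W; W'] ->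
       mxclose e (z *m weighted_sum d P) (weighted_sum d P *m z)) ->
  exists P' : nat -> 'M[C]_k, [/\ proj_family d.*2 P',
    mxclose dl (weighted_sum d.*2 P') (2%:R *: weighted_sum d P + F) &
    forall j, (j < d.*2)%N -> (3 * \rank (P' j) <= 2 * \rank (P j./2))%N].
Proof.
move=> dl0; have [e [q [m [[e0 q0 qE] [n1 n2 n3 n4 n5] [n6 n7]]]]] := refine_family_tolerances d dl0.
exists e => // k P F V V' W W' PP Fs FF F1 FV nrm cm.
have nF : opnorm F <= 2 by apply: nrm; rewrite !inE eqxx.
have nV : opnorm V <= 2 by apply: nrm; rewrite !inE eqxx ?orbT.
have nV' : opnorm V' <= 2 by apply: nrm; rewrite !inE eqxx ?orbT.
have nW : opnorm W <= 2 by apply: nrm; rewrite !inE eqxx ?orbT.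
have nW' : opnorm W' <= 2 by apply: nrm; rewrite !inE eqxx ?orbT.
have cF := cm F _; have cV := cm V _; have cV' := cm V' _.
have cW := cm W _; have cW' := cm W' _.
rewrite !inE !eqxx ?orbT in cF cV cV' cW cW'.
move: (cF isT) (cV isT) (cV' isT) (cW isT) (cW' isT) => {cm}{}cF {}cV {}cV' {}cW {}cW'.
(* The pinching of F is hermitian and commutes with the family exactly. *)
have [F' [FF' F's F'P]] : exists F', [/\ mxclose q F F', F'^t* = F' &
    forall j, (j < d)%N -> P j *m F' = F' *m P j].
  exists (pinch d P F); split; last by move=> j; exact: pinch_comm.
    by apply: le_trans (off_pinch PP F) _; rewrite qE; apply: ler_wpM2l cF; rewrite exprn_ge0.
  by rewrite (pinch_ct PP) Fs.
have nF' : opnorm F' <= 3 by apply: le_trans (mxclose_norm FF' nF) n1.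
have [G [Gs GG FG Gc]] := round_proj F's.
have F'F' : mxclose (7 * q + e) (F' *m F') F'.
  have h1 := mxclose_mull nF' (mxclose_sym FF').
  have h2 := mxclose_mulr nF (mxclose_sym FF').
  exact: mxclose_le n2 (mxclose_trans (mxclose_trans (mxclose_trans h1 h2) FF) FF').
have cFG : mxclose (m / 10) F G.
  have h : mxclose (2 * (7 * q + e)) F' G.
    by apply: le_trans FG _; rewrite ler_pM2l.
  exact: mxclose_le n3 (mxclose_trans FF' h).
have PG j : (j < d)%N -> P j *m G = G *m P j.
  by move=> jd; apply/Gc/F'P.
exists (refine P G); split.
- exact: refine_proj_family.
- rewrite (weighted_sum_refine PP) //; apply: (@mxclose_le _ _ (0 + m / 10)) => //.
  by apply: mxcloseD; [exact: mxclosexx|exact: mxclose_sym].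
have nG : opnorm G <= 1 by exact: opnorm_proj.
have G1 : (1%:M - G) *m (1%:M - G) = 1%:M - G.
  by rewrite mulmxBl mul1mx mulmxBr mulmx1 GG subrr subr0.
have n1G : opnorm (1%:M - G) <= 1.
  by apply: opnorm_proj => //; rewrite ctB ct1 Gs.
case: (PP) => Ps Po P1.
have ranks j : (j < d)%N ->
   (\rank (P j *m (1%:M - G)) <= 2 * \rank (P j *m G))%N /\
   (\rank (P j *m G) <= \rank (P j *m (1%:M - G)))%N.
  move=> jd; have Pn := proj_family_norm PP jd.
  have PPj : P j *m P j = P j by rewrite Po // eqxx.
  have cP X := @comm_proj_family_mxclose _ _ _ _ PP X e _ jd.
  rewrite -qE in cP.
  have PG1 : P j *m (1%:M - G) = (1%:M - G) *m P j.
    by rewrite mulmxBr mulmxBl mulmx1 mul1mx PG.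
  have idem1 : P j *m (1%:M - G) *m (P j *m (1%:M - G)) = P j *m (1%:M - G).
    by rewrite mulmx_comm_idem // G1.
  have idem2 : P j *m G *m (P j *m G) = P j *m G.
    by rewrite mulmx_comm_idem ?GG //; exact: PG.
  split.
    apply: (@leq_trans (\rank (V *m (P j *m G) *m V' + W *m (P j *m G) *m W')%R)).
      apply: rank_perturb; first exact: idem1.
      have s1 : mxclose (m / 10) (1%:M - G) (1%:M - F).
        by rewrite -[m / 10]add0r; apply: mxcloseD; [exact: mxclosexx|apply/mxcloseN/mxclose_sym].
      have s2 : mxclose e (1%:M - F) (V *m F *m V' + W *m F *m W').
        by move: F1; rewrite /mxclose opprD addrA.
      have s3 X X' : opnorm X <= 2 -> opnorm X' <= 2 ->
          mxclose (2 * (m / 10) * 2) (X *m F *m X') (X *m G *m X').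
        move=> hX hX'; exact: (mxclose_mulr hX' (mxclose_mull hX cFG)).
      have s4 := mxcloseD (s3 _ _ nV nV') (s3 _ _ nW nW').
      have s5 := mxclose_mull Pn (mxclose_trans (mxclose_trans s1 s2) s4).
      have s6 X X' : opnorm X <= 2 -> opnorm X' <= 2 ->
          mxclose e (X *m weighted_sum d P) (weighted_sum d P *m X) ->
          mxclose (2 * q * (1 * 2)) (P j *m (X *m G *m X')) (X *m (P j *m G) *m X').
        move=> hX hX' /(cP _) h; rewrite -(mulmxA X G) !mulmxA -!(mulmxA _ G).
        exact: (mxclose_mulr (opnormM_le nG hX') h).
      have s7 := mxcloseD (s6 _ _ nV nV' cV) (s6 _ _ nW nW' cW).
      rewrite -mulmxDr in s7.
      have s8 := mxclose_trans s5 s7.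
      exact: (mxclose_lt s8 n6).
    apply: leq_trans (mxrank_add _ _) _; rewrite mul2n -addnn.
    by apply: leq_add; exact: rank_sandwich.
  apply: (@leq_trans (\rank (V' *m (P j *m (1%:M - G)) *m V))); last exact: rank_sandwich.
  apply: rank_perturb; first exact: idem2.
  have s1 : mxclose (m / 10) (1%:M - F) (1%:M - G).
    by rewrite -[m / 10]add0r; apply: mxcloseD; [exact: mxclosexx|exact/mxcloseN].
  have s2 := mxclose_mulr nV (mxclose_mull nV' s1).
  have s3 := mxclose_mull Pn (mxclose_trans (mxclose_trans (mxclose_sym cFG) FV) s2).
  have s4 : mxclose (2 * q * (1 * 2)) (P j *m (V' *m (1%:M - G) *m V))
      (V' *m (P j *m (1%:M - G)) *m V).
    rewrite -(mulmxA V') !mulmxA -!(mulmxA _ (1%:M - G)).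
    exact: (mxclose_mulr (opnormM_le n1G nV) (cP _ cV')).
  have s5 := mxclose_trans s3 s4.
  exact: (mxclose_lt s5 n7).
move=> j jd; have jd2 := half_lt jd; have [r1 r2] := ranks _ jd2.
have r3 : (\rank (P j./2 *m (1%:M - G)) + \rank (P j./2 *m G) <= \rank (P j./2))%N.
  have PPj : P j./2 *m P j./2 = P j./2 by rewrite Po // eqxx.
  have G0 : G *m (1%:M - G) = 0 by rewrite mulmxBr mulmx1 GG subrr.
  have G0' : (1%:M - G) *m G = 0 by rewrite mulmxBl mul1mx GG subrr.
  have PG' : P j./2 *m (1%:M - G) = (1%:M - G) *m P j./2.
    by rewrite mulmxBr mulmxBl mulmx1 mul1mx PG.
  apply: rank_orth_idem.
  - by rewrite mulmx_comm_idem // G1.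
  - by rewrite mulmx_comm_idem ?GG //; exact: PG.
  - by rewrite mulmx_comm_idem // G0' mulmx0.
  - by rewrite mulmx_comm_idem ?G0 ?mulmx0 //; exact: PG.
  - by rewrite PG' -mulmxA PPj.
  - by rewrite PG // -mulmxA PPj.
rewrite /refine; case: ifP => _; move: r1 r2 r3; clear;
  move: (\rank _) (\rank _) (\rank _) => a b c; lia.
Qed.

End RefinementStep.

(** * Almost central partitions seen by microstates *)

Section TermTools.
Variable R : realType.
Notation C := R[i].

Lemma teval_lip_fam (I : finType) n (r : R) (t : I -> term n) :
  exists2 L : R, 0 <= L &
  forall j (T : pzRingType) (f : C -> T) nu (x y : 'I_n -> T) (e : R),
  normed_alg f nu -> (forall i, nu (x i) <= r) -> (forall i, nu (y i) <= r) ->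
  0 <= e -> (forall i, nu (x i - y i) <= e) ->
  nu (teval f x (t j) - teval f y (t j)) <= L * e.
Proof.
have /choice[L hL] j : exists L : R,
  forall (T : pzRingType) (f : C -> T) nu (x y : 'I_n -> T) (e : R),
  normed_alg f nu -> (forall i, nu (x i) <= r) -> (forall i, nu (y i) <= r) ->
  0 <= e -> (forall i, nu (x i - y i) <= e) ->
  nu (teval f x (t j) - teval f y (t j)) <= L * e.
  by have [L _ h] := teval_lip r (t j); exists L.
exists (\sum_j `|L j|); first by apply: sumr_ge0.
move=> j T f nu x y e na hx hy e0 h.
apply: le_trans (hL j _ _ _ _ _ _ na hx hy e0 h) _; rewrite ler_wpM2r //.
rewrite (bigD1 j) //=; apply: le_trans (ler_norm _) _; rewrite lerDl.
exact: sumr_ge0.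
Qed.

Definition tone n := TConst n 1 0.
Definition tsub n (s t : term n) := TAdd s (TMul (TConst n (-1) 0) t).

Lemma teval_tone n (T : pzRingType) (f : C -> T) nu (x : 'I_n -> T) :
  normed_alg f nu -> teval f x (tone n) = 1.
Proof. by move=> na; rewrite /= /rat_complex rmorph1 raddf0 (na_f1 na). Qed.

Lemma teval_tsub n (T : pzRingType) (f : C -> T) nu (x : 'I_n -> T) s t :
  normed_alg f nu -> teval f x (tsub s t) = teval f x s - teval f x t.
Proof.
move=> na /=; congr (_ + _).
have -> : f (rat_complex R (-1) 0) = -1.
  rewrite /rat_complex rmorphN1 raddf0; apply/eqP; rewrite -subr_eq0 opprK addrC -(na_f1 na).
  by rewrite -(na_fD na) -[X in 1 + X]/((-1)%:C) rmorphN1 subrr (na_f0 na).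
by rewrite mulN1r.
Qed.

Lemma commutator_change (T : pzRingType) (a b c : T) :
  b * c - c * b = (a * c - c * a) - ((a - b) * c - c * (a - b)).
Proof.
rewrite -{1 2}(subKr a b) [(a - (a - b)) * c]mulrBl [c * (a - (a - b))]mulrBr.
by rewrite !opprB addrACA [RHS]addrACA; congr (_ + _); exact: addrC.
Qed.

Lemma tevalA n (T : pzRingType) (f : C -> T) (x : 'I_n -> T) s t :
  teval f x (TAdd s t) = teval f x s + teval f x t.
Proof. by []. Qed.

Lemma tevalM n (T : pzRingType) (f : C -> T) (x : 'I_n -> T) s t :
  teval f x (TMul s t) = teval f x s * teval f x t.
Proof. by []. Qed.

Lemma tevalV n (T : pzRingType) (f : C -> T) (x : 'I_n -> T) i :
  teval f x (TVar i) = x i.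
Proof. by []. Qed.

Lemma proj_family1 k : proj_family 1 (fun=> 1%:M : 'M[C]_k).
Proof.
split; last by rewrite big_ord1.
  by move=> j _; rewrite ct1.
by move=> [|i] [|j] // _ _; rewrite mulmx1.
Qed.

End TermTools.

Section AlmostCentralTerms.
Variable R : realType.
Notation C := R[i].
Variables (A : cstarAlgType R) (n : nat) (x : 'I_n -> A).
Hypothesis xsa : forall i, self_adjoint (x i).
Hypothesis xgen : generates x.
Hypothesis Adiv : approximately_divisible A.

Notation ev t := (teval (fun c => c%:A : A) x t).
Notation evM M t := (teval (@scalar_mx C _) M t).

Definition hermitian_term (t : term n) := forall k (M : 'I_n -> 'M[C]_k),
  (forall i, (M i)^t* = M i) -> (evM M t)^t* = evM M t.

(** The exact relations of [approximate_halving] are terms in six variables.  These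
    are Lipschitz, so the relations persist approximately when the elements are
    replaced by values of terms in x. *)
Lemma approximate_halving_terms (q : term n) (e : R) : 0 < e ->
  exists F V V' W W' : term n, [/\ hermitian_term F,
   forall i, cnorm (ev F * x i - x i * ev F) < e,
   [/\ cnorm (ev F) < 2, cnorm (ev V) < 2, cnorm (ev V') < 2, cnorm (ev W) < 2 &
       cnorm (ev W') < 2],
   [/\ cnorm (ev F * ev F - ev F) < e,
      cnorm (1 - (ev F + (ev V * ev F * ev V' + ev W * ev F * ev W'))) < e &
      cnorm (ev F - ev V' * (1 - ev F) * ev V) < e] &
   [/\ cnorm (ev F * ev q - ev q * ev F) < e, cnorm (ev V * ev q - ev q * ev V) < e,
       cnorm (ev V' * ev q - ev q * ev V') < e, cnorm (ev W * ev q - ev q * ev W) < e &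
       cnorm (ev W' * ev q - ev q * ev W') < e]].
Proof.
move=> e0.
(* The six variables stand for f, v, v', w, w' and the value of q, in this order. *)
pose va (i : 'I_6) : term 6 := TVar i.
pose F := va ord0; pose V := va (inord 1); pose V' := va (inord 2).
pose W := va (inord 3); pose W' := va (inord 4); pose Q := va (inord 5).
pose rel : 'I_8 -> term 6 := fun i => nth F [::
  tsub (TMul F F) F;
  tsub (tone 6) (TAdd F (TAdd (TMul (TMul V F) V') (TMul (TMul W F) W')));
  tsub F (TMul (TMul V' (tsub (tone 6) F)) V);
  tsub (TMul F Q) (TMul Q F); tsub (TMul V Q) (TMul Q V);
  tsub (TMul V' Q) (TMul Q V'); tsub (TMul W Q) (TMul Q W);
  tsub (TMul W' Q) (TMul Q W')] i.
have nq := cnorm_ge0 (ev q).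
have [K [K2 Kq Kx]] : exists K : R, [/\ 2 <= K, cnorm (ev q) <= K &
    forall i, cnorm (x i) <= K].
  have sx0 : 0 <= \sum_i cnorm (x i) by apply: sumr_ge0 => i _; exact: cnorm_ge0.
  exists (2 + cnorm (ev q) + \sum_i cnorm (x i)); split; [lra|lra|move=> i].
  rewrite (bigD1 i) //=.
  have : 0 <= \sum_(j | j != i) cnorm (x j) by apply: sumr_ge0 => j _; exact: cnorm_ge0.
  lra.
have [L L0 hL] := teval_lip_fam K rel.
have [e1 [e10 e11 e1L e1K]] : exists e1 : R,
    [/\ 0 < e1, e1 < 1, L * e1 < e / 2 & e1 * (1 + 2 * K) < e].
  pose D := 2 * (L + 1 + 2 * K + e).
  have D0 : 0 < D by rewrite /D; lra.
  have h : e / D * D = e by rewrite divfK // gt_eqF.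
  have h0 : 0 < e / D by rewrite divr_gt0.
  exists (e / D); move: h h0; rewrite /D; move: (e / _) => z.
  have K0 : 0 <= K by lra.
  move=> h h0; have : 0 <= z * L by rewrite mulr_ge0 // ltW.
  have : 0 <= z * K by rewrite mulr_ge0 // ltW.
  have : 0 < z * e by rewrite mulr_gt0.
  split => //; nra.
(* The generators, with the value of q appended as last entry. *)
pose y (j : 'I_n.+1) : A := oapp x (ev q) (unlift ord_max j).
have [f [v [v' [w [w' [fs ff [nf nv nv' nw nw'] [r1 r2] cm]]]]]] :=
  approximate_halving Adiv y e10.
have cx z : z \in [:: f; v; v'; w; w'] -> forall i, cnorm (z * x i - x i * z) < e1.
  by move=> zl i; have := cm z zl (lift ord_max i); rewrite /y liftK /= cnormBC.
have cq z : z \in [:: f; v; v'; w; w'] -> cnorm (z * ev q - ev q * z) < e1.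
  by move=> zl; have := cm z zl ord_max; rewrite /y unlift_none /= cnormBC.
have [tf hf] := sym_terms_dense xsa xgen fs e10.
have [tv hv] := terms_dense xsa xgen v e10.
have [tv' hv'] := terms_dense xsa xgen v' e10.
have [tw hw] := terms_dense xsa xgen w e10.
have [tw' hw'] := terms_dense xsa xgen w' e10.
pose tt6 (i : 'I_6) := nth q [:: tsym tf; tv; tv'; tw; tw'; q] i.
pose el6 (i : 'I_6) := nth 0 [:: f; v; v'; w; w'; ev q] i.
have el_tt i : cnorm (el6 i - ev (tt6 i)) <= e1.
  rewrite /el6 /tt6; case: i => [[|[|[|[|[|[|//]]]]]] ?] /=; try exact: ltW.
  by rewrite subrr cnorm0 ltW.
have el_n i : cnorm (el6 i) <= K.
  rewrite /el6; case: i => [[|[|[|[|[|[|//]]]]]] ?] /=; lra.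
have tt_n0 (i : 'I_6) : (i < 5)%N -> cnorm (ev (tt6 i)) < 2.
  move=> i5; have : cnorm (el6 i) <= 1.
    by rewrite /el6; case: i i5 => [[|[|[|[|[|[|//]]]]]] ?].
  have -> : ev (tt6 i) = el6 i - (el6 i - ev (tt6 i)) by rewrite opprB addrC subrK.
  have := cnorm_leD (el6 i) (- (el6 i - ev (tt6 i))); rewrite cnormN.
  have := el_tt i; lra.
have tt_n (i : 'I_6) : cnorm (ev (tt6 i)) <= K.
  have [i5|i5] := ltnP i 5; first by have := tt_n0 i i5; lra.
  have -> : i = inord 5.
    by apply/val_inj; rewrite /= inordK //; apply/eqP; rewrite eqn_leq i5 -ltnS ltn_ord.
  by rewrite /tt6 inordK.
have na := cstar_normed A.
have relsmall j : cnorm (teval (fun c => c%:A : A) el6 (rel j)) < e1 ->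
    cnorm (teval (fun c => c%:A : A) (fun i => ev (tt6 i)) (rel j)) < e.
  move=> h.
  have h2 := hL j _ _ _ _ _ _ na tt_n el_n (ltW e10) _.
  have h3 : cnorm (teval (fun c => c%:A : A) (fun i => ev (tt6 i)) (rel j) -
     teval (fun c => c%:A : A) el6 (rel j)) <= L * e1.
    by apply: h2 => i; rewrite cnormBC.
  have := cnorm_leD (teval (fun c => c%:A : A) (fun i => ev (tt6 i)) (rel j) -
     teval (fun c => c%:A : A) el6 (rel j)) (teval (fun c => c%:A : A) el6 (rel j)).
  rewrite subrK.
  have : e1 < e / 2.
    have : e1 * 2 <= e1 * K by rewrite ler_pM2l.
    move: e1K; lra.
  lra.
have simp := (fun x s t => teval_tsub x s t na, fun x => teval_tone x na, tevalA, tevalM, tevalV).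
have relE j : cnorm (teval (fun c => c%:A : A) el6 (rel j)) < e1.
  case: j => [[|[|[|[|[|[|[|[|//]]]]]]]] ?]; rewrite /rel [nth _ _ _]/=
     /F /V /V' /W /W' /Q /va !simp /el6 ?inordK //=.
  - by rewrite ff subrr cnorm0.
  - by rewrite -r1 subrr cnorm0.
  - by rewrite -r2 subrr cnorm0.
  - by apply: cq; rewrite !inE eqxx ?orbT.
  - by apply: cq; rewrite !inE eqxx ?orbT.
  - by apply: cq; rewrite !inE eqxx ?orbT.
  - by apply: cq; rewrite !inE eqxx ?orbT.
  - by apply: cq; rewrite !inE eqxx ?orbT.
have rels j := relsmall j (relE j).
have small (i : 'I_6) : (i < 5)%N -> cnorm (ev (tt6 i)) < 2 by exact: tt_n0.
exists (tsym tf), tv, tv', tw, tw'; split.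
- by move=> k M Ms; apply: teval_ct.
- move=> i; set g := ev (tsym tf).
  have -> : g * x i - x i * g = (f * x i - x i * f) - ((f - g) * x i - x i * (f - g)).
    exact: commutator_change.
  have h1 := cx f (mem_head _ _) i.
  have h2 : cnorm ((f - g) * x i) <= e1 * K.
    apply: le_trans (cnorm_leM _ _) _; apply: ler_pM; rewrite ?cnorm_ge0 //.
    exact: ltW.
  have h3 : cnorm (x i * (f - g)) <= K * e1.
    apply: le_trans (cnorm_leM _ _) _; apply: ler_pM; rewrite ?cnorm_ge0 //.
    exact: ltW.
  have h4 := cnorm_leD (f * x i - x i * f) (- ((f - g) * x i - x i * (f - g))).
  have h5 := cnorm_leD ((f - g) * x i) (- (x i * (f - g))).
  rewrite cnormN in h4; rewrite cnormN in h5.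
  move: e1K h1 h2 h3 h4 h5; lra.
- split; [exact: (small (@Ordinal 6 0 isT))|exact: (small (@Ordinal 6 1 isT))|
    exact: (small (@Ordinal 6 2 isT))|exact: (small (@Ordinal 6 3 isT))|
    exact: (small (@Ordinal 6 4 isT))].
- split.
  + have := rels (@Ordinal 8 0 isT).
    by rewrite /rel [nth _ _ _]/= /F /V /V' /W /W' /Q /va !simp /tt6 ?inordK.
  + have := rels (@Ordinal 8 1 isT).
    by rewrite /rel [nth _ _ _]/= /F /V /V' /W /W' /Q /va !simp /tt6 ?inordK.
  + have := rels (@Ordinal 8 2 isT).
    by rewrite /rel [nth _ _ _]/= /F /V /V' /W /W' /Q /va !simp /tt6 ?inordK.
split.
+ have := rels (@Ordinal 8 3 isT).
  by rewrite /rel [nth _ _ _]/= /F /V /V' /W /W' /Q /va !simp /tt6 ?inordK.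
+ have := rels (@Ordinal 8 4 isT).
  by rewrite /rel [nth _ _ _]/= /F /V /V' /W /W' /Q /va !simp /tt6 ?inordK.
+ have := rels (@Ordinal 8 5 isT).
  by rewrite /rel [nth _ _ _]/= /F /V /V' /W /W' /Q /va !simp /tt6 ?inordK.
+ have := rels (@Ordinal 8 6 isT).
  by rewrite /rel [nth _ _ _]/= /F /V /V' /W /W' /Q /va !simp /tt6 ?inordK.
+ have := rels (@Ordinal 8 7 isT).
  by rewrite /rel [nth _ _ _]/= /F /V /V' /W /W' /Q /va !simp /tt6 ?inordK.
Qed.

End AlmostCentralTerms.

Section AlmostCentralFamily.
Variable R : realType.
Notation C := R[i].
Variables (A : cstarAlgType R) (n : nat) (p : nat -> ncpoly R n) (x : 'I_n -> A).
Hypothesis hp : is_enumeration p.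
Hypothesis xsa : forall i, self_adjoint (x i).
Hypothesis xgen : generates x.
Hypothesis Adiv : approximately_divisible A.

Notation ev t := (teval (fun c => c%:A : A) x t).
Notation evM M t := (teval (@scalar_mx C _) M t).

(** Induction on s.  Given q, apply [approximate_halving_terms] to q with errors small
    compared with the tolerance of [refine_family_step], and take 2 q + F. *)
Lemma almost_central_family (s : nat) (dl : R) : 0 < dl -> exists q : term n,
  [/\ hermitian_term R q, forall i, cnorm (ev q * x i - x i * ev q) < dl &
  micro_near p x (fun k M => exists P, [/\ proj_family (2 ^ s) P,
    mxclose dl (weighted_sum (2 ^ s) P) (evM M q) &
    forall j, (j < 2 ^ s)%N -> (3 ^ s * \rank (P j) <= 2 ^ s * k)%N])].
Proof.
elim: s dl => [|s ih] dl dl0.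
  have q0 (T : pzRingType) (f : C -> T) nu y : normed_alg f nu ->
    teval f y (TConst n 0 0) = 0 by move=> na; rewrite /= /rat_complex !raddf0 (na_f0 na).
  exists (TConst n 0 0); split.
  - by move=> k M _; rewrite (q0 _ _ _ _ (matrix_normed R k)) trmx0 map_mx0.
  - by move=> i; rewrite (q0 _ _ _ _ (cstar_normed A)) mul0r mulr0 subrr cnorm0.
  apply: micro_near_mono (micro_near_herm p x) => k M _; exists (fun=> 1%:M); split.
  - exact: proj_family1.
  - rewrite (q0 _ _ _ _ (matrix_normed R k)) /weighted_sum big_ord1 scale0r.
    by apply: mxclose_le (mxclosexx 0); exact: ltW.
  - by move=> j _; rewrite mxrank1.
have d20 : 0 < dl / 2 by rewrite divr_gt0.
have [e e0 step] := refine_family_step (2 ^ s) d20.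
pose d1 := Num.min (dl / 8) (e / 16).
have d10 : 0 < d1 by rewrite lt_min !divr_gt0.
have d1a : d1 <= dl / 8 by rewrite ge_min lexx.
have d1b : d1 <= e / 16 by rewrite ge_min lexx orbT.
have [q [qsa qx qG]] := ih d1 d10.
pose e1 := Num.min (dl / 2) (e / 2).
have e10 : 0 < e1 by rewrite lt_min !divr_gt0.
have e1a : e1 <= dl / 2 by rewrite ge_min lexx.
have e1b : e1 <= e / 2 by rewrite ge_min lexx orbT.
clearbody d1 e1.
have e1e : e1 <= e by move: e1b e0; lra.
have num : 2 * d1 + e1 + d1 * 2 <= e by move: d1b e1b; lra.
have num' : dl / 2 + (d1 + d1 + 0) <= dl by move: d1a dl0; lra.
have [F [V [V' [W [W' [Fsa Fx [nF nV nV' nW nW'] [r1 r2 r3] [cF cV cV' cW cW']]]]]]] :=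
  approximate_halving_terms xsa xgen Adiv q e10.
pose q' := TAdd (TAdd q q) F.
exists q'; split.
- by move=> k M Ms; rewrite /= !ctD qsa // Fsa.
- move=> i; rewrite /=.
  have -> : (ev q + ev q + ev F) * x i - x i * (ev q + ev q + ev F) =
    (ev q * x i - x i * ev q) + (ev q * x i - x i * ev q) + (ev F * x i - x i * ev F).
    by rewrite !mulrDl !mulrDr !opprD addrACA; congr (_ + _); rewrite addrACA.
  have := qx i; have := Fx i.
  have := cnorm_leD (ev q * x i - x i * ev q + (ev q * x i - x i * ev q)) (ev F * x i - x i * ev F).
  have := cnorm_leD (ev q * x i - x i * ev q) (ev q * x i - x i * ev q).
  lra.
have naA := cstar_normed A.
have rel (t : term n) (X : A) (a : R) : ev t = X -> cnorm X < a ->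
    micro_near p x (fun k M => opnorm (evM M t) < a).
  by move=> tX Xa; apply: (micro_near_small hp); rewrite tX.
have simA := (fun (y : 'I_n -> A) s t => teval_tsub y s t naA,
  fun y : 'I_n -> A => teval_tone y naA,
  @tevalA R n, @tevalM R n).
have R1 := rel (tsub (TMul F F) F) _ _ _ r1.
have R2 := rel (tsub (tone n) (TAdd F (TAdd (TMul (TMul V F) V') (TMul (TMul W F) W')))) _ _ _ r2.
have R3 := rel (tsub F (TMul (TMul V' (tsub (tone n) F)) V)) _ _ _ r3.
have RF := rel (tsub (TMul F q) (TMul q F)) _ _ _ cF.
have RV := rel (tsub (TMul V q) (TMul q V)) _ _ _ cV.
have RV' := rel (tsub (TMul V' q) (TMul q V')) _ _ _ cV'.
have RW := rel (tsub (TMul W q) (TMul q W)) _ _ _ cW.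
have RW' := rel (tsub (TMul W' q) (TMul q W')) _ _ _ cW'.
rewrite !simA in R1 R2 R3 RF RV RV' RW RW'.
have G1 := micro_near_and qG (micro_near_and (R1 erefl)
  (micro_near_and (R2 erefl) (R3 erefl))).
have G2 := micro_near_and (RF erefl) (micro_near_and (RV erefl)
  (micro_near_and (RV' erefl)
  (micro_near_and (RW erefl) (RW' erefl)))).
have G3 := micro_near_and (micro_near_small hp nF)
  (micro_near_and (micro_near_small hp nV) (micro_near_and (micro_near_small hp nV')
  (micro_near_and (micro_near_small hp nW) (micro_near_small hp nW')))).
have G4 := micro_near_and (micro_near_herm p x)
  (micro_near_and G1 (micro_near_and G2 G3)).
apply: micro_near_mono G4 => k M [Ms [[[P [PP PH Pr]] [m1 [m2 m3]]] [[c1 [c2 [c3 [c4 c5]]]]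
  [n1 [n2 [n3 [n4 n5]]]]]]].
have naM := matrix_normed R k.
have simM := (fun (y : 'I_n -> 'M[C]_k) s t => teval_tsub y s t naM,
  fun y : 'I_n -> 'M[C]_k => teval_tone y naM,
  @tevalA R n, @tevalM R n).
rewrite !simM in m1 m2 m3 c1 c2 c3 c4 c5.
have cc Z : opnorm Z < 2 -> opnorm (Z * evM M q - evM M q * Z) < e1 ->
    mxclose e (Z *m weighted_sum (2 ^ s) P) (weighted_sum (2 ^ s) P *m Z).
  move=> /ltW Z2 /mxcloseW Zq.
  have h1 := mxclose_mull Z2 PH; have h2 := mxclose_mulr Z2 (mxclose_sym PH).
  exact: mxclose_le num (mxclose_trans (mxclose_trans h1 Zq) h2).
have [||||||P' [PP' PH' Pr']] := step k P (evM M F) (evM M V) (evM M V') (evM M W) (evM M W') PP.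
- exact: (Fsa k M Ms).
- exact: (mxclose_le e1e (mxcloseW m1)).
- exact: (mxclose_le e1e (mxcloseW m2)).
- exact: (mxclose_le e1e (mxcloseW m3)).
- move=> z; rewrite !inE => /or4P[/eqP->|/eqP->|/eqP->|/orP[]/eqP->];
    [exact: ltW n1|exact: ltW n2|exact: ltW n3|exact: ltW n4|exact: ltW n5].
- move=> z; rewrite !inE => /or4P[/eqP->|/eqP->|/eqP->|/orP[]/eqP->];
    [exact: cc n1 c1|exact: cc n2 c2|exact: cc n3 c3|exact: cc n4 c4|exact: cc n5 c5].
exists P'; rewrite expnS mul2n; split => //.
- have h : mxclose (d1 + d1 + 0) (2%:R *: weighted_sum (2 ^ s) P + evM M F) (evM M q').
    apply: mxcloseD; last exact: mxclosexx.
    by rewrite scaler_nat mulr2n; exact: mxcloseD.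
  exact: mxclose_le num' (mxclose_trans PH' h).
- move=> j jd; have := Pr' j jd; have := Pr _ (half_lt jd).
  rewrite expnS; move: (\rank _) (\rank _) (3 ^ s)%N (2 ^ s)%N => a b c d h1 h2.
  rewrite -mulnA mulnCA; apply: leq_trans (leq_mul (leqnn c) h2) _.
  rewrite mulnCA -mul2n -mulnA; exact: leq_mul.
Qed.

End AlmostCentralFamily.

(** * The upper bound *)

Section DiagFamily.
Variable R : realType.
Notation C := R[i].
Variables (k d : nat) (U : 'M[C]_k) (l : 'I_k -> nat).
Hypothesis Uu : unitary U.
Hypothesis ld : forall a, (l a < d)%N.

Definition conj_diag : 'M[C]_k := U *m real_diag (fun a => (l a)%:R : R) *m U^t*.
Definition eigen_proj (j : nat) : 'M[C]_k := U *m real_diag (fun a => (l a == j)%:R : R) *m U^t*.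

Lemma real_diag_sum (I : Type) (r : seq I) (F : I -> 'I_k -> R) :
  \sum_(i <- r) real_diag (F i) = real_diag (fun a => \sum_(i <- r) F i a).
Proof.
apply/matrixP => a b; rewrite summxE real_diagE; under eq_bigr do rewrite real_diagE.
by case: eqP => _; [rewrite rmorph_sum|rewrite big1].
Qed.

Lemma real_diag_ext (f g : 'I_k -> R) : (forall a, f a = g a) -> real_diag f = real_diag g.
Proof. by move=> fg; congr real_diag; apply: functional_extensionality_dep. Qed.

Lemma real_diag1 : real_diag (fun=> 1 : R) = 1%:M :> 'M[C]_k.
Proof. by apply/matrixP => a b; rewrite real_diagE !mxE; case: eqP. Qed.

Lemma real_diag0 : real_diag (fun=> 0 : R) = 0 :> 'M[C]_k.
Proof. by apply/matrixP => a b; rewrite real_diagE !mxE; case: eqP. Qed.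

Lemma real_diagZ (x : R) (f : 'I_k -> R) : x%:C *: real_diag f = real_diag (fun a => x * f a).
Proof.
apply/matrixP => a b; rewrite mxE !real_diagE; case: eqP => _; last by rewrite mulr0.
by rewrite rmorphM.
Qed.

Lemma sum_delta_ord (F : nat -> R) m : (m < d)%N -> \sum_(j < d) F j * (m == j)%:R = F m.
Proof.
move=> md; rewrite (bigD1 (Ordinal md)) //= eqxx mulr1 big1 ?addr0 // => j.
by rewrite -val_eqE /= eq_sym => /negbTE->; rewrite mulr0.
Qed.

Lemma eigen_proj_family : proj_family d eigen_proj.
Proof.
split.
- by move=> j _; rewrite /eigen_proj !ctM ctK real_diag_ct mulmxA.
- move=> i j _ _; rewrite /eigen_proj (sandwichM _ _ Uu) real_diagM.
  have [->|ij] := eqVneq i j.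
    by congr (_ *m _ *m _); apply: real_diag_ext => a; case: eqP; rewrite ?mulr1 ?mulr0.
  rewrite (_ : real_diag _ = 0) ?mulmx0 ?mul0mx // -real_diag0; apply: real_diag_ext => a.
  by case: eqP => [->|]; rewrite ?mul0r // (negbTE ij) mulr0.
rewrite /eigen_proj -mulmx_suml -mulmx_sumr real_diag_sum.
rewrite (_ : real_diag _ = 1%:M) ?mulmx1 ?unitaryC //.
rewrite -real_diag1; apply: real_diag_ext => a.
by have := sum_delta_ord (fun=> 1) (ld a); under eq_bigr do rewrite mul1r.
Qed.

Lemma weighted_sum_eigen : weighted_sum d eigen_proj = conj_diag.
Proof.
rewrite /weighted_sum /eigen_proj /conj_diag.
under eq_bigr do rewrite -(rmorph_nat (real_complex R)) scalemxAl scalemxAr real_diagZ.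
rewrite -mulmx_suml -mulmx_sumr real_diag_sum; congr (_ *m _ *m _).
by apply: real_diag_ext => a; exact: (sum_delta_ord (fun j => j%:R)).
Qed.

Lemma conj_diag_ct : conj_diag^t* = conj_diag.
Proof. by rewrite /conj_diag !ctM ctK real_diag_ct mulmxA. Qed.

Lemma conj_diag_norm : opnorm conj_diag <= d%:R.
Proof.
rewrite opnorm_conj //; apply: opnorm_real_diag => // a.
by rewrite ger0_norm // ler_nat ltnW.
Qed.

Definition same_block (a b : 'I_k) := l a == l b.

(** In the eigenbasis U, a matrix commuting with the eigenprojections is block
    diagonal. *)
Lemma pinch_block X : X^t* = X ->
  herm_supp same_block (U^t* *m pinch d eigen_proj X *m U).
Proof.
move=> Xs; have QP := eigen_proj_family; have UU := unitaryC Uu.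
set E := pinch d eigen_proj X.
have Es : E^t* = E by rewrite /E (pinch_ct QP) Xs.
have EH : E *m conj_diag = conj_diag *m E.
  rewrite -weighted_sum_eigen /weighted_sum mulmx_sumr mulmx_suml; apply: eq_bigr => j _.
  by rewrite -scalemxAr -scalemxAl (pinch_comm QP).
clearbody E; split; first by rewrite !ctM ctK Es mulmxA.
move=> a b ab.
apply: (@comm_real_diag _ _ (fun a => (l a)%:R : R)); last by rewrite eqr_nat.
have [Y EY] : exists Y, E = U *m Y *m U^t*.
  by exists (U^t* *m E *m U); rewrite (sandwichK E UU).
move: EH; rewrite /conj_diag EY (sandwichM Y _ Uu) (sandwichM _ Y Uu).
by move=> /(congr1 (fun Z => U^t* *m Z *m U)); rewrite !(sandwichK _ Uu).
Qed.

(** Each row a of the pattern contains as many pairs as the block of a has elements. *)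
Lemma support_card_same_block (x y : nat) :
  (forall j, (j < d)%N -> (x * #|[pred a | l a == j]| <= y * k)%N) ->
  (x * support_card same_block <= y * k ^ 2)%N.
Proof.
move=> h; rewrite /support_card -sum1_card /=.
rewrite (eq_bigl (fun x : 'I_k * 'I_k => true && same_block x.1 x.2)) //.
rewrite -(pair_big_dep xpredT (fun a b => same_block a b) (fun _ _ => 1%N)) /=.
rewrite big_distrr /=; apply: (@leq_trans (\sum_(a < k) y * k)%N).
  apply: leq_sum => a _; rewrite sum1_card.
  apply: leq_trans (h (l a) (ld a)); rewrite leq_mul2l; apply/orP; right.
  by apply: subset_leq_card; apply/fintype.subsetP => b; rewrite !inE /same_block eq_sym.
by rewrite sum_nat_const card_ord mulnCA expnS expn1.
Qed.

End DiagFamily.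

Section KeyDiag.
Variable R : realType.
Notation C := R[i].
Variables (A : cstarAlgType R) (n : nat) (p : nat -> ncpoly R n) (x : 'I_n -> A).
Hypothesis hp : is_enumeration p.
Hypothesis xsa : forall i, self_adjoint (x i).
Hypothesis xgen : generates x.
Hypothesis Adiv : approximately_divisible A.

Notation evM M t := (teval (@scalar_mx C _) M t).

Lemma almost_central_diag (s : nat) (dl : R) : 0 < dl -> exists q : term n,
  [/\ hermitian_term R q,
   micro_near p x (fun k M => forall i, mxclose dl (evM M q *m M i) (M i *m evM M q)) &
   micro_near p x (fun k M => exists U l, [/\ unitary U, forall a, (l a < 2 ^ s)%N,
     mxclose dl (conj_diag U l) (evM M q) &
    forall j, (j < 2 ^ s)%N -> (3 ^ s * #|[pred a | l a == j]| <= 2 ^ s * k)%N])].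
Proof.
move=> dl0; have [q [qsa qx qG]] := almost_central_family hp xsa xgen Adiv s dl0.
exists q; split => //.
  apply: micro_near_all => i.
  have h : cnorm (teval (fun c => c%:A : A) x (tsub (TMul q (TVar i)) (TMul (TVar i) q))) < dl.
    by rewrite (teval_tsub _ _ _ (cstar_normed A)); exact: qx.
  apply: micro_near_mono (micro_near_small hp h) => k M.
  by rewrite (teval_tsub _ _ _ (matrix_normed R k)); exact: mxcloseW.
apply: micro_near_mono qG => k M [P [PP PH Pr]].
have [U [l [Uu ld He hl]]] := proj_family_diag PP.
exists U, l; split; [exact: Uu|exact: ld|by move: PH; rewrite He|].
move=> j jd; apply: leq_trans (Pr j jd); rewrite leq_mul2l; apply/orP; right.
exact: hl.
Qed.

Lemma micro_near_bounded :
  micro_near p x (fun k M => forall i, opnorm (M i) <= cnorm (x i) + 1).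
Proof.
apply: micro_near_all => i.
apply: micro_near_mono (micro_near_small hp (t := TVar i)
  (e := cnorm (x i) + 1) _) => [k M|].
  exact: ltW.
by rewrite /= ltrDl.
Qed.

End KeyDiag.

Section MatrixCover.
Variable R : realType.
Notation C := R[i].
Variables (n k d e2 : nat) (Rb rho w : R).
Hypothesis Rb1 : 1 <= Rb.
Hypothesis rho0 : 0 < rho.
Hypothesis w0 : 0 < w.
Hypothesis w1 : w < 1.
Hypothesis rhod : rho <= d%:R.
Hypothesis rhow : d%:R ^+ 2 * (5 * Rb * rho) <= w / 4.

(** Here U is an eigenbasis and l the eigenvalues of a matrix almost commuting with the
    tuple, and e2 bounds the real dimension of the hermitian block diagonal matrices. *)
Definition block_data (M : 'I_n -> 'M[C]_k) (U : 'M[C]_k) (l : 'I_k -> nat) :=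
  [/\ unitary U, forall a, (l a < d)%N, (support_card (same_block l) <= e2)%N &
    forall i, mxclose rho (M i *m conj_diag U l) (conj_diag U l *m M i)].

Definition block_tuple (M : 'I_n -> 'M[C]_k) :=
  [/\ forall i, (M i)^t* = M i, forall i, opnorm (M i) <= Rb &
    exists U l, block_data M U l].

Lemma support_card_full : support_card (fun _ _ : 'I_k => true) = (k ^ 2)%N.
Proof. by rewrite /support_card /= card_prod card_ord expnS expn1. Qed.

(** One tuple M0 in the cell supplies a basis U and labels l that serve all of them:
    another tuple in the cell almost commutes with its own matrix, which is close to
    that of M0, hence with that of M0, and is therefore close to its pinching. *)
Lemma cell_cover (c : 'M[C]_k) : exists cen : nat -> 'M[C]_k,
  forall M, block_tuple M ->
    (exists U l, block_data M U l /\ opnorm (conj_diag U l - c) < rho) ->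
  forall i, exists2 u, (u < Num.truncn ((32 * Rb / w) ^+ e2))%N & opnorm (M i - cen u) < w.
Proof.
have num1 : Rb * (2 * rho) + rho + 2 * rho * Rb <= 5 * Rb * rho.
  have : rho * 1 <= rho * Rb by rewrite ler_pM2l.
  lra.
have num2 : Rb + w / 4 <= 2 * Rb by move: w1 Rb1; lra.
have num3 : 1 <= 32 * Rb / w by rewrite ler_pdivlMr // mul1r; move: w1 Rb1; lra.
have num4 (u1 u2 : R) : u1 <= w / 4 -> u2 < w / 2 -> u1 + u2 < w by move: w0; lra.
have w2 : 0 < w / 2 by rewrite divr_gt0.
have wR : w / 2 <= 2 * Rb by move: w1 Rb1; lra.
have [[M0 [Mb0 [U [l [[Uu ld le2 cm] hc]]]]]|no] := pselect (exists M, block_tuple M /\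
  exists U l, block_data M U l /\ opnorm (conj_diag U l - c) < rho); last first.
  by exists (fun=> 0) => M Mb Mn; case: no; exists M.
have sym : symmetric (same_block l) by move=> a b; rewrite /same_block eq_sym.
have [N [cen [Nb cenP]]] := herm_cover sym w2 wR.
exists (fun u => U *m cen u *m U^t*) => M [Ms Mb _] [U' [l' [[_ _ _ cm'] hc']]] i.
have QP := eigen_proj_family Uu ld.
pose E := pinch d (eigen_proj U l) (M i).
have HH : mxclose (2 * rho) (conj_diag U' l') (conj_diag U l).
  have h1 : mxclose rho (conj_diag U' l') c by exact: mxcloseW.
  have h2 : mxclose rho (conj_diag U l) c by exact: mxcloseW.
  by apply: mxclose_le (mxclose_trans h1 (mxclose_sym h2)); rewrite mulr_natl mulr2n.
have cMi : mxclose (5 * Rb * rho) (M i *m conj_diag U l) (conj_diag U l *m M i).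
  have h1 := mxclose_mull (Mb i) (mxclose_sym HH).
  have h2 := mxclose_mulr (Mb i) HH.
  exact: mxclose_le num1 (mxclose_trans (mxclose_trans h1 (cm' i)) h2).
have ME : mxclose (w / 4) (M i) E.
  apply: mxclose_le rhow _; rewrite -(weighted_sum_eigen U ld) in cMi.
  by apply: le_trans (off_pinch QP (M i)) _; apply: ler_wpM2l cMi; rewrite exprn_ge0.
have UU := unitaryC Uu.
have EU : E = U *m (U^t* *m E *m U) *m U^t* by rewrite (sandwichK E UU).
have En : opnorm (U^t* *m E *m U) <= 2 * Rb.
  rewrite -(opnorm_conj _ Uu) -EU; exact: le_trans (mxclose_norm ME (Mb i)) num2.
have [u uN hu] := cenP _ (pinch_block Uu ld (Ms i)) En.
exists u.
  apply: leq_trans uN _; rewrite -[N](@natrK R); apply: le_truncn.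
  apply: le_trans Nb _.
  have -> : 8 * (2 * Rb) / (w / 2) = 32 * Rb / w by field; rewrite gt_eqF.
  exact: ler_weXn2l.
have hE : opnorm (E - U *m cen u *m U^t*) < w / 2.
  by rewrite EU sandwichB opnorm_conj.
have -> : M i - U *m cen u *m U^t* = (M i - E) + (E - U *m cen u *m U^t*).
  by rewrite addrA subrK.
apply: le_lt_trans (opnormD _ _) _.
exact: num4 ME hE.
Qed.

(** The first factor counts the cells for the almost central matrix, the second the
    points of a net of block diagonal matrices, one for each of the n coordinates. *)
Lemma block_tuple_cover : exists (N : nat) (c : 'I_N -> 'I_n -> 'M[C]_k),
  N%:R <= (8 * d%:R / rho) ^+ (k ^ 2) * ((32 * Rb / w) ^+ e2) ^+ n /\
  forall M, block_tuple M -> exists s, tuple_norm (fun i => M i - c s i) < w.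
Proof.
have [N1 [c1 [N1b c1P]]] := @herm_cover R k (fun _ _ => true) (fun _ _ => erefl) _ _ rho0 rhod.
have /choice[cen cenP] t := cell_cover (c1 t).
pose N2 := Num.truncn ((32 * Rb / w) ^+ e2).
pose T : finType := ('I_N1 * {ffun 'I_n -> 'I_N2})%type.
exists #|T|, (fun (s : 'I_#|T|) i =>
  let z : 'I_N1 * {ffun 'I_n -> 'I_N2} := enum_val s in cen z.1 (z.2 i)); split.
  rewrite card_prod card_ffun !card_ord natrM natrX; rewrite support_card_full in N1b.
  have b2 : 0 <= (32 * Rb / w) ^+ e2.
    by rewrite exprn_ge0 // divr_ge0 ?(ltW w0) // mulr_ge0 // (le_trans ler01).
  by apply: ler_pM => //; rewrite ?exprn_ge0 // lerXn2r ?nnegrE // /N2 truncn_le.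
move=> M Mb; have [_ _ [U [l dat]]] := Mb; have [Uu ld _ _] := dat.
have [] := c1P (conj_diag U l).
- by split => //; exact: conj_diag_ct.
- exact: conj_diag_norm.
move=> t tN ht.
have /choice[u uP] i : exists u, (u < N2)%N /\ opnorm (M i - cen t u) < w.
  have [u h1 h2] := cenP t M Mb (ex_intro _ U (ex_intro _ l (conj dat ht))) i.
  by exists u.
pose z : T := (Ordinal tN, [ffun i => Ordinal (uP i).1]).
exists (enum_rank z); rewrite /tuple_norm; apply: bigmax_lt => // i _.
rewrite enum_rankK /= ffunE /=; exact: (uP i).2.
Qed.

End MatrixCover.

Section Upper.
Variable R : realType.
Notation C := R[i].
Variables (A : cstarAlgType R) (n : nat) (p : nat -> ncpoly R n) (x : 'I_n -> A).
Hypothesis hp : is_enumeration p.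
Hypothesis xsa : forall i, self_adjoint (x i).
Hypothesis xgen : generates x.
Hypothesis Adiv : approximately_divisible A.

Lemma limn_esup_le (u : nat -> \bar R) (c : \bar R) :
  (forall k, (u k <= c)%E) -> (limn_esup u <= c)%E.
Proof.
move=> h; apply: (@le_trans _ _ (ereal_sup (u @` setT))).
  by apply: ereal_inf_lbound; exists setT => //; exact: filterT.
by apply: ge_ereal_sup => _ [k _ <-].
Qed.

Lemma covering_number_ge0 k (F : set ('I_n -> 'M[C]_k)) w : (0 <= covering_number F w)%E.
Proof. by apply: le_ereal_inf_tmp => _ [N _ <-]; rewrite lee_fin. Qed.

Lemma covering_number_le k (F : set ('I_n -> 'M[C]_k)) w (N : nat) (c : 'I_N -> 'I_n -> 'M[C]_k) :
  (forall M, F M -> exists s, tuple_norm (fun i => M i - c s i) < w) ->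
  (covering_number F w <= (N%:R)%:E)%E.
Proof. by move=> h; apply: ereal_inf_lbound; exists N => //=; exists c. Qed.

Lemma generator_bound : exists2 Rb : R, 1 <= Rb & forall i, cnorm (x i) + 1 <= Rb.
Proof.
have s0 (P : pred 'I_n) : 0 <= \sum_(i | P i) cnorm (x i).
  by apply: sumr_ge0 => i _; exact: cnorm_ge0.
exists (1 + \sum_i cnorm (x i)); first by have := s0 xpredT; lra.
by move=> i; rewrite (bigD1 i) //=; have := s0 (fun j => j != i); lra.
Qed.

(** The rank bound (2 / 3) ^ s k on the eigenspaces bounds the number of pairs in the
    same block by (2 / 3) ^ s k^2. *)
Lemma block_tuple_eventually (s : nat) (rho Rb : R) : 0 < rho -> 1 <= Rb ->
  (forall i, cnorm (x i) + 1 <= Rb) ->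
  micro_near p x (fun k M => block_tuple (2 ^ s) (2 ^ s * k ^ 2 %/ 3 ^ s) Rb rho M).
Proof.
move=> rho0 Rb1 hRb.
(* Three errors of size at most Rb * dl have to fit into rho. *)
pose dl := rho / (3 * Rb).
have Rb0 : 0 < Rb by lra.
have dl0 : 0 < dl by rewrite divr_gt0 // mulr_gt0.
have num : Rb * dl + dl + dl * Rb <= rho.
  have e : dl * (3 * Rb) = rho by rewrite /dl divfK // gt_eqF // mulr_gt0.
  have : dl * 1 <= dl * Rb by rewrite ler_pM2l.
  move: e; lra.
clearbody dl.
have [q [qsa qx qG]] := almost_central_diag hp xsa xgen Adiv s dl0.
apply: micro_near_mono (micro_near_and (micro_near_herm p x)
  (micro_near_and (micro_near_bounded x hp) (micro_near_and qx qG))).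
move=> k M [Ms [Mb [cm [U [l [Uu ld He hl]]]]]].
have Mb' i : opnorm (M i) <= Rb by exact: le_trans (Mb i) (hRb i).
split => //; exists U, l; split => //.
  rewrite leq_divRL ?expn_gt0 // mulnC; exact: support_card_same_block.
move=> i.
have h1 := mxclose_mull (Mb' i) He; have h2 := mxclose_mulr (Mb' i) (mxclose_sym He).
exact: mxclose_le num (mxclose_trans (mxclose_trans h1 (mxclose_sym (cm i))) h2).
Qed.

(** The bound of [block_tuple_cover] with the radius of the cells proportional to w,
    so that every base has the form constant / w. *)
Lemma delta_top_at_le (s : nat) : exists2 K : R, 0 <= K & forall w, 0 < w -> w < 1 ->
  (delta_top_at p x w <= (1 + n%:R * (2 / 3) ^+ s + K / (- ln w))%:E)%E.
Proof.
have [Rb Rb1 hRb] := generator_bound; have Rb0 : 0 < Rb by lra.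
pose d := (2 ^ s)%N; have d0 : (0 < d)%N by rewrite expn_gt0.
have d1 : 1 <= d%:R :> R by rewrite ler1n.
pose D : R := d%:R ^+ 2; have D1 : 1 <= D by rewrite exprn_ege1.
(* The bases 8 d / rho and 32 Rb / w of the two factors, multiplied by w. *)
pose K1 := 160 * d%:R * D * Rb; pose K2 := 32 * Rb.
have K21 : 1 <= K2 by rewrite /K2; lra.
have K11 : 1 <= K1.
  rewrite /K1; have h1 : 1 <= d%:R * D by rewrite mulr_ege1.
  have h2 : 1 <= d%:R * D * Rb by rewrite mulr_ege1.
  have -> : 160 * d%:R * D * Rb = 160 * (d%:R * D * Rb) by rewrite !mulrA.
  by rewrite mulr_ege1 //; lra.
pose eta : R := (2 / 3) ^+ s.
have eta0 : 0 <= eta by rewrite exprn_ge0.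
exists (ln K1 + n%:R * eta * ln K2); first by rewrite addr_ge0 ?mulr_ge0 ?ln_ge0.
move=> w w0 w1; pose L := - ln w.
have L0 : 0 < L by rewrite oppr_gt0 ln_lt0 // w0.
(* Makes the distance d^2 * (5 Rb rho) to the pinching equal to w / 4. *)
pose rho := w / (20 * D * Rb).
have rho0 : 0 < rho by rewrite divr_gt0 // !mulr_gt0 // (lt_le_trans ltr01).
have rhoe : rho * (20 * D * Rb) = w.
  by rewrite /rho divfK // gt_eqF // !mulr_gt0 // (lt_le_trans ltr01).
have rhod : rho <= d%:R.
  apply: le_trans d1; apply: le_trans (ltW w1).
  have h2 : 1 <= D * Rb by rewrite mulr_ege1.
  have : rho * 1 <= rho * (D * Rb) by rewrite ler_pM2l.
  have : 0 <= rho * (D * Rb) by rewrite mulr_ge0 ?(ltW rho0) // (le_trans ler01).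
  move: rhoe; have -> : rho * (20 * D * Rb) = 20 * (rho * (D * Rb)) by ring.
  lra.
have rhow : D * (5 * Rb * rho) <= w / 4.
  rewrite -rhoe; lra.
have [e [m [e0 m0 hG]]] := block_tuple_eventually s rho0 Rb1 hRb.
have c0 : 0 <= 1 + n%:R * eta + (ln K1 + n%:R * eta * ln K2) / L.
  by rewrite !addr_ge0 ?mulr_ge0 ?divr_ge0 ?addr_ge0 ?mulr_ge0 ?ln_ge0 ?invr_ge0 ?(ltW L0).
apply: (@le_trans _ _ (limn_esup (fun k : nat =>
      lne (covering_number (Gamma_top p x (k := k) e m) w)
        * ((- k%:R ^+ 2 * ln w)^-1)%:E)%E)).
  by apply: ereal_inf_lbound; exists e, m.
apply: limn_esup_le => k.
have [->|k0] := posnP k.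
  by rewrite expr0n /= oppr0 mul0r invr0 mule0 lee_fin.
set e2 := (2 ^ s * k ^ 2 %/ 3 ^ s)%N.
have [N [c [Nb cP]]] := block_tuple_cover n k e2 Rb1 rho0 w0 w1 rhod rhow.
set cov := covering_number _ _.
have cov0 : (0 <= cov)%E by exact: covering_number_ge0.
have covN : (cov <= (N%:R)%:E)%E.
  by apply: (@covering_number_le _ _ _ _ c) => M /hG/cP.
pose B := (K1 / w) ^+ (k ^ 2) * ((K2 / w) ^+ e2) ^+ n.
have BE : (8 * d%:R / rho) ^+ (k ^ 2) * ((32 * Rb / w) ^+ e2) ^+ n = B.
  rewrite /B; congr (_ ^+ _ * _); rewrite /K1 -rhoe; field.
  by rewrite !gt_eqF // (lt_le_trans ltr01).
have K1w : 0 < K1 / w by rewrite divr_gt0 // (lt_le_trans ltr01).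
have K2w : 0 < K2 / w by rewrite divr_gt0 // (lt_le_trans ltr01).
have B0 : 0 < B by rewrite mulr_gt0 // !exprn_gt0.
have lc : (lne cov <= (ln B)%:E)%E.
  rewrite -lne_EFin // lee_lne.
  - by apply: le_trans covN _; rewrite lee_fin -BE.
  - by rewrite in_itv /= cov0 leey.
  - by rewrite in_itv /= lee_fin (ltW B0) leey.
have k2 : 0 < k%:R ^+ 2 :> R by rewrite exprn_gt0 // ltr0n.
have kL : - k%:R ^+ 2 * ln w = k%:R ^+ 2 * L by rewrite /L mulrN mulNr.
rewrite kL; have kLp : 0 < k%:R ^+ 2 * L by rewrite mulr_gt0.
apply: (@le_trans _ _ ((ln B)%:E * ((k%:R ^+ 2 * L)^-1)%:E)%E).
  by apply: lee_wpmul2r => //; rewrite lee_fin invr_ge0 ltW.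
rewrite -EFinM lee_fin ler_pdivrMr //.
have lnB : ln B = k%:R ^+ 2 * (ln K1 + L) + n%:R * (e2%:R * (ln K2 + L)).
  rewrite /B lnM ?posrE ?exprn_gt0 // !lnXn ?exprn_gt0 //.
  rewrite !ln_div ?posrE ?(lt_le_trans ltr01 K11) ?(lt_le_trans ltr01 K21) //.
  by congr (_ + _); [rewrite -natrX mulr_natl|rewrite !mulr_natl].
have e2b : e2%:R <= eta * k%:R ^+ 2 :> R.
  rewrite /eta expr_div_n mulrAC ler_pdivlMr ?exprn_gt0 // -!natrX -!natrM ler_nat.
  exact: leq_divM.
have lK1 := ln_ge0 K11; have lK2 := ln_ge0 K21.
have : n%:R * (e2%:R * (ln K2 + L)) <= n%:R * (eta * k%:R ^+ 2 * (ln K2 + L)).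
  by apply: ler_wpM2l => //; apply: ler_wpM2r => //; rewrite addr_ge0 // ltW.
rewrite lnB.
have -> : (1 + n%:R * eta + (ln K1 + n%:R * eta * ln K2) / L) * (k%:R ^+ 2 * L) =
  k%:R ^+ 2 * (ln K1 + L) + n%:R * (eta * k%:R ^+ 2 * (ln K2 + L)).
  by field; rewrite gt_eqF.
lra.
Qed.

End Upper.

(** * Cayley transforms and unitary orbits *)

Section Cayley.
Variable R : realType.
Notation C := R[i].
Variable k : nat.
Implicit Types (K X : 'M[C]_k).
Local Notation iC := (Complex (0 : R) 1).

Lemma nc_i : Normc.normc iC = 1.
Proof. by rewrite /= expr0n expr1n /= add0r sqrtr1. Qed.

Definition cayley_den K : 'M[C]_k := 1%:M - iC *: K.
Definition cayley_resolvent K : 'M[C]_k := invmx (cayley_den K).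
(** The Cayley transform (1 + i K) (1 - i K)^-1.  It takes the place of the exponential
    as a chart of the unitary group near 1. *)
Definition cayley K : 'M[C]_k := (cayley_den K)^t* *m cayley_resolvent K.

Section CayleyUnitary.
Variable K : 'M[C]_k.
Hypothesis Ks : K^t* = K.

Lemma conj_iC : conjc iC = - iC.
Proof. by apply/eqP; rewrite eq_complex /= oppr0 !eqxx. Qed.

Lemma cayley_den_ct : (cayley_den K)^t* = 1%:M + iC *: K.
Proof. by rewrite ctB ct1 ctZ Ks conj_iC scaleNr opprK. Qed.

Lemma cayley_den_normal : (cayley_den K)^t* *m cayley_den K = 1%:M + K *m K.
Proof.
rewrite cayley_den_ct /cayley_den mulmxBr mulmx1 mulmxDl mul1mx opprD addrA addrK.
rewrite -scalemxAl -scalemxAr scalerA -scaleNr.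
have -> : - (iC * iC) = 1 by rewrite -[iC * iC]/(iC ^+ 2) sqr_i opprK.
by rewrite scale1r.
Qed.

Lemma cayley_den_comm : (cayley_den K)^t* *m cayley_den K = cayley_den K *m (cayley_den K)^t*.
Proof.
rewrite cayley_den_ct /cayley_den; move: (iC *: K) => X.
rewrite mulmxBr mulmxDr !mulmx1 mulmxDl mulmxBl !mul1mx.
by rewrite opprD !addrA addrK subrK.
Qed.

(** By [cayley_den_normal], |T v|^2 = |v|^2 + |K v|^2 for T = 1 - i K. *)
Lemma cayley_den_expand v : l2norm v <= l2norm (cayley_den K *m v).
Proof.
rewrite -(@ler_pXn2r _ 2) ?nnegrE ?l2norm_ge0 //.
have h : (l2norm (cayley_den K *m v) ^+ 2)%:C =
    (l2norm v ^+ 2 + l2norm (K *m v) ^+ 2)%:C.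
  rewrite rmorphD /= -(dot_sqr v) -(dot_sqr (K *m v)) -(dot_sqr (cayley_den K *m v)).
  rewrite (dot_ct (cayley_den K)) (dot_ct K) Ks !mulmxA.
  rewrite cayley_den_normal mulmxDl mul1mx.
  by rewrite /dot mulmxDr mxE.
by rewrite (complexI h) lerDl sqr_ge0.
Qed.

Lemma cayley_den_unit : cayley_den K \in unitmx.
Proof.
apply: unitmx_ker => v v0; apply: l2norm_eq0; apply/eqP.
rewrite eq_le l2norm_ge0 andbT; have := cayley_den_expand v.
by rewrite v0 l2norm0.
Qed.

Lemma cayley_resolventr : cayley_den K *m cayley_resolvent K = 1%:M.
Proof. exact: mulmxV cayley_den_unit. Qed.

Lemma cayley_resolventl : cayley_resolvent K *m cayley_den K = 1%:M.
Proof. exact: mulVmx cayley_den_unit. Qed.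

Lemma cayley_resolvent_norm : opnorm (cayley_resolvent K) <= 1.
Proof.
apply: opnorm_le => // v; rewrite mul1r.
by apply: le_trans (cayley_den_expand _) _; rewrite mulmxA cayley_resolventr mul1mx.
Qed.

Lemma cayley_unitary : unitary (cayley K).
Proof.
rewrite /unitary /cayley ctM ctK -mulmxA (mulmxA (cayley_den K)) -cayley_den_comm.
by rewrite -mulmxA cayley_resolventr mulmx1 -ctM cayley_resolventr ct1.
Qed.

Lemma cayleyE : cayley K = cayley_resolvent K + cayley_resolvent K - 1%:M.
Proof.
have e : (cayley_den K)^t* = 1%:M + 1%:M - cayley_den K.
  by rewrite cayley_den_ct /cayley_den opprB [_ - 1%:M]addrC addrA addrK.
by rewrite /cayley e mulmxBl mulmxDl !mul1mx cayley_resolventr.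
Qed.

Lemma cayley_resolvent_near1 : opnorm (cayley_resolvent K - 1%:M) <= opnorm K.
Proof.
have -> : cayley_resolvent K - 1%:M = (iC *: K) *m cayley_resolvent K.
  have -> : iC *: K = 1%:M - cayley_den K by rewrite /cayley_den opprB addrC subrK.
  by rewrite mulmxBl mul1mx cayley_resolventr.
apply: le_trans (opnormM_le (lexx _) cayley_resolvent_norm) _.
by rewrite mulr1 opnormZ nc_i mul1r.
Qed.

Lemma cayley_near1 : opnorm (cayley K - 1%:M) <= 2 * opnorm K.
Proof.
have -> : cayley K - 1%:M = (cayley_resolvent K - 1%:M) + (cayley_resolvent K - 1%:M).
  by rewrite cayleyE -addrA addrACA.
apply: le_trans (opnormD _ _) _.
by rewrite mulr_natl mulr2n; apply: lerD; exact: cayley_resolvent_near1.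
Qed.

End CayleyUnitary.

(** The resolvent identity. *)
Lemma cayley_resolvent_sub K K' : K^t* = K -> K'^t* = K' ->
  cayley_resolvent K - cayley_resolvent K' =
  iC *: (cayley_resolvent K *m (K - K') *m cayley_resolvent K').
Proof.
move=> Ks K's; have -> : iC *: (cayley_resolvent K *m (K - K') *m cayley_resolvent K') =
    cayley_resolvent K *m (cayley_den K' - cayley_den K) *m cayley_resolvent K'.
  rewrite scalemxAl scalemxAr; congr (_ *m _ *m _).
  by rewrite /cayley_den opprB [RHS]addrC addrA subrK scalerBr.
by rewrite mulmxBr mulmxBl cayley_resolventl // mul1mx -mulmxA cayley_resolventr // mulmx1.
Qed.

(** By [cayleyE] and the resolvent identity, Z = U'^* G (K - K') G' with G, G' the
    resolvents and U' the Cayley transform of K'.  The factors G, G' and U'^* are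
    within kp, kp and 2 kp of 1. *)
Lemma cayley_quotient K K' (kp : R) : K^t* = K -> K'^t* = K' ->
  opnorm K <= kp -> opnorm K' <= kp -> exists Z,
  (cayley K')^t* *m cayley K = 1%:M + (2 * iC) *: Z /\
  mxclose (4 * kp * opnorm (K - K')) Z (K - K').
Proof.
move=> Ks K's Kk Kk'; set X := K - K'.
set G := cayley_resolvent K; set G' := cayley_resolvent K'.
exists ((cayley K')^t* *m (G *m X *m G')); split.
  have -> : cayley K = cayley K' + (2 * iC) *: (G *m X *m G').
    rewrite !cayleyE // -/G -/G' -scalerA -cayley_resolvent_sub // -/G -/G'.
    rewrite scaler_nat mulr2n [RHS]addrAC; congr (_ - _).
    by rewrite addrACA [G' + (G - G')]addrC subrK.
  by rewrite mulmxDr (cayley_unitary K's) -scalemxAr.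
have nG : opnorm G <= 1 by exact: cayley_resolvent_norm.
have nG' : opnorm G' <= 1 by exact: cayley_resolvent_norm.
have h1 : mxclose kp G' 1%:M by exact: le_trans (cayley_resolvent_near1 K's) Kk'.
have h2 : mxclose kp G 1%:M by exact: le_trans (cayley_resolvent_near1 Ks) Kk.
have h3 : mxclose (2 * kp) ((cayley K')^t*) 1%:M.
  rewrite /mxclose -[X in _ - X]ct1 -ctB opnorm_ct.
  exact: le_trans (cayley_near1 K's) (ler_wpM2l (ler0n R 2) Kk').
have s1 := mxclose_mull (lexx (opnorm X)) h1; rewrite mulmx1 in s1.
have s2 := mxclose_mulr nG' (mxclose_mulr (lexx (opnorm X)) h2).
rewrite mul1mx in s2.
have nGXG : opnorm (G *m X *m G') <= 1 * opnorm X * 1.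
  exact: (opnormM_le (opnormM_le nG (lexx _)) nG').
have s3 := mxclose_mulr nGXG h3; rewrite mul1mx in s3.
apply: mxclose_le (mxclose_trans s3 (mxclose_trans s2 s1)).
move: (opnorm X) => a; rewrite le_eqVlt; apply/orP; left; apply/eqP; ring.
Qed.

End Cayley.

(** The bookkeeping of [orbit_separated], with x the norm of X, z that of
    Z, and y that of the commutator of Z and N. *)
Lemma separation_bound (R : realType) (d2 d dl kp z x D y : R) :
  0 <= d2 -> 0 <= d -> 0 <= dl -> 4 * kp <= 1 ->
  d2 * (4 * dl + 8 * kp * d) <= 1 / 2 ->
  0 <= x -> z <= x + 4 * kp * x -> 0 <= y ->
  x <= d2 * (y + ((z * dl + 4 * kp * x * d) + (dl * z + d * (4 * kp * x)))) ->
  2 * y <= D -> x <= d2 * D.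
Proof.
move=> D0 d0 dl0 kp4 hn x0 hz y0 hx hy.
have z2 : z <= 2 * x by have : 4 * kp * x <= 1 * x := ler_wpM2r x0 kp4; lra.
have h1 : dl * z <= dl * (2 * x) by rewrite ler_wpM2l.
have h2 : x <= d2 * (y + (4 * dl + 8 * kp * d) * x).
  apply: le_trans hx _; apply: ler_wpM2l => //; rewrite lerD2l; lra.
have h3 : d2 * (4 * dl + 8 * kp * d) * x <= 1 / 2 * x by rewrite ler_wpM2r.
have h4 : d2 * (2 * y) <= d2 * D by rewrite ler_wpM2l.
have : x <= d2 * y + d2 * (4 * dl + 8 * kp * d) * x.
  by apply: le_trans h2 _; rewrite le_eqVlt; apply/orP; left; apply/eqP; ring.
lra.
Qed.

Section Separation.
Variable R : realType.
Notation C := R[i].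
Variables (k d : nat) (V N : 'M[C]_k) (l : 'I_k -> nat) (dl kp : R).
Hypothesis Vu : unitary V.
Hypothesis ld : forall a, (l a < d)%N.
Hypothesis dl0 : 0 <= dl.
Hypothesis kp4 : 4 * kp <= 1.
Hypothesis num : d%:R ^+ 2 * (4 * dl + 8 * kp * d%:R) <= 1 / 2.
Hypothesis NH : mxclose dl (conj_diag V l) N.

Definition off_block (a b : 'I_k) := l a != l b.

Lemma off_block_sym : symmetric off_block.
Proof. by move=> a b; rewrite /off_block eq_sym. Qed.

(** The corners on the diagonal of an off-diagonal matrix are zero. *)
Lemma pinch_off_block Y : herm_supp off_block Y ->
  pinch d (eigen_proj V l) (V *m Y *m V^t*) = 0.
Proof.
move=> [_ Y0]; rewrite /pinch big1 // => j _.
rewrite /eigen_proj !(sandwichM _ _ Vu) (_ : _ *m Y *m _ = 0) ?mulmx0 ?mul0mx //.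
apply/matrixP => a b; rewrite /real_diag mul_diag_mx mul_mx_diag !mxE.
have [la|_] := eqVneq (l a) j; last by rewrite rmorph0 !mul0r.
have [lb|_] := eqVneq (l b) j; last by rewrite rmorph0 mulr0.
by rewrite Y0 ?mulr0 ?mul0r // /off_block la lb eqxx.
Qed.

Definition cayley_rotation (Y : 'M[C]_k) := cayley (V *m Y *m V^t*).

Lemma conj_ct Y : Y^t* = Y -> (V *m Y *m V^t*)^t* = V *m Y *m V^t*.
Proof. by move=> Ys; rewrite !ctM ctK Ys mulmxA. Qed.

Lemma cayley_rotation_unitary Y : Y^t* = Y -> unitary (cayley_rotation Y).
Proof. by move=> Ys; apply: cayley_unitary; exact: conj_ct. Qed.

(** Multiply the difference by U'^* on the left and by U on the right. *)
Lemma conj_twist (U U' : 'M[C]_k) : unitary U -> unitary U' ->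
  opnorm (U'^t* *m U *m N - N *m (U'^t* *m U)) <=
  opnorm (U *m N *m U^t* - U' *m N *m U'^t*).
Proof.
move=> Uu U'u.
have -> : U'^t* *m U *m N - N *m (U'^t* *m U) =
    U'^t* *m (U *m N *m U^t* - U' *m N *m U'^t*) *m U.
  rewrite mulmxBr mulmxBl !mulmxA -[_ *m U^t* *m U]mulmxA Uu mulmx1.
  by rewrite U'u mul1mx.
rewrite -[leRHS]mulr1 -[X in X * _]mul1r.
apply: opnormM_le; last exact: opnorm_unitary.
by apply: opnormM_le => //; apply/opnorm_unitary/unitary_ct.
Qed.

(** Let W = U'^* U, where U and U' are the two rotations.  By [cayley_quotient],
    W - 1 = 2 i Z with Z close to X = V (Y - Y') V^* relative to the norm of X.  So
    the commutator of W and N is close to 2 i times that of X and H = conj_diag V l,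
    whose norm is at least that of X divided by d^2, by [off_pinch], as X has zero
    pinching.  All errors are proportional to the norm of X, so N only has to be
    within a fixed distance of H. *)
Lemma orbit_separated Y Y' : herm_supp off_block Y -> herm_supp off_block Y' ->
  opnorm Y <= kp -> opnorm Y' <= kp ->
  opnorm (Y - Y') <= d%:R ^+ 2 *
    opnorm (cayley_rotation Y *m N *m (cayley_rotation Y)^t*
      - cayley_rotation Y' *m N *m (cayley_rotation Y')^t*).
Proof.
move=> hY hY' nY nY'.
have Ks := conj_ct hY.1; have K's := conj_ct hY'.1.
have nK : opnorm (V *m Y *m V^t*) <= kp by rewrite opnorm_conj.
have nK' : opnorm (V *m Y' *m V^t*) <= kp by rewrite opnorm_conj.
have [Z [WZ ZX]] := cayley_quotient Ks K's nK nK'.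
have := conj_twist (cayley_rotation_unitary hY.1) (cayley_rotation_unitary hY'.1).
move: (opnorm (cayley_rotation Y *m N *m (cayley_rotation Y)^t*
  - cayley_rotation Y' *m N *m (cayley_rotation Y')^t*)) => Dl.
rewrite /cayley_rotation WZ => hD.
have XE : V *m Y *m V^t* - V *m Y' *m V^t* = V *m (Y - Y') *m V^t*.
  by rewrite sandwichB.
have hYY : herm_supp off_block (Y - Y').
  apply: herm_suppD => //; rewrite -scaleN1r -(rmorphN1 (real_complex R)).
  exact: herm_suppZ.
rewrite XE in ZX; rewrite -(opnorm_conj (Y - Y') Vu).
have := pinch_off_block hYY.
move: (V *m (Y - Y') *m V^t*) ZX => X ZX X0.
have ZN : 2 * opnorm (Z *m N - N *m Z) <= Dl.
  have e : (1%:M + (2 * Complex 0 1) *: Z) *m N - N *m (1%:M + (2 * Complex 0 1) *: Z) =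
    (2 * Complex (0 : R) 1) *: (Z *m N - N *m Z).
    rewrite mulmxDl mulmxDr mul1mx mulmx1 opprD addrACA subrr add0r.
    by rewrite -scalemxAl -scalemxAr scalerBr.
  rewrite e opnormZ ncM nc_i mulr1 in hD.
  by rewrite -(rmorph_nat (real_complex R)) nc_real ger0_norm // in hD.
have QP := eigen_proj_family Vu ld; have hoff := off_pinch QP X.
rewrite X0 subr0 weighted_sum_eigen // in hoff.
have nH := conj_diag_norm Vu ld (R := R).
have zle : opnorm Z <= opnorm X + 4 * kp * opnorm X.
  exact: mxclose_norm (mxclose_sym ZX) (lexx _).
apply: (separation_bound _ _ dl0 kp4 num (opnorm_ge0 X) zle
  (opnorm_ge0 (Z *m N - N *m Z)) _ ZN); [by rewrite exprn_ge0|by []|].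
apply: le_trans hoff _; apply: ler_wpM2l; first by rewrite exprn_ge0.
have c1 := mxclose_trans (mxclose_mull (lexx (opnorm Z)) (mxclose_sym NH)) (mxclose_mulr nH ZX).
have c2 := mxclose_trans (mxclose_mulr (lexx (opnorm Z)) (mxclose_sym NH)) (mxclose_mull nH ZX).
exact: mxclose_norm (mxcloseD c1 (mxcloseN c2)) (lexx _).
Qed.

End Separation.

(** * The lower bound *)

Section Orbits.
Variable R : realType.
Notation C := R[i].

Lemma teval_conj k n (U : 'M[C]_k) (M : 'I_n -> 'M[C]_k) (t : term n) : unitary U ->
  teval (@scalar_mx C k) (fun i => U *m M i *m U^t*) t =
  U *m teval (@scalar_mx C k) M t *m U^t*.
Proof.
move=> Uu; elim: t => [i|a b|u hu v hv|u hu v hv] //=.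
- by rewrite scalar_mxC -mulmxA unitaryC // mulmx1.
- by rewrite hu hv mulmxDr mulmxDl.
- by rewrite hu hv [LHS](sandwichM _ _ Uu).
Qed.

Variables (A : cstarAlgType R) (n : nat) (p : nat -> ncpoly R n) (x : 'I_n -> A).
Hypothesis hp : is_enumeration p.

(** Unitary conjugation commutes with polynomials and preserves norms. *)
Lemma Gamma_top_conj k (e : R) m (U : 'M[C]_k) M : unitary U ->
  Gamma_top p x (k := k) e m M -> Gamma_top p x (k := k) e m (fun i => U *m M i *m U^t*).
Proof.
move=> Uu [Ms h]; split; first by move=> i; rewrite !ctM ctK Ms mulmxA.
move=> j jm; have := h j jm.
have [j0 _] := andP jm; have [t ht] := term_of_enumeration hp j0.
have na := matrix_normed R k.
rewrite (ht _ _ _ (fun i => U *m M i *m U^t*) na) (ht _ _ _ M na).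
by rewrite (teval_conj _ _ Uu) (opnorm_conj _ Uu).
Qed.

Lemma tuple_norm_ge k (M : 'I_n -> 'M[C]_k) i : opnorm (M i) <= tuple_norm M.
Proof. exact: le_bigmax. Qed.

Lemma orbit_lipschitz k (q : term n) (M c : 'I_n -> 'M[C]_k) (U U' : 'M[C]_k)
    (Rb L w : R) : (forall i, opnorm (M i) <= Rb) -> unitary U -> unitary U' -> 0 < w ->
  (forall (T : pzRingType) (f : C -> T) nu (y z : 'I_n -> T) (r : R),
    normed_alg f nu -> (forall i, nu (y i) <= Rb) -> (forall i, nu (z i) <= Rb) ->
    0 <= r -> (forall i, nu (y i - z i) <= r) ->
    nu (teval f y q - teval f z q) <= L * r) ->
  (forall i, opnorm (U *m M i *m U^t* - c i) < w) ->
  (forall i, opnorm (U' *m M i *m U'^t* - c i) < w) ->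
  opnorm (U *m teval (@scalar_mx C k) M q *m U^t* -
    U' *m teval (@scalar_mx C k) M q *m U'^t*) <= L * (w + w).
Proof.
move=> Mb Uu Uu' w0 hL h h'; rewrite -(teval_conj M q Uu) -(teval_conj M q Uu').
apply: (hL _ _ _ _ _ _ (matrix_normed R k)).
- by move=> i; rewrite (opnorm_conj _ Uu).
- by move=> i; rewrite (opnorm_conj _ Uu').
- by rewrite addr_ge0 // ltW.
by move=> i; exact: (mxclose_trans (mxcloseW (h i)) (mxclose_sym (mxcloseW (h' i)))).
Qed.

(** A covering of the microstates by N balls of radius w cuts the small off-diagonal
    hermitian matrices Y into N cells, according to the ball that contains the rotated
    tuple.  Two matrices in the same cell rotate M to tuples at distance at most 2 w,
    so the values of q differ by at most 2 L w, and [orbit_separated] bounds the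
    diameter of the cell. *)
Lemma covering_number_orbit k (e : R) m (q : term n) (M : 'I_n -> 'M[C]_k)
    (V : 'M[C]_k) (l : 'I_k -> nat) (d : nat) (dl kp Rb L w : R) :
  Gamma_top p x (k := k) e m M -> (forall i, opnorm (M i) <= Rb) ->
  unitary V -> (forall a, (l a < d)%N) ->
  mxclose dl (conj_diag V l) (teval (@scalar_mx C k) M q) ->
  0 <= dl -> 0 < kp -> 4 * kp <= 1 ->
  d%:R ^+ 2 * (4 * dl + 8 * kp * d%:R) <= 1 / 2 ->
  0 <= L -> 0 < w ->
  (forall (T : pzRingType) (f : C -> T) nu (y z : 'I_n -> T) (r : R),
    normed_alg f nu -> (forall i, nu (y i) <= Rb) -> (forall i, nu (z i) <= Rb) ->
    0 <= r -> (forall i, nu (y i - z i) <= r) ->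
    nu (teval f y q - teval f z q) <= L * r) ->
  ((((2 * L * d%:R ^+ 2 + 1) / kp * w) ^- support_card (off_block l))%:E <=
    covering_number (Gamma_top p x (k := k) e m) w)%E.
Proof.
move=> GM Mb Vu ld NH dl0 kp0 kp4 num L0 w0 hL.
set th := _ * w.
have d20 : 0 <= d%:R ^+ 2 :> R by rewrite exprn_ge0.
have K0 : 0 < 2 * L * d%:R ^+ 2 + 1 by rewrite ltr_wpDl // !mulr_ge0.
have th0 : 0 < th by rewrite mulr_gt0 // divr_gt0.
have thE : d%:R ^+ 2 * (L * (w + w)) <= kp * th.
  have -> : kp * th = (2 * L * d%:R ^+ 2 + 1) * w.
    by rewrite /th; field; rewrite gt_eqF.
  move: w0; lra.
clearbody th.
apply: le_ereal_inf_tmp => _ [N [c hc] <-]; rewrite lee_fin.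
pose orb (Y : 'M[C]_k) (i : 'I_n) := cayley_rotation V Y *m M i *m (cayley_rotation V Y)^t*.
pose good Y := herm_supp (off_block l) Y /\ opnorm Y <= kp.
have /choice[s sP] Y : exists t : nat, good Y ->
    exists tN : (t < N)%N, tuple_norm (fun i => orb Y i - c (Ordinal tN) i) < w.
  have [gY|nY] := pselect (good Y); last by exists 0%N.
  have [[t tN] ht] := hc _ (Gamma_top_conj (cayley_rotation_unitary V gY.1.1) GM).
  by exists t => _; exists tN.
apply: (herm_cells (@off_block_sym k l) (s := s) (r := kp)) => //.
- by move=> Y hY nY; have [] := sP Y (conj hY nY).
move=> Y Y' hY hY' nY nY' ss.
have [tN ht] := sP Y (conj hY nY); have := sP Y' (conj hY' nY').
rewrite -ss => -[tN' ht'].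
have Uu := cayley_rotation_unitary V hY.1; have Uu' := cayley_rotation_unitary V hY'.1.
apply: le_trans (orbit_separated Vu ld dl0 kp4 num NH hY hY' nY nY') _.
apply: le_trans thE; apply: ler_wpM2l => //.
have e12 : tN = tN' by exact: bool_irrelevance.
rewrite -e12 in ht'.
apply: (orbit_lipschitz Mb Uu Uu' w0 hL (c := c (Ordinal tN))).
- by move=> i; exact: le_lt_trans (tuple_norm_ge _ i) ht.
- by move=> i; exact: le_lt_trans (tuple_norm_ge _ i) ht'.
Qed.

Lemma support_card_off_block k (l : 'I_k -> nat) :
  (support_card (off_block l) + support_card (same_block l) = k ^ 2)%N.
Proof.
rewrite -(support_card_full k) /support_card addnC -(cardC [pred z | same_block l z.1 z.2]) /=.
by congr (_ + _)%N.
Qed.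

End Orbits.

Section Lower.
Variable R : realType.
Notation C := R[i].
Variables (A : cstarAlgType R) (n : nat) (p : nat -> ncpoly R n) (x : 'I_n -> A).
Hypothesis hp : is_enumeration p.
Hypothesis xsa : forall i, self_adjoint (x i).
Hypothesis xgen : generates x.
Hypothesis Adiv : approximately_divisible A.
Hypothesis micro : forall (e : R) (m : nat), 0 < e -> (0 < m)%N -> forall k0 : nat,
  exists k, [/\ (k0 <= k)%N, (0 < k)%N & Gamma_top p x (k := k) e m !=set0].

Lemma limn_esup_ge (u : nat -> \bar R) (c : \bar R) :
  (forall k0, exists2 k, (k0 <= k)%N & (c <= u k)%E) -> (c <= limn_esup u)%E.
Proof.
move=> h; apply: le_ereal_inf_tmp => _ [V [k0 _ hV] <-].
have [k kk ck] := h k0; apply: le_trans ck _.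
by apply: ereal_sup_ubound; exists k => //; exact: hV.
Qed.

(** For every precision there are microstates of arbitrarily large size, and the orbit
    of one of them already has a large covering number. *)
Lemma delta_top_at_ge (s : nat) : exists K w0 : R, [/\ 0 <= K, 0 < w0 &
  forall w, 0 < w -> w < w0 ->
  (((1 - (2 / 3) ^+ s) * (1 - K / (- ln w)))%:E <= delta_top_at p x w)%E].
Proof.
have [Rb Rb1 hRb] := generator_bound x.
pose d := (2 ^ s)%N; have d0 : (0 < d)%N by rewrite expn_gt0.
have d1 : 1 <= d%:R :> R by rewrite ler1n.
have [dl [kp [dl0 kp0 kp4 num]]] : exists dl kp : R, [/\ 0 < dl, 0 < kp, 4 * kp <= 1 &
    d%:R ^+ 2 * (4 * dl + 8 * kp * d%:R) <= 1 / 2].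
  have dp : 0 < d%:R :> R by exact: lt_le_trans d1.
  (* Each of the two summands becomes 1 / 4. *)
  exists (1 / (16 * d%:R ^+ 2)), (1 / (32 * d%:R ^+ 3)); split.
  - by rewrite divr_gt0 // mulr_gt0 // exprn_gt0.
  - by rewrite divr_gt0 // mulr_gt0 // exprn_gt0.
  - have h : 1 <= d%:R ^+ 3 :> R by rewrite exprn_ege1.
    rewrite mulrA mulr1 ler_pdivrMr ?mulr_gt0 ?exprn_gt0 //; move: h; lra.
  rewrite le_eqVlt; apply/orP; left; apply/eqP; field.
  by rewrite gt_eqF.
have [q [qsa _ qG]] := almost_central_diag hp xsa xgen Adiv s dl0.
have [L L0 hL] := @teval_lip R n Rb q.
pose K3 := Num.max 1 ((2 * L * d%:R ^+ 2 + 1) / kp).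
have K31 : 1 <= K3 by rewrite le_max lexx.
have K30 : 0 < K3 by exact: lt_le_trans K31.
pose eta : R := (2 / 3) ^+ s.
have eta1 : eta <= 1 by rewrite exprn_ile1 //; lra.
exists (ln K3), (K3^-1); split; [exact: ln_ge0|by rewrite invr_gt0|move=> w wp wK].
have K3w : K3 * w < 1 by rewrite -ltr_pdivlMl ?mulr1.
have w1 : w < 1 by apply: lt_le_trans wK _; rewrite invf_le1.
pose Lw := - ln w; have Lw0 : 0 < Lw by rewrite oppr_gt0 ln_lt0 // wp.
have Lw1 : 0 <= Lw - ln K3.
  by rewrite /Lw -opprD oppr_ge0 -lnM ?posrE // ln_le0 // mulrC ltW.
apply: le_ereal_inf_tmp => _ [e [m [e0 m0 ->]]].
have eG : micro_near p x (fun k M => Gamma_top p x (k := k) e m M) by exists e, m.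
have [e' [m' [e'0 m'0 hG]]] := micro_near_and eG
  (micro_near_and (micro_near_bounded x hp) qG).
apply: limn_esup_ge => k0; have [k [kk kp1 [M hM]]] := micro e'0 m'0 k0.
exists k => //; have [GM [Mb [V [l [Vu ld NH hl]]]]] := hG k M hM.
have Mb' i : opnorm (M i) <= Rb by exact: le_trans (Mb i) (hRb i).
have := covering_number_orbit hp GM Mb' Vu ld NH (ltW dl0) kp0 kp4 num L0 wp hL.
set cov := covering_number _ _; set E := support_card _ => hcov.
have k2 : 0 < k%:R ^+ 2 :> R by rewrite exprn_gt0 // ltr0n.
have Eb : (1 - eta) * k%:R ^+ 2 <= E%:R.
  have hs := support_card_same_block ld hl.
  have hE : (E + support_card (same_block l) = k ^ 2)%N by exact: support_card_off_block.
  have h3 : 0 < 3 ^+ s :> R by rewrite exprn_gt0.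
  have hs' : 3 ^+ s * (support_card (same_block l))%:R <= 2 ^+ s * k%:R ^+ 2 :> R.
    by rewrite -!natrX -!natrM ler_nat.
  have hE' : E%:R + (support_card (same_block l))%:R = k%:R ^+ 2 :> R.
    by rewrite -natrX -natrD hE.
  have : (support_card (same_block l))%:R <= eta * k%:R ^+ 2 :> R.
    by rewrite /eta expr_div_n mulrAC ler_pdivlMr // mulrC.
  move: hE'; lra.
clearbody E.
have cov2 : (((K3 * w) ^- E)%:E <= cov)%E.
  apply: le_trans hcov; rewrite lee_fin -!exprVn.
  have K0p : 0 < (2 * L * d%:R ^+ 2 + 1) / kp.
    by rewrite divr_gt0 // ltr_wpDl // !mulr_ge0 // exprn_ge0.
  have K03 : (2 * L * d%:R ^+ 2 + 1) / kp <= K3 by rewrite le_max lexx orbT.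
  move: (_ / kp) K0p K03 => K0 K0p K03.
  apply: lerXn2r; rewrite ?nnegrE ?invr_ge0 ?mulr_ge0 ?(ltW wp) ?(ltW K30) ?(ltW K0p) //.
  by rewrite lef_pV2 ?posrE ?mulr_gt0 // ler_pM2r.
have B0 : 0 < (K3 * w) ^- E by rewrite invr_gt0 exprn_gt0 // mulr_gt0.
have lc : ((ln ((K3 * w) ^- E))%:E <= lne cov)%E.
  rewrite -lne_EFin // lee_lne //.
  - by rewrite in_itv /= lee_fin (ltW B0) leey.
  - by rewrite in_itv /= covering_number_ge0 leey.
have kL : - k%:R ^+ 2 * ln w = k%:R ^+ 2 * Lw by rewrite /Lw mulrN mulNr.
rewrite kL; have kLp : 0 < k%:R ^+ 2 * Lw by rewrite mulr_gt0.
apply: (@le_trans _ _ ((ln ((K3 * w) ^- E))%:E * ((k%:R ^+ 2 * Lw)^-1)%:E)%E); last first.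
  by apply: lee_wpmul2r => //; rewrite lee_fin invr_ge0 ltW.
rewrite -EFinM lee_fin ler_pdivlMr //.
have -> : ln ((K3 * w) ^- E) = E%:R * (Lw - ln K3).
  rewrite -exprVn lnXn ?invr_gt0 ?mulr_gt0 // lnV ?posrE ?mulr_gt0 // lnM ?posrE //.
  by rewrite mulr_natl /Lw opprD addrC.
have -> : (1 - (2 / 3) ^+ s) * (1 - ln K3 / - ln w) * (k%:R ^+ 2 * Lw) =
   (1 - eta) * k%:R ^+ 2 * (Lw - ln K3).
  by rewrite -/eta -/Lw; field; rewrite gt_eqF.
exact: ler_wpM2r.
Qed.

End Lower.

(** * Microstates for arbitrary generators and the limit *)

Section Transfer.
Variable R : realType.
Notation C := R[i].
Variable p : forall n, nat -> ncpoly R n.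
Hypothesis hp : forall n, is_enumeration (p n).
Variable A : cstarAlgType R.
Hypothesis Aap : approximation_property p A.

Lemma increasing_ge (ks : nat -> nat) : (forall s, (ks s < ks s.+1)%N) ->
  forall s, (s <= ks s)%N.
Proof. by move=> h; elim=> // s ih; exact: leq_ltn_trans ih (h s). Qed.

(** Let y be the generators for which microstates exist.  Approximate each x i by the
    value of a hermitian term at y; the values of these terms at fine microstates of y
    are microstates of x, because the finitely many polynomials involved are
    Lipschitz. *)
Lemma microstates_exist n (x : 'I_n -> A) : (forall i, self_adjoint (x i)) ->
  forall (e : R) (m : nat), 0 < e -> (0 < m)%N -> forall k0 : nat,
  exists k, [/\ (k0 <= k)%N, (0 < k)%N & Gamma_top (p n) x (k := k) e m !=set0].
Proof.
move=> xsa e m e0 m0 k0; have [n' [y [ysa ygen hy]]] := Aap.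
have /choice[t ht] (j : 'I_m) : exists t : term n,
    forall (T : pzRingType) (f : C -> T) (nu : T -> R) z,
    normed_alg f nu -> nceval f z (p n j.+1) = teval f z t.
  exact: (term_of_enumeration (hp n)).
have [Rb Rb1 hRb] := generator_bound x.
have [L L0 hL] := teval_lip_fam Rb t.
pose dl := Num.min 1 (e / (2 * (L + 1))).
have L1 : 0 < 2 * (L + 1) by rewrite mulr_gt0 // ltr_wpDl.
have dl0 : 0 < dl by rewrite lt_min ltr01 divr_gt0.
have dl1 : dl <= 1 by rewrite ge_min lexx.
have dlL : L * dl < e / 2.
  have : dl * (2 * (L + 1)) <= e by rewrite -ler_pdivlMr // ge_min lexx orbT.
  move: dl0; lra.
have /choice[u hu] i : exists u : term n',
    cnorm (x i - teval (fun c => c%:A : A) y (tsym u)) < dl.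
  exact: sym_terms_dense.
pose tau i := tsym (u i).
have naA := cstar_normed A.
have ub i : cnorm (teval (fun c => c%:A : A) y (tau i)) <= Rb.
  apply: le_trans (hRb i).
  have -> : teval (fun c => c%:A : A) y (tau i) =
      x i - (x i - teval (fun c => c%:A : A) y (tau i)) by rewrite opprB addrC subrK.
  apply: le_trans (cnorm_leD _ _) _; rewrite cnormN lerD2l.
  exact: ltW (lt_le_trans (hu i) dl1).
have xb i : cnorm (x i) <= Rb by have := hRb i; lra.
have e2 : 0 < e / 2 by rewrite divr_gt0.
have [e' [m' [e'0 m'0 hG]]] := micro_near_and (micro_near_herm (p n') y)
  (micro_near_all (fun j : 'I_m =>
  micro_near_term y (hp n') (tsubst tau (t j)) e2)).
have [ks [ks0 ksS ksG]] := hy m' e' m'0 e'0.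
exists (ks k0); split; [exact: increasing_ge|exact: ks0|].
have [M hM] := ksG k0; have [Ms Mt] := hG _ _ hM.
exists (fun i => teval (@scalar_mx C _) M (tau i)); split.
  by move=> i; exact: teval_ct.
move=> [//|j] /andP[_ jm]; have := Mt (Ordinal jm).
rewrite !teval_subst => h1.
have h2 := hL (Ordinal jm) _ _ _ _ _ _ naA xb ub (ltW dl0) (fun i => ltW (hu i)).
rewrite (ht (Ordinal jm) _ _ _ _ (matrix_normed R _)) (ht (Ordinal jm) _ _ _ _ naA).
set a := teval _ x _ in h2 *.
set b := teval _ (fun i => teval (fun c => c%:A : A) y (tau i)) _ in h1 h2.
have h3 : cnorm a <= cnorm b + cnorm (a - b).
  by apply: le_trans (cnorm_leD _ _); rewrite addrC subrK.
have h4 : cnorm b <= cnorm a + cnorm (a - b).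
  by rewrite cnormBC; apply: le_trans (cnorm_leD _ _); rewrite addrC subrK.
move: h1 h2 h3 h4 dlL.
move: (cnorm (a - b)) (cnorm a) (cnorm b) (opnorm _) (L * dl) => z1 z2 z3 z4 z5.
rewrite !ltr_norml => /andP[? ?] ? ? ? ?; apply/andP; split; lra.
Qed.

End Transfer.

Section Limits.
Variable R : realType.

Lemma geometric_small (e : R) : 0 < e -> exists s : nat, (2 / 3 : R) ^+ s <= e.
Proof.
move=> e0; apply/not_existsP => h.
have : (3 / 2 : R) <= 1; last by lra.
apply: (@pow_bounded_le1 _ _ (e^-1)); first by lra.
move=> j; have -> : (3 / 2 : R) = (2 / 3)^-1 by rewrite invf_div.
rewrite exprVn lef_pV2 ?posrE ?exprn_gt0 //.
by rewrite leNgt; apply/negP => hj; apply: (h j); exact: ltW.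
Qed.

Lemma log_small (K e : R) : 0 <= K -> 0 < e -> exists2 w0 : R, 0 < w0 &
  forall w, 0 < w -> w < w0 -> w < 1 /\ K / (- ln w) <= e.
Proof.
move=> K0 e0; exists (expR (- (K / e + 1))); first exact: expR_gt0.
move=> w wp ww.
have h : ln w < - (K / e + 1) by rewrite -[ltRHS]expRK ltr_ln ?posrE ?expR_gt0.
have k0 : 0 <= K / e by rewrite divr_ge0 // ltW.
split.
  have : ln w < 0 by move: h k0; lra.
  by rewrite -[X in _ < X -> _](@ln1 R) ltr_ln ?posrE.
have h2 : K / e <= - ln w by move: h; lra.
have lp : 0 < - ln w by move: h k0; lra.
by rewrite ler_pdivrMr // mulrC -ler_pdivrMr.
Qed.

Lemma limf_esup_right_eq1 (f : R -> \bar R) :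
  (forall e : R, 0 < e -> exists2 w0 : R, 0 < w0 & forall w, 0 < w -> w < w0 ->
     ((1 - e)%:E <= f w <= (1 + e)%:E)%E) ->
  limf_esup f 0^'+ = 1%:E.
Proof.
move=> h; apply/eqP; rewrite eq_le; apply/andP; split.
  apply/lee_addgt0Pr => e e0; have [w0 w00 hw] := h e e0.
  apply: (@le_trans _ _ (ereal_sup (f @` [set w | 0 < w /\ w < w0]))).
    apply: ereal_inf_lbound; exists [set w | 0 < w /\ w < w0] => //.
    by near=> w; split; near: w; [exact: nbhs_right_gt|exact: nbhs_right_lt].
  apply: ge_ereal_sup => _ [w [wp ww] <-].
  by have /andP[] := hw w wp ww.
apply: le_ereal_inf_tmp => _ [V VF <-].
apply/lee_subgt0Pr => e e0; have [w0 w00 hw] := h e e0.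
have [w [[Vw wp] ww]] : exists w, (V w /\ 0 < w) /\ w < w0.
  apply: (@filter_ex _ (0 : R)^'+); apply: filterI; last exact: nbhs_right_lt.
  by apply: filterI => //; exact: nbhs_right_gt.
apply: (@le_trans _ _ (f w)); first by have /andP[] := hw w wp ww.
by apply: ereal_sup_ubound; exists w.
Unshelve. all: by end_near.
Qed.

End Limits.

Theorem theorem4p3 (R : realType)
  (p : forall n : nat, nat -> ncpoly R n)
  (hp : forall n : nat, is_enumeration (p n))
  (A : cstarAlgType R)
  (Asep : separable_cstar A)
  (Adiv : approximately_divisible A)
  (Aap : approximation_property p A)
  (n : nat) (x : 'I_n -> A)
  (xsa : forall i : 'I_n, self_adjoint (x i))
  (xgen : generates x) :
  delta_top (p n) x = 1%:E.
Proof.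
apply: limf_esup_right_eq1 => e e0.
have e3 : 0 < e / (2 * (n%:R + 1)) by rewrite divr_gt0 // mulr_gt0 // ltr_wpDl.
have [s hs] := geometric_small e3.
have n0 : 0 <= n%:R :> R by [].
have s0 : 0 <= (2 / 3 : R) ^+ s by rewrite exprn_ge0.
have hs2 : (2 / 3 : R) ^+ s * (2 * (n%:R + 1)) <= e.
  by rewrite -ler_pdivlMr // mulr_gt0 // ltr_wpDl.
have s1 : (2 / 3 : R) ^+ s <= 1 by rewrite exprn_ile1 //; lra.
have [K K0 hK] := delta_top_at_le (hp n) xsa xgen Adiv s.
have [K' [w' [K'0 w'0 hK']]] := delta_top_at_ge (hp n) xsa xgen Adiv
  (microstates_exist hp Aap xsa) s.
have e2 : 0 < e / 2 by rewrite divr_gt0.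
have [w1 w10 hw1] := log_small K0 e2.
have [w2 w20 hw2] := log_small K'0 e2.
exists (Num.min w' (Num.min w1 w2)); first by rewrite !lt_min w'0 w10.
move=> w wp; rewrite !lt_min => /and3P[ww' ww1 ww2].
have [wl1 hu] := hw1 w wp ww1; have [_ hl] := hw2 w wp ww2.
have ns : 0 <= n%:R * (2 / 3 : R) ^+ s by rewrite mulr_ge0.
apply/andP; split.
  apply: le_trans (hK' w wp ww'); rewrite lee_fin.
  have lp : 0 < - ln w by rewrite oppr_gt0 ln_lt0 // wp.
  have kl : 0 <= K' / (- ln w) by rewrite divr_ge0 // ltW.
  move: hl kl s0 s1 hs2 ns; move: (_ ^+ s) (K' / _) => a b.
  nra.
apply: le_trans (hK w wp wl1) _; rewrite lee_fin.
move: hu hs2 ns s0; move: (_ ^+ s) (K / _) => a b; nra.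
Qed.
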